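(* Let $\epsilon>0$ be arbitrarily small. Then as $n\to\infty$, for positive integers $k\ll n^{\frac18-\epsilon}$, $$M_k(n)=\frac{\pi}{12\sqrt{2}}\,k\,n^{-\frac32}e^{\frac{2\pi\sqrt{n}}{\sqrt{6}}}+O\left(k^3n^{-\frac74}e^{\frac{2\pi\sqrt{n}}{\sqrt{6}}}\right).$$ That is: for every $\epsilon>0$ and $C>0$ there are constants $K>0$ and $N$ such that for all integers $n\ge N$ and all integers $k$ with $1\le k\le Cn^{\frac18-\epsilon}$, $$\left|M_k(n)-\frac{\pi}{12\sqrt{2}}\,k\,n^{-\frac32}e^{\frac{2\pi\sqrt{n}}{\sqrt{6}}}\right|\le K\,k^3n^{-\frac74}e^{\frac{2\pi\sqrt{n}}{\sqrt{6}}}.$$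
   Context: For an integer $m$, $p(m)$ denotes the number of partitions of $m$, with $p(0)=1$ and $p(m)=0$ for $m<0$. For positive integers $n$ and $k$, $$M_k(n):=(-1)^{k-1}\sum_{j=0}^{k-1}(-1)^j\Big(p\big(n-j(3j+1)/2\big)-p\big(n-j(3j+5)/2-1\big)\Big).$$ *)

(* Defs.v *)
From Stdlib Require Import ZArith Reals.
From mathcomp Require Import all_boot.

Set Implicit Arguments.
Unset Strict Implicit.
Unset Printing Implicit Defensive.

Definition is_partition (n : nat) (s : seq nat) : bool :=
  [&& sorted geq s, 0 \notin s & sumn s == n].

(* A partition of n has at most n parts, each at most n, so that the bounded
   sequences below include every partition (see [is_partition_bseq]). *)
Definition partitions (n : nat) : {set n.-bseq 'I_n.+1} :=
  [set s : n.-bseq 'I_n.+1 | is_partition n (map val s)].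

Lemma is_partition_bseq (n : nat) (s : seq nat) :
  is_partition n s ->
  exists2 t : n.-bseq 'I_n.+1, t \in partitions n & map val t = s.
Proof.
move=> Ps; have /and3P[_ s0 /eqP sn] := Ps.
have size_le : size s <= n.
  rewrite -sn {Ps sn}; elim: s s0 => //= x s IHs.
  rewrite inE negb_or eq_sym -lt0n => /andP[x0 /IHs le_s].
  by rewrite -add1n leq_add.
have part_le x : x \in s -> x <= n.
  rewrite -sn {Ps sn s0 size_le}; elim: s => //= y s IHs.
  rewrite inE => /predU1P[->|/IHs le_x]; first exact: leq_addr.
  exact: leq_trans le_x (leq_addl _ _).
have valK : map val (map (@inord n) s) = s.
  rewrite -map_comp -[RHS]map_id; apply/eq_in_map => x xs /=.
  by rewrite inordK // ltnS part_le.
have size_t : size (map (@inord n) s) <= n by rewrite size_map.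
by exists (Bseq size_t); rewrite ?inE /= valK.
Qed.

Definition p (m : Z) : nat :=
  if (m <? 0)%Z then 0 else #|partitions (Z.to_nat m)|.

Local Open Scope R_scope.

(* Meant for k > 0 only.  [sum_f_R0 f m] includes the term of index m, and both
   divisions by 2 are exact. *)
Definition M (k n : nat) : R :=
  (-1) ^ (k - 1) *
   sum_f_R0 (fun j : nat =>
     let n' := Z.of_nat n in
     let j' := Z.of_nat j in
     (-1) ^ j * (INR (p (n' - j' * (3 * j' + 1) / 2)%Z)
                 - INR (p (n' - j' * (3 * j' + 5) / 2 - 1)%Z)))
   (k - 1).

(* Main.v *)
(* Since [p n - p (n - 1)] is the n-th coefficient of (1 - q) P(q), where P is the
   generating function of partitions, it is an integral of (1 - q) P(q) q^{-n} over the
   circle of radius e^{-s}. At the saddle point s = PI / sqrt (6 n) the integrand is compared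
   with s cos^{2M}(x/2), where M ~ 2 PI^2 / (3 s^3) gives the same Gaussian width: near x = 0
   modulus and argument of each factor 1/(1 - q^m) are expanded to second order, and away from
   0 the integrand is exponentially small. The moments that occur are Riemann sums of
   t / (e^t - 1) and its relatives, and log P(e^{-s}) is evaluated by the trapezoidal rule and
   Stirling's formula. This gives
     p n - p (n - 1) = PI / (12 sqrt 2) n^{-3/2} e^{2 PI sqrt (n / 6)} (1 + O(n^{-1/4})).
   The j-th term of M_k(n) is a sum of 2j + 1 such differences at arguments n - O(k^2), over
   which the main term varies by a factor 1 + O(k^2 n^{-1/2}), and
   sum_{j < k} (-1)^j (2j + 1) = (-1)^{k-1} k. *)
From Stdlib Require Import ZArith Reals Lra Lia Psatz.
From Coquelicot Require Import Coquelicot.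

Local Open Scope R_scope.

(** * Finite sums and the functions t / (e^t - 1) and t^2 e^t / (e^t - 1)^2 *)

(** Subtracting asymptotics for [p n] and [p (n - 1)] would not do: their difference is smaller than
    either by a factor of order n^{-1/2}, below a relative error of n^{-1/4}. So the factor 1 - q
    stays inside the integral, where it contributes s. The product is cut off at m <= n, which
    leaves the coefficients up to index n unchanged and makes every sum finite; modulus and argument
    are handled as real functions. At n s^2 = PI^2 / 6 the linear part of the argument cancels the
    phase n x up to a small error. Comparing with a power of the cosine instead of a Gaussian lets
    Wallis' recurrence bound the integral sharply, and the same recurrence serves Stirling's formula
    and zeta(2). In the estimates [q] denotes sqrt s, of order n^{-1/4}. The peak has width q^3, the
    main integral has order q^5 and the errors have order q^6; this relative loss q is what the
    error term k^3 n^{-7/4} allows. The analysis sees partitions only through a function [c N n]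
    with the recurrence of partitions of n into parts at most N. *)

Fixpoint sum1 (f : nat -> R) (n : nat) : R :=
  match n with
  | O => 0
  | S n' => sum1 f n' + f n
  end.

Lemma sum1_S (f : nat -> R) (n : nat) : sum1 f (S n) = sum1 f n + f (S n).
Proof. reflexivity. Qed.

Lemma sum1_ext (f g : nat -> R) (n : nat) :
  (forall m, (1 <= m <= n)%nat -> f m = g m) -> sum1 f n = sum1 g n.
Proof.
  induction n as [|n IH]; intros H; simpl; [reflexivity|].
  rewrite IH, (H (S n)); [reflexivity|lia|intros; apply H; lia].
Qed.

Lemma sum1_le (f g : nat -> R) (n : nat) :
  (forall m, (1 <= m <= n)%nat -> f m <= g m) -> sum1 f n <= sum1 g n.
Proof.
  induction n as [|n IH]; intros H; simpl; [lra|].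
  apply Rplus_le_compat; [apply IH; intros; apply H; lia|apply H; lia].
Qed.

Lemma sum1_plus (f g : nat -> R) (n : nat) :
  sum1 (fun m => f m + g m) n = sum1 f n + sum1 g n.
Proof. induction n as [|n IH]; simpl; [lra|rewrite IH; lra]. Qed.

Lemma sum1_scal (c : R) (f : nat -> R) (n : nat) :
  sum1 (fun m => c * f m) n = c * sum1 f n.
Proof. induction n as [|n IH]; simpl; [lra|rewrite IH; lra]. Qed.

Lemma sum1_const (c : R) (n : nat) : sum1 (fun _ => c) n = INR n * c.
Proof. induction n as [|n IH]; [simpl; lra|]. rewrite S_INR; simpl; rewrite IH; lra. Qed.

Lemma sum1_nonneg (f : nat -> R) (n : nat) :
  (forall m, (1 <= m <= n)%nat -> 0 <= f m) -> 0 <= sum1 f n.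
Proof.
  intros H; replace 0 with (sum1 (fun _ => 0) n) by (rewrite sum1_const; lra).
  now apply sum1_le.
Qed.

Lemma sum1_Rabs (f : nat -> R) (n : nat) :
  Rabs (sum1 f n) <= sum1 (fun m => Rabs (f m)) n.
Proof.
  induction n as [|n IH]; simpl; [rewrite Rabs_R0; lra|].
  eapply Rle_trans; [apply Rabs_triang|lra].
Qed.

Lemma sum1_Rabs_le (f g : nat -> R) (n : nat) :
  (forall m, (1 <= m <= n)%nat -> Rabs (f m) <= g m) ->
  Rabs (sum1 f n) <= sum1 g n.
Proof.
  intros H; eapply Rle_trans; [apply sum1_Rabs|now apply sum1_le].
Qed.

Lemma sum1_minus (f g : nat -> R) (n : nat) :
  sum1 (fun m => f m - g m) n = sum1 f n - sum1 g n.
Proof. induction n as [|n IH]; simpl; [lra|rewrite IH; lra]. Qed.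

Lemma sum1_le_n (f : nat -> R) (n N : nat) :
  (n <= N)%nat -> (forall m, (1 <= m <= N)%nat -> 0 <= f m) ->
  sum1 f n <= sum1 f N.
Proof.
  induction N as [|N IH]; intros Hn H.
  - replace n with 0%nat by lia; lra.
  - destruct (Nat.eq_dec n (S N)) as [->|]; [lra|].
    simpl; assert (0 <= f (S N)) by (apply H; lia).
    assert (sum1 f n <= sum1 f N) by (apply IH; [lia|intros; apply H; lia]); lra.
Qed.

(* [field] may fail on terms containing [exp (- t)] unless they are made opaque. *)
Ltac gen_exp :=
  repeat match goal with
  | |- context [exp ?a] => generalize dependent (exp a); intros
  end.

Lemma exp_neg (x : R) : exp (- x) * exp x = 1.
Proof. rewrite <- exp_plus, Rplus_opp_l; apply exp_0. Qed.

Lemma exp_le (x y : R) : x <= y -> exp x <= exp y.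
Proof.
  intros [H| ->]; [left; now apply exp_increasing|lra].
Qed.

(** Telescopes after multiplication by exp a - 1, which is at least a. The expansion errors of the
    single factors are later summed by this bound. *)
Lemma sum1_geom (a : R) (n : nat) : 0 < a ->
  sum1 (fun m => exp (- (INR m * a))) n <= / a.
Proof.
  intros Ha.
  assert (Hs : sum1 (fun m => exp (- (INR m * a))) n * (exp a - 1)
               = 1 - exp (- (INR n * a))).
  { induction n as [|n IH].
    - simpl; replace (- (0 * a)) with 0 by lra; rewrite exp_0; lra.
    - rewrite sum1_S, Rmult_plus_distr_r, IH.
      replace (- (INR n * a)) with (- (INR (S n) * a) + a) by (rewrite S_INR; lra).
      rewrite exp_plus; ring. }
  assert (H1 := exp_ineq1_le a).
  assert (H2 := exp_pos (- (INR n * a))).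
  assert (H3 : 0 <= sum1 (fun m => exp (- (INR m * a))) n)
    by (apply sum1_nonneg; intros; left; apply exp_pos).
  apply Rmult_le_reg_r with a; [assumption|].
  rewrite Rinv_l by lra; nra.
Qed.

Lemma mvt (f df : R -> R) (a b : R) :
  a <= b -> (forall x, a <= x <= b -> is_derive f x (df x)) ->
  exists c, a <= c <= b /\ f b - f a = df c * (b - a).
Proof.
  intros Hab H.
  destruct (MVT_gen f a b df) as [c [Hc E]].
  - intros x; rewrite Rmin_left, Rmax_right by assumption; intros; apply H; lra.
  - intros x; rewrite Rmin_left, Rmax_right by assumption; intros Hx.
    apply continuity_pt_filterlim, (ex_derive_continuous f).
    eexists; now apply H.
  - rewrite Rmin_left, Rmax_right in Hc by assumption; eauto.
Qed.

Lemma derive_ge0_le (f df : R -> R) (a b : R) :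
  a <= b -> (forall x, a <= x <= b -> is_derive f x (df x)) ->
  (forall x, a <= x <= b -> 0 <= df x) -> f a <= f b.
Proof.
  intros Hab H H0; destruct (mvt f df a b Hab H) as [c [Hc E]].
  assert (0 <= df c) by now apply H0. nra.
Qed.

Lemma exp_neg_lt1 (t : R) : 0 < t -> exp (- t) < 1.
Proof. intros; rewrite <- exp_0; apply exp_increasing; lra. Qed.

(** The last inequality is 1 + t <= exp t rearranged; read as t / (1 - exp (- t)) <= 1 + t, it later
    trades powers of 1 / (1 - r) for polynomials. *)
Lemma exp_neg_bounds (t : R) : 0 <= t ->
  1 - t <= exp (- t) <= 1 /\ t <= (1 + t) * (1 - exp (- t)).
Proof.
  intros Ht; assert (H := exp_ineq1_le (- t)); assert (H1 := exp_ineq1_le t).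
  assert (H2 := exp_neg t); assert (H3 := exp_pos (- t)).
  assert (exp (- t) <= 1) by (rewrite <- exp_0; apply exp_le; lra).
  repeat split; nra.
Qed.

(** At r = exp (- t) and angle t z, the functions [arg] and [ln_mod] below are z [bose t] and - z^2
    / 2 [bose2 t] to leading order. *)
Definition bose (t : R) : R := t * exp (- t) / (1 - exp (- t)).
Definition bose2 (t : R) : R := t ^ 2 * exp (- t) / (1 - exp (- t)) ^ 2.

Lemma bose_bounds (t : R) : 0 < t -> 0 <= bose t /\ 1 - t <= bose t <= 1.
Proof.
  intros Ht; assert (H := exp_neg_lt1 t Ht); assert (H1 := exp_pos (- t)).
  destruct (exp_neg_bounds t) as [[H2 H3] H4]; [lra|].
  unfold bose; repeat split.
  - apply Rmult_le_pos; [nra|left; apply Rinv_0_lt_compat; lra].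
  - apply Rmult_le_reg_r with (1 - exp (- t)); [lra|].
    field_simplify; [nra|lra].
  - apply Rmult_le_reg_r with (1 - exp (- t)); [lra|].
    field_simplify; [nra|lra].
Qed.

Lemma bose_decr (a b : R) : 0 < a <= b -> bose b <= bose a.
Proof.
  intros Hab.
  enough (- bose a <= - bose b) by lra.
  apply (derive_ge0_le (fun t => - bose t)
    (fun t => - ((exp (- t) - t * exp (- t)) * (1 - exp (- t)) - t * exp (- t) * exp (- t))
       / (1 - exp (- t)) ^ 2)); [lra| |].
  - intros x Hx; assert (Hx0 : 0 < x) by lra; assert (H := exp_neg_lt1 x Hx0).
    unfold bose; auto_derive; [lra|gen_exp; field; lra].
  - intros x Hx; assert (Hx0 : 0 < x) by lra; assert (H := exp_neg_lt1 x Hx0).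
    assert (H1 := exp_pos (- x)); assert (H2 := exp_ineq1_le (- x)).
    apply Rmult_le_pos; [nra|left; apply Rinv_0_lt_compat; nra].
Qed.

(** This is 2 sinh (t / 2). Through [bose2_sh] it reduces the bounds and the monotonicity of [bose2]
    to those of t / sh t. *)
Definition sh (t : R) : R := exp (t / 2) - exp (- (t / 2)).

Lemma sh_ge (t : R) : 0 <= t -> t <= sh t.
Proof.
  intros Ht.
  enough (H : sh 0 - 0 <= sh t - t) by (unfold sh at 1 in H; rewrite Rdiv_0_l, Ropp_0 in H; lra).
  apply (derive_ge0_le (fun t => sh t - t)
    (fun t => (exp (t / 2) + exp (- (t / 2))) / 2 - 1)); [lra| |].
  - intros x _; unfold sh, Rdiv; auto_derive; [exact I|gen_exp; field].
  - intros x _; assert (H := exp_neg (x / 2)); assert (H1 := exp_pos (x / 2)).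
    assert (H2 := exp_pos (- (x / 2))).
    assert (0 <= (exp (x / 2) - exp (- (x / 2))) ^ 2) by apply pow2_ge_0. nra.
Qed.

Lemma bose2_sh (t : R) : 0 < t -> bose2 t = (t / sh t) ^ 2.
Proof.
  intros Ht; assert (H := sh_ge t); unfold bose2, sh in *.
  assert (H3 : exp (t / 2) - exp (- (t / 2)) > 0) by lra.
  assert (H1 : exp (- t) = exp (- (t / 2)) * exp (- (t / 2)))
    by (rewrite <- exp_plus; f_equal; lra).
  assert (H2 := exp_neg (t / 2)).
  replace (1 - exp (- t)) with (exp (- (t / 2)) * (exp (t / 2) - exp (- (t / 2))))
    by (rewrite H1; nra).
  rewrite H1; field; split; [lra|]. apply Rgt_not_eq, exp_pos.
Qed.

Lemma bose2_bounds (t : R) : 0 < t -> 0 <= bose2 t <= 1.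
Proof.
  intros Ht; rewrite bose2_sh by assumption.
  assert (H := sh_ge t); split; [apply pow2_ge_0|].
  assert (0 <= t / sh t <= 1).
  { split; [apply Rmult_le_pos; [lra|left; apply Rinv_0_lt_compat; lra]|].
    apply Rmult_le_reg_r with (sh t); [lra|]. field_simplify; lra. }
  nra.
Qed.

Lemma bose2_decr (a b : R) : 0 < a <= b -> bose2 b <= bose2 a.
Proof.
  intros Hab; rewrite !bose2_sh by lra.
  assert (Ha := sh_ge a); assert (Hb := sh_ge b).
  enough (H : b / sh b <= a / sh a).
  { assert (0 <= b / sh b) by (apply Rmult_le_pos; [lra|left; apply Rinv_0_lt_compat; lra]).
    nra. }
  enough (- (a / sh a) <= - (b / sh b)) by lra.
  apply (derive_ge0_le (fun t => - (t / sh t))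
    (fun t => (t * ((exp (t / 2) + exp (- (t / 2))) / 2) - sh t) / sh t ^ 2)); [lra| |].
  - intros x Hx; assert (H := sh_ge x); unfold sh, Rdiv in *; auto_derive; [lra|gen_exp; field; lra].
  - intros x Hx; assert (H := sh_ge x).
    apply Rmult_le_pos; [|left; apply Rinv_0_lt_compat; nra].
    (* The numerator t cosh (t / 2) - 2 sinh (t / 2) vanishes at 0 and has derivative t sh t / 4 >=
       0. *)
    enough (H1 : 0 * ((exp (0 / 2) + exp (- (0 / 2))) / 2) - sh 0
             <= x * ((exp (x / 2) + exp (- (x / 2))) / 2) - sh x).
    { unfold sh at 1 in H1; rewrite Rdiv_0_l, Ropp_0 in H1; lra. }
    apply (derive_ge0_le (fun x => x * ((exp (x / 2) + exp (- (x / 2))) / 2) - sh x)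
      (fun x => x * sh x / 4)); [lra| |].
    + intros y _; unfold sh, Rdiv; auto_derive; [exact I|gen_exp; field].
    + intros y Hy; assert (H2 := sh_ge y); nra.
Qed.

(** * Wallis integrals, Stirling's formula and zeta(2) *)

Lemma ex_RInt_cont (f : R -> R) (a b : R) :
  (forall x, continuous f x) -> ex_RInt f a b.
Proof. intros H; apply (ex_RInt_continuous (V := R_CompleteNormedModule)); auto. Qed.

Lemma RInt_lin (f g : R -> R) (c d a b : R) :
  ex_RInt f a b -> ex_RInt g a b ->
  RInt (fun x => c * f x + d * g x) a b = c * RInt f a b + d * RInt g a b.
Proof.
  intros Hf Hg.
  rewrite <- (RInt_scal (V := R_CompleteNormedModule) f a b c Hf : _ = c * _).
  rewrite <- (RInt_scal (V := R_CompleteNormedModule) g a b d Hg : _ = d * _).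
  apply (RInt_plus (V := R_CompleteNormedModule) (fun x => c * f x) (fun x => d * g x)).
  - exact (ex_RInt_scal (V := R_CompleteNormedModule) f a b c Hf).
  - exact (ex_RInt_scal (V := R_CompleteNormedModule) g a b d Hg).
Qed.

Lemma RInt_deriv (f df : R -> R) (a b : R) :
  (forall x, is_derive f x (df x)) -> (forall x, continuous df x) ->
  RInt df a b = f b - f a.
Proof.
  intros H H1.
  apply (is_RInt_unique (V := R_CompleteNormedModule) df a b).
  apply (is_RInt_derive (V := R_CompleteNormedModule) f df); auto.
Qed.

Definition wallis (n : nat) : R := RInt (fun x => cos x ^ n) 0 (PI / 2).

Lemma continuous_cos_pow (n : nat) (x : R) : continuous (fun x => cos x ^ n) x.
Proof.
  apply (ex_derive_continuous (fun x => cos x ^ n)); auto_derive; exact I.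
Qed.

(** Integrate the derivative of sin x cos^{n+1} x, which vanishes at both ends. *)
Lemma wallis_rec (n : nat) : INR (n + 2) * wallis (n + 2) = INR (n + 1) * wallis n.
Proof.
  assert (H : RInt (fun x => INR (n + 2) * cos x ^ (n + 2) + - INR (n + 1) * cos x ^ n)
                   0 (PI / 2) = 0).
  { rewrite (RInt_deriv (fun x => sin x * cos x ^ S n)).
    - rewrite cos_PI2, sin_0; simpl; lra.
    - intros x; auto_derive; [exact I|].
      replace (n + 2)%nat with (S (S n)) by lia.
      replace (n + 1)%nat with (S n) by lia.
      rewrite !S_INR, <- !tech_pow_Rmult.
      assert (H := sin2_cos2 x); unfold Rsqr in H.
      change (Init.Nat.pred (S n)) with n.
      replace (match n with 0%nat => 1 | S _ => INR n + 1 end) with (INR n + 1)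
        by (destruct n; simpl; lra).
      transitivity (cos x * (cos x * cos x ^ n)
                    - (sin x * sin x) * ((INR n + 1) * cos x ^ n)); [ring|].
      replace (sin x * sin x) with (1 - cos x * cos x) by lra; ring.
    - intros x; apply (ex_derive_continuous (fun x => _ + _)); auto_derive; exact I. }
  rewrite RInt_lin in H by (apply ex_RInt_cont, continuous_cos_pow).
  unfold wallis; lra.
Qed.

Lemma wallis_0 : wallis 0 = PI / 2.
Proof.
  unfold wallis; simpl.
  rewrite (RInt_const (V := R_CompleteNormedModule)).
  change (scal (PI / 2 - 0) 1) with ((PI / 2 - 0) * 1); lra.
Qed.

Lemma wallis_1 : wallis 1 = 1.
Proof.
  unfold wallis; rewrite (RInt_deriv sin).
  - rewrite sin_PI2, sin_0; lra.
  - intros x; auto_derive; [exact I|simpl; ring].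
  - intros x; apply continuous_cos_pow.
Qed.

Lemma wallis_pos_decr (n : nat) : 0 < wallis n /\ wallis (S n) <= wallis n.
Proof.
  assert (H := PI_RGT_0).
  assert (Hc : forall x, 0 < x < PI / 2 -> 0 < cos x <= 1).
  { intros x Hx; split; [apply cos_gt_0; lra|apply COS_bound]. }
  split.
  - apply RInt_gt_0; [lra| |].
    + intros x Hx; apply pow_lt, Hc, Hx.
    + intros x _; apply continuous_cos_pow.
  - apply RInt_le; [lra|apply ex_RInt_cont, continuous_cos_pow..|].
    intros x Hx; destruct (Hc x Hx) as [H1 H2]; simpl.
    assert (0 < cos x ^ n) by now apply pow_lt. nra.
Qed.

Lemma wallis_prod (n : nat) : INR (n + 1) * (wallis (n + 1) * wallis n) = PI / 2.
Proof.
  induction n as [|n IH].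
  - simpl; rewrite wallis_0, wallis_1; lra.
  - assert (H := wallis_rec n).
    replace (S n + 1)%nat with (n + 2)%nat by lia.
    replace (S n) with (n + 1)%nat by lia.
    rewrite <- IH.
    transitivity (INR (n + 2) * wallis (n + 2) * wallis (n + 1)); [ring|].
    rewrite H; ring.
Qed.

(** Monotonicity squeezes W_{2m}^2 between W_{2m+1} W_{2m} and W_{2m} W_{2m-1}, both known
    exactly. *)
Lemma wallis_sqr_bounds (m : nat) : (1 <= m)%nat ->
  PI / (4 * INR m + 2) <= wallis (2 * m) ^ 2 <= PI / (4 * INR m).
Proof.
  intros Hm.
  assert (Hm' : 1 <= INR m) by (apply (le_INR 1); assumption).
  assert (H1 := wallis_prod (2 * m)).
  assert (H2 := wallis_prod (2 * m - 1)).
  replace (2 * m - 1 + 1)%nat with (2 * m)%nat in H2 by lia.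
  destruct (wallis_pos_decr (2 * m)) as [P D].
  destruct (wallis_pos_decr (2 * m - 1)) as [P' D'].
  replace (S (2 * m - 1)) with (2 * m)%nat in D' by lia.
  replace (2 * m + 1)%nat with (S (2 * m)) in H1 by lia.
  rewrite S_INR in H1; rewrite mult_INR in H1, H2; simpl (INR 2) in H1, H2.
  destruct (wallis_pos_decr (S (2 * m))) as [P'' _].
  split; apply Rmult_le_reg_r with (4 * INR m + 2); try lra.
  - unfold Rdiv; rewrite Rmult_assoc, Rinv_l by lra.
    assert (wallis (S (2 * m)) * wallis (2 * m) <= wallis (2 * m) ^ 2) by nra. nra.
  - apply Rmult_le_compat_r; [lra|].
    apply Rmult_le_reg_r with (4 * INR m); [lra|].
    unfold Rdiv; rewrite Rmult_assoc, Rinv_l by lra.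
    assert (wallis (2 * m) ^ 2 <= wallis (2 * m) * wallis (2 * m - 1)) by nra. nra.
Qed.

Definition ln_fact (n : nat) : R := sum1 (fun m => ln (INR m)) n.

(** The recurrence yields W_{2m} = (PI / 2) (2m)! / (4^m m!^2); its logarithm is how PI enters
    Stirling's formula. *)
Lemma ln_wallis (m : nat) :
  ln (wallis (2 * m)) = ln (PI / 2) + ln_fact (2 * m) - 2 * INR m * ln 2 - 2 * ln_fact m.
Proof.
  induction m as [|m IH].
  - simpl; rewrite wallis_0; unfold ln_fact; simpl; lra.
  - assert (H := wallis_rec (2 * m)).
    replace (2 * S m)%nat with (2 * m + 2)%nat by lia.
    assert (P := proj1 (wallis_pos_decr (2 * m))).
    assert (P' := proj1 (wallis_pos_decr (2 * m + 2))).
    assert (E : ln (INR (2 * m + 2) * wallis (2 * m + 2)) = ln (INR (2 * m + 1) * wallis (2 * m)))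
      by now rewrite H.
    assert (0 < INR (2 * m + 2)) by (apply lt_0_INR; lia).
    assert (0 < INR (2 * m + 1)) by (apply lt_0_INR; lia).
    rewrite !ln_mult in E by assumption.
    unfold ln_fact in *.
    replace (2 * m + 2)%nat with (S (S (2 * m))) at 2 by lia.
    rewrite !sum1_S.
    replace (S (S (2 * m))) with (2 * m + 2)%nat by lia.
    replace (S (2 * m)) with (2 * m + 1)%nat by lia.
    replace (ln (INR (2 * m + 2))) with (ln 2 + ln (INR (S m))) in *.
    + replace (2 * INR (S m) * ln 2) with (2 * INR m * ln 2 + 2 * ln 2)
        by (rewrite S_INR; ring).
      lra.
    + rewrite <- ln_mult; [|lra|apply lt_0_INR; lia].
      f_equal; rewrite S_INR, plus_INR, mult_INR; simpl; lra.
Qed.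

(** Each bound is an equality at u = 0 and follows by comparing derivatives. The rational lower
    bound times 1 / u + 1 / 2 is exactly 1, which gives the sign in [stirling_step]. *)
Lemma ln_1p_bounds (u : R) : 0 <= u ->
  2 * u / (2 + u) <= ln (1 + u) /\ ln (1 + u) <= u - u ^ 2 / 2 + u ^ 3 / 3
  /\ u - u ^ 2 / 2 <= ln (1 + u) <= u.
Proof.
  intros Hu.
  assert (L0 : ln (1 + 0) = 0) by (rewrite Rplus_0_r; apply ln_1).
  repeat split.
  - enough (ln (1 + 0) - 2 * 0 / (2 + 0) <= ln (1 + u) - 2 * u / (2 + u)) by lra.
    apply (derive_ge0_le (fun u => ln (1 + u) - 2 * u / (2 + u))
             (fun u => u ^ 2 / ((1 + u) * (2 + u) ^ 2))); [lra| |].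
    + intros x Hx; auto_derive; [lra|field; lra].
    + intros x Hx; apply Rmult_le_pos; [nra|left; apply Rinv_0_lt_compat; nra].
  - enough (0 - 0 ^ 2 / 2 + 0 ^ 3 / 3 - ln (1 + 0) <= u - u ^ 2 / 2 + u ^ 3 / 3 - ln (1 + u)) by lra.
    apply (derive_ge0_le (fun u => u - u ^ 2 / 2 + u ^ 3 / 3 - ln (1 + u))
             (fun u => u ^ 3 / (1 + u))); [lra| |].
    + intros x Hx; auto_derive; [lra|field; lra].
    + intros x Hx; apply Rmult_le_pos; [apply pow_le; lra|left; apply Rinv_0_lt_compat; nra].
  - enough (ln (1 + 0) - (0 - 0 ^ 2 / 2) <= ln (1 + u) - (u - u ^ 2 / 2)) by lra.
    apply (derive_ge0_le (fun u => ln (1 + u) - (u - u ^ 2 / 2))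
             (fun u => u ^ 2 / (1 + u))); [lra| |].
    + intros x Hx; auto_derive; [lra|field; lra].
    + intros x Hx; apply Rmult_le_pos; [apply pow_le; lra|left; apply Rinv_0_lt_compat; nra].
  - enough (0 - ln (1 + 0) <= u - ln (1 + u)) by lra.
    apply (derive_ge0_le (fun u => u - ln (1 + u)) (fun u => u / (1 + u))); [lra| |].
    + intros x Hx; auto_derive; [lra|field; lra].
    + intros x Hx; apply Rmult_le_pos; [lra|left; apply Rinv_0_lt_compat; nra].
Qed.

Definition stirling_rem (n : nat) : R := ln_fact n - (INR n + 1 / 2) * ln (INR n) + INR n.

(** With u = 1 / n the step is (1 / u + 1 / 2) ln (1 + u) - 1 <= u^2 / 12 + u^3 / 6. The weaker
    upper bound stated here is chosen because it telescopes. *)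
Lemma stirling_step (n : nat) : (1 <= n)%nat ->
  0 <= stirling_rem n - stirling_rem (S n) <= / (2 * INR n) - / (2 * INR (S n)).
Proof.
  intros Hn.
  assert (Hn' : 1 <= INR n) by (apply (le_INR 1); assumption).
  unfold stirling_rem, ln_fact; rewrite sum1_S.
  set (u := / INR n).
  assert (Hu : 0 < u <= 1).
  { split; [apply Rinv_0_lt_compat; lra|].
    rewrite <- Rinv_1; apply Rinv_le_contravar; lra. }
  assert (Eu : INR n = / u) by (unfold u; now rewrite Rinv_inv).
  assert (E : ln (INR (S n)) = ln (INR n) + ln (1 + u)).
  { rewrite <- ln_mult by lra; f_equal; rewrite S_INR; unfold u; field; lra. }
  rewrite E, S_INR, Eu.
  destruct (ln_1p_bounds u) as [H1 [H2 _]]; [lra|].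
  set (l := ln (1 + u)) in *.
  match goal with |- 0 <= ?x <= _ => replace x with ((/ u + 1 / 2) * l - 1) by lra end.
  assert (Hp : 0 < / u + 1 / 2) by (assert (0 < / u) by (apply Rinv_0_lt_compat; lra); lra).
  split.
  - apply Rle_trans with ((/ u + 1 / 2) * (2 * u / (2 + u)) - 1).
    + right; field; lra.
    + assert (H := Rmult_le_compat_l _ _ _ (Rlt_le _ _ Hp) H1); lra.
  - apply Rle_trans with ((/ u + 1 / 2) * (u - u ^ 2 / 2 + u ^ 3 / 3) - 1).
    + assert (H := Rmult_le_compat_l _ _ _ (Rlt_le _ _ Hp) H2); lra.
    + replace (/ (2 * / u) - / (2 * (/ u + 1))) with (u ^ 2 / (2 * (1 + u))) by (field; lra).
      replace ((/ u + 1 / 2) * (u - u ^ 2 / 2 + u ^ 3 / 3) - 1) with (u ^ 2 / 12 + u ^ 3 / 6)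
        by (field; lra).
      apply Rmult_le_reg_r with (2 * (1 + u)); [lra|].
      replace (u ^ 2 / (2 * (1 + u)) * (2 * (1 + u))) with (u ^ 2) by (field; lra).
      assert (0 < u ^ 2) by (apply pow_lt; lra).
      replace ((u ^ 2 / 12 + u ^ 3 / 6) * (2 * (1 + u)))
        with (u ^ 2 * ((1 / 6 + u / 3) * (1 + u))) by field.
      assert ((1 / 6 + u / 3) * (1 + u) <= 1) by nra.
      generalize dependent (u ^ 2); intros; nra.
Qed.

Lemma stirling_telescope (n j : nat) : (1 <= n)%nat ->
  0 <= stirling_rem n - stirling_rem (n + j) <= / (2 * INR n) - / (2 * INR (n + j)).
Proof.
  intros Hn; induction j as [|j IH].
  - rewrite Nat.add_0_r; lra.
  - assert (H := stirling_step (n + j)).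
    replace (n + S j)%nat with (S (n + j)) by lia.
    assert ((1 <= n + j)%nat) by lia. specialize (H H0); lra.
Qed.

(* Wallis' product evaluates r(2n) - 2 r(n), while r(2n) - r(n) = O(1/n);
   subtracting, r(n) itself is known up to O(1/n). *)
Lemma stirling (n : nat) : (1 <= n)%nat ->
  Rabs (ln_fact n - ((INR n + 1 / 2) * ln (INR n) - INR n + ln (2 * PI) / 2)) <= / INR n.
Proof.
  intros Hn.
  assert (Hn' : 1 <= INR n) by (apply (le_INR 1); assumption).
  assert (HP := PI_RGT_0).
  assert (T := stirling_telescope n n Hn).
  assert (L := ln_wallis n).
  destruct (wallis_sqr_bounds n Hn) as [W1 W2].
  assert (P := proj1 (wallis_pos_decr (2 * n))).
  replace (n + n)%nat with (2 * n)%nat in T by lia.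
  assert (E2 : ln (wallis (2 * n) ^ 2) = 2 * ln (wallis (2 * n))).
  { simpl; rewrite Rmult_1_r, ln_mult by assumption; lra. }
  assert (U : 2 * ln (wallis (2 * n)) <= ln PI - 2 * ln 2 - ln (INR n)).
  { rewrite <- E2; replace (2 * ln 2) with (ln 2 + ln 2) by lra.
    rewrite <- ln_mult by lra.
    replace (ln PI - ln (2 * 2) - ln (INR n)) with (ln PI - (ln (2 * 2) + ln (INR n))) by lra.
    rewrite <- ln_mult by lra. rewrite <- ln_div by lra.
    replace (2 * 2 * INR n) with (4 * INR n) by lra.
    destruct W2 as [W2| W2]; [left; apply ln_increasing; [nra|assumption]|right; now rewrite W2]. }
  (* PI / (4n + 2) is PI / (4n) divided by 1 + 1 / (2n), whose logarithm is at most 1 / (2n). *)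
  assert (V : ln PI - 2 * ln 2 - ln (INR n) - / (2 * INR n) <= 2 * ln (wallis (2 * n))).
  { rewrite <- E2; replace (2 * ln 2) with (ln 2 + ln 2) by lra.
    rewrite <- ln_mult by lra.
    assert (Hl : ln (1 + / (2 * INR n)) <= / (2 * INR n)).
    { apply ln_1p_bounds; left; apply Rinv_0_lt_compat; lra. }
    assert (Hi : 0 < / (2 * INR n)) by (apply Rinv_0_lt_compat; lra).
    apply Rle_trans with (ln PI - (ln (2 * 2) + (ln (INR n) + ln (1 + / (2 * INR n))))); [lra|].
    rewrite <- ln_mult by lra.
    assert (Hq : 0 < INR n * (1 + / (2 * INR n))) by (apply Rmult_lt_0_compat; lra).
    rewrite <- ln_mult, <- ln_div by lra.
    replace (2 * 2 * (INR n * (1 + / (2 * INR n)))) with (4 * INR n + 2) by (field; lra).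
    assert (0 < PI / (4 * INR n + 2)) by (apply Rmult_lt_0_compat; [lra|apply Rinv_0_lt_compat; lra]).
    destruct W1 as [W1| W1]; [left; apply ln_increasing; assumption|right; now rewrite W1]. }
  unfold stirling_rem in T.
  rewrite ln_div in L by lra; rewrite ln_mult by lra.
  rewrite mult_INR in T; change (INR 2) with (1 + 1) in T; replace (1 + 1) with 2 in T by lra; rewrite ln_mult in T by lra.
  replace (/ (2 * INR n)) with (/ INR n / 2) in * by (field; lra).
  replace (/ (2 * (2 * INR n))) with (/ INR n / 4) in * by (field; lra).
  assert (0 < / INR n) by (apply Rinv_0_lt_compat; lra).
  apply Rabs_le; split; lra.
Qed.

(** * Jordan's inequality and zeta(2) *)

Lemma sin_ge_linear (x : R) : 0 <= x <= PI / 2 -> 2 / PI * x <= sin x.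
Proof.
  intros [[Hx| <-] Hx1]; [|rewrite sin_0; lra].
  assert (HP := PI_RGT_0).
  enough (H : - (sin x / x) <= - (sin (PI / 2) / (PI / 2))).
  { rewrite sin_PI2 in H.
    replace (1 / (PI / 2)) with (2 / PI) in H by (field; lra).
    assert (H1 : 2 / PI <= sin x / x) by lra.
    apply Rmult_le_compat_r with (r := x) in H1; [|lra].
    replace (sin x / x * x) with (sin x) in H1 by (field; lra); assumption. }
  apply (derive_ge0_le (fun t => - (sin t / t)) (fun t => (sin t - t * cos t) / t ^ 2)); [lra| |].
  - intros t Ht; auto_derive; [lra|field; lra].
  - intros t Ht; apply Rmult_le_pos; [|left; apply Rinv_0_lt_compat; nra].
    enough (sin 0 - 0 * cos 0 <= sin t - t * cos t) by (rewrite sin_0 in *; lra).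
    apply (derive_ge0_le (fun t => sin t - t * cos t) (fun t => t * sin t)); [lra| |].
    + intros y Hy; auto_derive; [exact I|ring].
    + intros y Hy; apply Rmult_le_pos; [lra|apply sin_ge_0; lra].
Qed.

Definition wallis_x2 (n : nat) : R := RInt (fun x => x ^ 2 * cos x ^ n) 0 (PI / 2).

Lemma continuous_x2_cos_pow (n : nat) (x : R) : continuous (fun x => x ^ 2 * cos x ^ n) x.
Proof.
  apply (ex_derive_continuous (fun x => x ^ 2 * cos x ^ n)); auto_derive; exact I.
Qed.

(** Two integrations by parts: the function 2 x cos^{n+2} x + (n + 2) x^2 sin x cos^{n+1} x vanishes
    at both ends. *)
Lemma wallis_x2_rec (n : nat) :
  2 * wallis (n + 2)
  = INR (n + 2) * INR (n + 1) * wallis_x2 n - INR (n + 2) ^ 2 * wallis_x2 (n + 2).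
Proof.
  assert (HP := PI_RGT_0).
  assert (H : RInt (fun x => 1 * (2 * cos x ^ (n + 2) + INR (n + 2) ^ 2 * (x ^ 2 * cos x ^ (n + 2)))
       + - (INR (n + 2) * INR (n + 1)) * (x ^ 2 * cos x ^ n)) 0 (PI / 2) = 0).
  { rewrite (RInt_deriv (fun x => 2 * x * cos x ^ S (S n)
       + INR (n + 2) * x ^ 2 * sin x * cos x ^ S n)).
    - rewrite cos_PI2; simpl; ring.
    - intros x; auto_derive; [exact I|].
      replace (n + 2)%nat with (S (S n)) by lia.
      replace (n + 1)%nat with (S n) by lia.
      change (Init.Nat.pred (S n)) with n.
      change (Init.Nat.pred (S (S n))) with (S n).
      replace (match n with 0%nat => 1 | S _ => INR n + 1 end) with (INR n + 1)
        by (destruct n; simpl; lra).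
      rewrite !S_INR, <- !tech_pow_Rmult.
      assert (H := sin2_cos2 x); unfold Rsqr in H.
      transitivity (2 * (cos x * (cos x * cos x ^ n))
        + (INR n + 1 + 1) * x ^ 2 * cos x * (cos x * cos x ^ n)
        - (INR n + 1 + 1) * x ^ 2 * (sin x * sin x) * ((INR n + 1) * cos x ^ n)).
      { simpl; ring. }
      replace (sin x * sin x) with (1 - cos x * cos x) by lra; simpl; ring.
    - intros x; apply (ex_derive_continuous (fun x => _ + _)); auto_derive; exact I. }
  rewrite RInt_lin, RInt_lin in H.
  - unfold wallis, wallis_x2; lra.
  - apply ex_RInt_cont, continuous_cos_pow.
  - apply ex_RInt_cont, continuous_x2_cos_pow.
  - apply ex_RInt_cont; intros x; apply (ex_derive_continuous (fun x => _ + _)); auto_derive; exact I.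
  - apply ex_RInt_cont, continuous_x2_cos_pow.
Qed.

(** Jordan's inequality gives x <= (PI / 2) sin x, hence x^2 cos^n x <= (PI^2 / 4) (cos^n x -
    cos^{n+2} x). *)
Lemma wallis_x2_bound (n : nat) : 0 <= wallis_x2 n <= PI ^ 2 / 4 * (wallis n - wallis (n + 2)).
Proof.
  assert (HP := PI_RGT_0).
  assert (Hc : forall x, 0 < x < PI / 2 -> 0 <= cos x ^ n).
  { intros x Hx; apply pow_le; left; apply cos_gt_0; lra. }
  split.
  - apply RInt_ge_0; [lra|apply ex_RInt_cont, continuous_x2_cos_pow|].
    intros x Hx; apply Rmult_le_pos; [apply pow2_ge_0|auto].
  - unfold wallis.
    replace (PI ^ 2 / 4 * (RInt (fun x => cos x ^ n) 0 (PI / 2)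
               - RInt (fun x => cos x ^ (n + 2)) 0 (PI / 2)))
      with (PI ^ 2 / 4 * RInt (fun x => cos x ^ n) 0 (PI / 2)
            + - (PI ^ 2 / 4) * RInt (fun x => cos x ^ (n + 2)) 0 (PI / 2)) by ring.
    rewrite <- RInt_lin by apply ex_RInt_cont, continuous_cos_pow.
    apply RInt_le; [lra|apply ex_RInt_cont, continuous_x2_cos_pow| |].
    + apply ex_RInt_cont; intros x; apply (ex_derive_continuous (fun x => _ + _)); auto_derive; exact I.
    + intros x Hx; specialize (Hc x Hx).
      assert (Hs : 2 / PI * x <= sin x) by (apply sin_ge_linear; lra).
      assert (H := sin2_cos2 x); unfold Rsqr in H.
      assert (Hx2 : x ^ 2 <= PI ^ 2 / 4 * (sin x * sin x)).
      { assert (Hx' : x <= PI / 2 * sin x).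
        { apply Rmult_le_compat_l with (r := PI / 2) in Hs; [|lra].
          replace (PI / 2 * (2 / PI * x)) with x in Hs by (field; lra); lra. }
        replace (PI ^ 2 / 4 * (sin x * sin x)) with ((PI / 2 * sin x) * (PI / 2 * sin x)) by field.
        nra. }
      replace (PI ^ 2 / 4 * cos x ^ n + - (PI ^ 2 / 4) * cos x ^ (n + 2))
        with (PI ^ 2 / 4 * (1 - cos x * cos x) * cos x ^ n) by (rewrite pow_add; simpl; ring).
      replace (1 - cos x * cos x) with (sin x * sin x) by lra.
      now apply Rmult_le_compat_r.
Qed.

(* Matsuoka's proof: [wallis_x2_rec] makes 1/k^2 telescope. *)
Lemma basel (n : nat) :
  0 <= PI ^ 2 / 6 - sum1 (fun k => / INR k ^ 2) n <= PI ^ 2 / (4 * (INR n + 1)).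
Proof.
  assert (HP := PI_RGT_0).
  (* The remainder of the series is twice the ratio of the two moments; at n = 0 that ratio is PI^2
     / 12, which fixes the value of the sum. *)
  assert (E : PI ^ 2 / 6 - sum1 (fun k => / INR k ^ 2) n
              = 2 * (wallis_x2 (2 * n) / wallis (2 * n))).
  { induction n as [|n IH].
    - simpl sum1; simpl (2 * 0)%nat; rewrite wallis_0.
      unfold wallis_x2; rewrite (RInt_deriv (fun x => x ^ 3 / 3)).
      + field; lra.
      + intros x; auto_derive; [exact I|simpl; field].
      + intros x; apply continuous_x2_cos_pow.
    - rewrite sum1_S.
      assert (H1 := wallis_rec (2 * n)); assert (H2 := wallis_x2_rec (2 * n)).
      replace (2 * S n)%nat with (2 * n + 2)%nat by lia.
      assert (P1 := proj1 (wallis_pos_decr (2 * n))).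
      assert (P2 := proj1 (wallis_pos_decr (2 * n + 2))).
      assert (P3 := pos_INR n).
      assert (E1 : INR (2 * n + 2) = 2 * (INR n + 1)) by (rewrite plus_INR, mult_INR; simpl; ring).
      assert (E2 : INR (2 * n + 1) = 2 * INR n + 1) by (rewrite plus_INR, mult_INR; simpl; ring).
      rewrite E1, E2 in *; rewrite S_INR.
      replace (wallis (2 * n)) with (2 * (INR n + 1) * wallis (2 * n + 2) / (2 * INR n + 1)) in IH
        by (rewrite H1; field; lra).
      replace (wallis_x2 (2 * n + 2)) with
        ((2 * (INR n + 1) * (2 * INR n + 1) * wallis_x2 (2 * n) - 2 * wallis (2 * n + 2))
         / (2 * (INR n + 1)) ^ 2) by (rewrite H2; field; lra).
      replace (PI ^ 2 / 6 - (sum1 (fun k => / INR k ^ 2) n + / (INR n + 1) ^ 2))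
        with (PI ^ 2 / 6 - sum1 (fun k => / INR k ^ 2) n - / (INR n + 1) ^ 2) by ring.
      rewrite IH; field; repeat split; lra. }
  rewrite E.
  assert (P1 := proj1 (wallis_pos_decr (2 * n))).
  destruct (wallis_x2_bound (2 * n)) as [B1 B2].
  assert (P3 := pos_INR n).
  split.
  - apply Rmult_le_pos; [lra|apply Rmult_le_pos; [assumption|left; now apply Rinv_0_lt_compat]].
  - assert (H1 := wallis_rec (2 * n)).
    assert (E1 : INR (2 * n + 2) = 2 * (INR n + 1)) by (rewrite plus_INR, mult_INR; simpl; ring).
    assert (E2 : INR (2 * n + 1) = 2 * INR n + 1) by (rewrite plus_INR, mult_INR; simpl; ring).
    rewrite E1, E2 in H1.
    replace (wallis (2 * n + 2)) with ((2 * INR n + 1) * wallis (2 * n) / (2 * (INR n + 1))) in B2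
      by (rewrite <- H1; field; lra).
    apply Rmult_le_reg_r with (wallis (2 * n)); [assumption|].
    replace (2 * (wallis_x2 (2 * n) / wallis (2 * n)) * wallis (2 * n))
      with (2 * wallis_x2 (2 * n)) by (field; lra).
    eapply Rle_trans; [apply Rmult_le_compat_l; [lra|apply B2]|].
    right; field; lra.
Qed.

(** * The generating function on the positive real axis *)

Lemma is_derive_sum1 (f df : nat -> R -> R) (n : nat) (x : R) :
  (forall m, (1 <= m <= n)%nat -> is_derive (f m) x (df m x)) ->
  is_derive (fun x => sum1 (fun m => f m x) n) x (sum1 (fun m => df m x) n).
Proof.
  induction n as [|n IH]; intros H; simpl.
  - apply (is_derive_const (V := R_NormedModule) 0).
  - apply (is_derive_plus (V := R_NormedModule) (fun x => sum1 (fun m => f m x) n) (f (S n)));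
      [apply IH; intros; apply H; lia|apply H; lia].
Qed.

Lemma bose_continuous (t : R) : 0 < t -> continuous bose t.
Proof.
  intros Ht; assert (H := exp_neg_lt1 t Ht).
  apply (ex_derive_continuous bose); unfold bose; auto_derive; lra.
Qed.

(** The base point is 1 because the formula for [bose] divides by zero at 0; only differences of
    values occur. *)
Definition bose_int (t : R) : R := RInt bose 1 t.

Lemma bose_int_derive (t : R) : 0 < t -> is_derive bose_int t (bose t).
Proof.
  intros Ht; apply (is_derive_RInt (V := R_NormedModule) bose bose_int 1).
  - exists (mkposreal t Ht); intros y Hy.
    assert (Hy0 : 0 < y).
    { unfold ball in Hy; simpl in Hy; unfold AbsRing_ball, abs, minus, plus, opp in Hy; simpl in Hy.
      apply Rabs_def2 in Hy; lra. }
    apply (RInt_correct (V := R_CompleteNormedModule)).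
    apply (ex_RInt_continuous (V := R_CompleteNormedModule)); intros z Hz.
    apply bose_continuous.
    assert (0 < Rmin 1 y) by (apply Rmin_glb_lt; lra); lra.
  - now apply bose_continuous.
Qed.

(** By the mean value theorem each increment of H lies between s times the values of h at the two
    ends; the discrepancies telescope. *)
Lemma sum1_decr_int (h H : R -> R) (s : R) (n : nat) :
  0 < s -> (1 <= n)%nat ->
  (forall t, 0 < t -> is_derive H t (h t)) ->
  (forall a b, 0 < a <= b -> h b <= h a) ->
  s * h (INR n * s) <= s * sum1 (fun m => h (INR m * s)) n - (H (INR n * s) - H s) <= s * h s.
Proof.
  intros Hs Hn HH Hh; induction Hn as [|n Hn IH].
  - simpl; rewrite Rmult_1_l; lra.
  - rewrite sum1_S.
    assert (Hn' : 1 <= INR n) by (apply (le_INR 1); assumption).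
    destruct (mvt H h (INR n * s) (INR (S n) * s)) as [c [Hc E]].
    + rewrite S_INR; nra.
    + intros x Hx; apply HH; nra.
    + assert (H1 : h (INR (S n) * s) <= h c) by (apply Hh; nra).
      assert (H2 : h c <= h (INR n * s)) by (apply Hh; nra).
      replace (INR (S n) * s - INR n * s) with s in E by (rewrite S_INR; ring).
      nra.
Qed.

(** Primitive of the first J terms t exp (- j t) of the geometric expansion of [bose t], normalised
    to vanish at infinity; at 0 it is minus a partial sum of zeta(2). *)
Definition bose_approx (J : nat) (t : R) : R :=
  sum1 (fun j => - (exp (- (INR j * t)) * (t / INR j + / INR j ^ 2))) J.

Lemma bose_approx_derive (J : nat) (t : R) : 0 < t ->
  is_derive (bose_approx J) t (bose t * (1 - exp (- (INR J * t)))).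
Proof.
  intros Ht; assert (H := exp_neg_lt1 t Ht).
  replace (bose t * (1 - exp (- (INR J * t))))
    with (sum1 (fun j => t * exp (- (INR j * t))) J).
  - apply (is_derive_sum1 (fun j t => - (exp (- (INR j * t)) * (t / INR j + / INR j ^ 2)))
             (fun j t => t * exp (- (INR j * t)))).
    intros m Hm; assert (Hm' : 1 <= INR m) by (apply (le_INR 1); lia).
    unfold Rdiv; auto_derive; [exact I|]. gen_exp; field; lra.
  - induction J as [|J IH].
    + simpl; replace (- (0 * t)) with 0 by ring; rewrite exp_0; ring.
    + rewrite sum1_S, IH.
      replace (- (INR (S J) * t)) with (- (INR J * t) + - t) by (rewrite S_INR; ring).
      rewrite exp_plus; unfold bose; gen_exp; field; lra.
Qed.

Lemma bose_approx_large (J : nat) (T : R) : 1 <= T ->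
  Rabs (bose_approx J T) <= 4 * exp (- (T / 2)).
Proof.
  intros HT.
  apply Rle_trans with ((T + 1) * exp (- (T / 2)) * / (T / 2)).
  - eapply Rle_trans; [|apply Rmult_le_compat_l; [|apply (sum1_geom (T / 2) J); lra]].
    2: { apply Rmult_le_pos; [lra|left; apply exp_pos]. }
    rewrite <- sum1_scal; apply sum1_Rabs_le; intros j Hj.
    assert (Hj' : 1 <= INR j) by (apply (le_INR 1); lia).
    assert (Hi : 0 < / INR j <= 1).
    { split; [apply Rinv_0_lt_compat; lra|rewrite <- Rinv_1; apply Rinv_le_contravar; lra]. }
    rewrite Rabs_Ropp, Rabs_mult, (Rabs_right (exp _)) by (left; apply exp_pos).
    replace (/ INR j ^ 2) with (/ INR j * / INR j) by (field; lra).
    unfold Rdiv; rewrite Rabs_right by nra.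
    (* Half of the exponent is kept as decay in T, the other half makes the sum over j geometric. *)
    assert (E : exp (- (INR j * T)) <= exp (- (T * / 2)) * exp (- (INR j * (T * / 2)))).
    { rewrite <- exp_plus; apply exp_le; nra. }
    assert (0 < exp (- (INR j * T))) by apply exp_pos.
    assert (T * / INR j + / INR j * / INR j <= T + 1) by nra.
    apply Rle_trans with (exp (- (INR j * T)) * (T + 1)); [nra|]. nra.
  - assert (H := exp_pos (- (T / 2))).
    apply Rmult_le_reg_r with (T / 2); [lra|].
    replace ((T + 1) * exp (- (T / 2)) * / (T / 2) * (T / 2)) with ((T + 1) * exp (- (T / 2)))
      by (field; lra).
    nra.
Qed.

(** With y = j a each term is (1 - exp (- y) (1 + y)) / j^2, whose numerator lies between 0 and
    y^2. *)
Lemma bose_approx_small (J : nat) (a : R) : 0 < a ->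
  0 <= bose_approx J a + sum1 (fun j => / INR j ^ 2) J <= INR J * a ^ 2.
Proof.
  intros Ha; unfold bose_approx; rewrite <- sum1_plus, <- sum1_const.
  assert (H : forall j, (1 <= j <= J)%nat ->
    0 <= - (exp (- (INR j * a)) * (a / INR j + / INR j ^ 2)) + / INR j ^ 2 <= a ^ 2).
  { intros j Hj; assert (Hj' : 1 <= INR j) by (apply (le_INR 1); lia).
    assert (Hy : 0 <= INR j * a) by nra.
    destruct (exp_neg_bounds (INR j * a) Hy) as [[H1 H2] H3].
    replace (- (exp (- (INR j * a)) * (a / INR j + / INR j ^ 2)) + / INR j ^ 2)
      with ((1 - exp (- (INR j * a)) * (1 + INR j * a)) * / INR j ^ 2) by (gen_exp; field; lra).
    assert (0 < / INR j ^ 2) by (apply Rinv_0_lt_compat; nra).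
    split; [apply Rmult_le_pos; [nra|lra]|].
    replace (a ^ 2) with ((INR j * a) ^ 2 * / INR j ^ 2) by (field; lra).
    apply Rmult_le_compat_r; [lra|nra]. }
  split; [apply sum1_nonneg|apply sum1_le]; intros j Hj; now apply H.
Qed.

(* The constant is the integral of t/(e^t-1) over (0, oo), that is zeta(2); the part
   of the integral near 0 is cut off at 1/J and J tends to infinity. *)
Lemma bose_int_main (s T : R) : 0 < s <= 1 -> 1 <= T ->
  Rabs (bose_int T - bose_int s - PI ^ 2 / 6 + s) <= s ^ 2 + 4 * exp (- (T / 2)).
Proof.
  intros Hs HT.
  (* The 7 collects 1 each from the omitted terms of the series, from the interval (0, 1 / J) and
     from [bose_approx] at 1 / J, and 4 from the remainder of zeta(2). *)
  enough (main : forall J : nat, (1 <= J)%nat -> / INR J <= s ->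
    Rabs (bose_int T - bose_int s - PI ^ 2 / 6 + s)
      <= s ^ 2 + 4 * exp (- (T / 2)) + 7 * / INR J).
  { apply le_epsilon; intros e He.
    destruct (archimed_cor1 (Rmin s (e / 7))) as [J [HJ HJ0]].
    { apply Rmin_glb_lt; lra. }
    assert (HJ1 := Rmin_l s (e / 7)); assert (HJ2 := Rmin_r s (e / 7)).
    specialize (main J HJ0); lra. }
  intros J HJ HJs.
  assert (HJ' : 1 <= INR J) by (apply (le_INR 1); lia).
  assert (Ha0 : 0 < / INR J) by (apply Rinv_0_lt_compat; lra).
  set (a := / INR J) in *.
  assert (EJ : INR J * a = 1) by (unfold a; field; lra).
  assert (HP := PI_RGT_0); assert (HP4 := PI_4).
  (* The omitted part bose t exp (- J t) of the integrand lies between 0 and exp (- J t), so the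
     difference of the two primitives grows by at least 0 (G1) and at most 1 / J (G2). *)
  assert (G1 : bose_int a - bose_approx J a <= bose_int T - bose_approx J T).
  { apply (derive_ge0_le (fun t => bose_int t - bose_approx J t)
      (fun t => bose t - bose t * (1 - exp (- (INR J * t))))); [lra| |].
    - intros t Ht; apply (is_derive_minus (V := R_NormedModule) bose_int (bose_approx J));
        [apply bose_int_derive|apply bose_approx_derive]; lra.
    - intros t Ht; assert (H := bose_bounds t).
      assert (0 < exp (- (INR J * t))) by apply exp_pos.
      replace (bose t - bose t * (1 - exp (- (INR J * t)))) with (bose t * exp (- (INR J * t))) by ring.
      apply Rmult_le_pos; lra. }
  assert (G2 : - exp (- (INR J * a)) * a - (bose_int a - bose_approx J a)
               <= - exp (- (INR J * T)) * a - (bose_int T - bose_approx J T)).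
  { apply (derive_ge0_le (fun t => - exp (- (INR J * t)) * a - (bose_int t - bose_approx J t))
      (fun t => exp (- (INR J * t)) - (bose t - bose t * (1 - exp (- (INR J * t)))))); [lra| |].
    - intros t Ht.
      apply (is_derive_minus (V := R_NormedModule) (fun t => - exp (- (INR J * t)) * a)
               (fun t => bose_int t - bose_approx J t)).
      + auto_derive; [exact I|]. unfold a; gen_exp; field; lra.
      + apply (is_derive_minus (V := R_NormedModule) bose_int (bose_approx J));
          [apply bose_int_derive|apply bose_approx_derive]; lra.
    - intros t Ht; assert (H := bose_bounds t).
      assert (0 < exp (- (INR J * t))) by apply exp_pos. nra. }
  assert (0 < exp (- (INR J * T))) by apply exp_pos.
  assert (exp (- (INR J * a)) <= 1) by (rewrite <- exp_0; apply exp_le; lra).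
  assert (G3 : (s - a) * (1 - s) <= bose_int s - bose_int a <= s - a).
  { destruct (mvt bose_int bose a s) as [c [Hc E]]; [lra| |].
    - intros x Hx; apply bose_int_derive; lra.
    - assert (H3 := bose_bounds c); rewrite E; nra. }
  assert (G4 := bose_approx_large J T HT); apply Rabs_le_between in G4.
  assert (G5 := bose_approx_small J a Ha0).
  replace (INR J * a ^ 2) with a in G5 by (transitivity (INR J * a * a); [rewrite EJ|]; ring).
  assert (G6 := basel J).
  assert (G7 : PI ^ 2 / (4 * (INR J + 1)) <= 4 * a).
  { apply Rmult_le_reg_r with (4 * (INR J + 1)); [lra|].
    replace (PI ^ 2 / (4 * (INR J + 1)) * (4 * (INR J + 1))) with (PI ^ 2) by (field; lra). nra. }
  apply Rabs_le; split; nra.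
Qed.

(** The 16 comes from T (1 + T) <= 16 (1 + T / 4)^2, and (1 + T / 4) exp (- T / 4) <= 1. *)
Lemma T_bose_small (T : R) : 1 <= T -> 0 <= T * bose T <= 16 * exp (- (T / 2)).
Proof.
  intros HT; assert (H := bose_bounds T).
  split; [nra|].
  assert (Hb : bose T <= (1 + T) * exp (- T)).
  { destruct (exp_neg_bounds T) as [_ H3]; [lra|].
    assert (H4 := exp_neg_lt1 T); assert (0 < exp (- T)) by apply exp_pos.
    unfold bose; apply Rmult_le_reg_r with (1 - exp (- T)); [lra|].
    replace (T * exp (- T) / (1 - exp (- T)) * (1 - exp (- T))) with (T * exp (- T))
      by (gen_exp; field; lra).
    nra. }
  assert (E1 : exp (- T) = exp (- (T / 2)) * (exp (- (T / 4)) * exp (- (T / 4))))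
    by (rewrite <- !exp_plus; f_equal; lra).
  assert (E2 := exp_neg (T / 4)); assert (E3 := exp_ineq1_le (T / 4)).
  assert (E4 := exp_pos (- (T / 4))); assert (E5 := exp_pos (- (T / 2))).
  assert (E6 : exp (- (T / 4)) * (1 + T / 4) <= 1) by nra.
  assert (E7 : (exp (- (T / 4)) * (1 + T / 4)) * (exp (- (T / 4)) * (1 + T / 4)) <= 1).
  { assert (0 <= exp (- (T / 4)) * (1 + T / 4)) by nra. nra. }
  apply Rle_trans with (T * ((1 + T) * exp (- T))); [nra|].
  rewrite E1.
  apply Rle_trans with (16 * ((exp (- (T / 4)) * (1 + T / 4)) * (exp (- (T / 4)) * (1 + T / 4)))
                        * exp (- (T / 2))); [|nra].
  set (q := exp (- (T / 4))) in *; set (r := exp (- (T / 2))) in *.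
  replace (T * ((1 + T) * (r * (q * q)))) with ((T * (1 + T)) * (r * (q * q))) by ring.
  replace (16 * (q * (1 + T / 4) * (q * (1 + T / 4))) * r)
    with ((16 * (1 + T / 4) * (1 + T / 4)) * (r * (q * q))) by ring.
  apply Rmult_le_compat_r; [|nra].
  apply Rmult_le_pos; [lra|nra].
Qed.

Lemma sum_bose_asym (s : R) (n : nat) : 0 < s <= 1 -> (1 <= n)%nat -> 1 <= INR n * s ->
  Rabs (s * sum1 (fun m => bose (INR m * s)) n - PI ^ 2 / 6)
    <= 3 * s + 4 * exp (- (INR n * s / 2)).
Proof.
  intros Hs Hn HT.
  assert (H1 := sum1_decr_int bose bose_int s n (proj1 Hs) Hn bose_int_derive bose_decr).
  assert (H2 := bose_int_main s (INR n * s) Hs HT); apply Rabs_le_between in H2.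
  assert (H3 := bose_bounds s); assert (H4 := bose_bounds (INR n * s)).
  apply Rabs_le; split; nra.
Qed.

(** Since t bose t has derivative 2 bose t - bose2 t, a primitive of [bose2] is 2 bose_int t - t
    bose t; hence the constant 2 zeta(2). *)
Lemma sum_bose2_asym (s : R) (n : nat) : 0 < s <= 1 -> (1 <= n)%nat -> 1 <= INR n * s ->
  Rabs (s * sum1 (fun m => bose2 (INR m * s)) n - PI ^ 2 / 3)
    <= 6 * s + 24 * exp (- (INR n * s / 2)).
Proof.
  intros Hs Hn HT.
  assert (H1 := sum1_decr_int bose2 (fun t => 2 * bose_int t - t * bose t) s n (proj1 Hs) Hn).
  assert (HD : forall t, 0 < t -> is_derive (fun t => 2 * bose_int t - t * bose t) t (bose2 t)).
  { intros t Ht; assert (H := exp_neg_lt1 t Ht).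
    replace (bose2 t) with (2 * bose t - (2 * bose t - bose2 t)) by ring.
    apply (is_derive_minus (V := R_NormedModule) (fun t => 2 * bose_int t) (fun t => t * bose t)).
    - apply (is_derive_scal bose_int t 2), bose_int_derive, Ht.
    - unfold bose, bose2; auto_derive; [lra|]. gen_exp; field; lra. }
  specialize (H1 HD bose2_decr); cbv beta in H1.
  assert (H2 := bose_int_main s (INR n * s) Hs HT); apply Rabs_le_between in H2.
  assert (H3 := bose2_bounds s); assert (H4 := bose2_bounds (INR n * s)).
  assert (H5 := T_bose_small (INR n * s) HT); assert (H6 := bose_bounds s).
  apply Rabs_le; split; nra.
Qed.

(** Mean value theorem for the error as a function of the right endpoint. A bound by the drop of g1
    telescopes when intervals are joined. *)
Lemma trapezoid (F g g1 : R -> R) (a b : R) : a <= b ->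
  (forall t, a <= t <= b -> is_derive F t (g t)) ->
  (forall t, a <= t <= b -> is_derive g t (g1 t)) ->
  (forall t u, a <= t <= u -> u <= b -> g1 u <= g1 t) ->
  Rabs (F b - F a - (b - a) * (g a + g b) / 2) <= (b - a) ^ 2 / 2 * (g1 a - g1 b).
Proof.
  intros Hab HF Hg Hg1.
  destruct (mvt (fun t => F t - F a - (t - a) * (g a + g t) / 2)
    (fun t => g t - (1 * (g a + g t) + (t - a) * g1 t) / 2) a b Hab) as [c [Hc E]].
  - intros t Ht.
    assert (Df : ex_derive F t) by (eexists; apply HF, Ht).
    assert (Dg : ex_derive g t) by (eexists; apply Hg, Ht).
    auto_derive; [tauto|].
    rewrite (is_derive_unique _ _ _ (HF t Ht) : Derive (fun t => F t) t = _).
    rewrite (is_derive_unique _ _ _ (Hg t Ht) : Derive (fun t => g t) t = _). field.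
  - destruct (mvt g g1 a c) as [d [Hd E2]]; [lra| |].
    + intros x Hx; apply Hg; lra.
    + replace (F b - F a - (b - a) * (g a + g b) / 2)
        with (F b - F a - (b - a) * (g a + g b) / 2 - (F a - F a - (a - a) * (g a + g a) / 2)) by field.
      rewrite E.
      replace (g c - (1 * (g a + g c) + (c - a) * g1 c) / 2)
        with ((c - a) / 2 * (g1 d - g1 c)) by (replace (g c) with (g a + g1 d * (c - a)) by lra; field).
      assert (g1 c <= g1 d) by (apply Hg1; lra).
      assert (g1 d <= g1 a) by (apply Hg1; lra).
      assert (g1 b <= g1 c) by (apply Hg1; lra).
      rewrite Rabs_right by (apply Rle_ge; repeat apply Rmult_le_pos; lra).
      replace ((c - a) / 2 * (g1 d - g1 c) * (b - a)) with ((c - a) * (g1 d - g1 c) * ((b - a) / 2)) by field.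
      replace ((b - a) ^ 2 / 2 * (g1 a - g1 b)) with ((b - a) * (g1 a - g1 b) * ((b - a) / 2)) by field.
      apply Rmult_le_compat_r; [lra|].
      apply Rmult_le_compat; lra.
Qed.

Lemma sum1_trapezoid (F g g1 : R -> R) (s : R) (n : nat) :
  0 < s -> (1 <= n)%nat ->
  (forall t, 0 < t -> is_derive F t (g t)) ->
  (forall t, 0 < t -> is_derive g t (g1 t)) ->
  (forall a b, 0 < a <= b -> g1 b <= g1 a) ->
  Rabs (F (INR n * s) - F s
        - s * (sum1 (fun m => g (INR m * s)) n - (g s + g (INR n * s)) / 2))
    <= s ^ 2 / 2 * (g1 s - g1 (INR n * s)).
Proof.
  intros Hs Hn HF Hg Hg1; induction Hn as [|n Hn IH].
  - simpl; rewrite Rmult_1_l.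
    replace (F s - F s - s * (0 + g s - (g s + g s) / 2)) with 0 by field.
    rewrite Rabs_R0; lra.
  - rewrite sum1_S.
    assert (Hn' : 1 <= INR n) by (apply (le_INR 1); assumption).
    assert (Hns : 0 < INR n * s) by nra.
    assert (E : INR (S n) * s - INR n * s = s) by (rewrite S_INR; ring).
    assert (T := trapezoid F g g1 (INR n * s) (INR (S n) * s)).
    rewrite E in T.
    eapply Rle_trans; [|eapply Rle_trans; [apply Rplus_le_compat; [exact IH|apply T]|]].
    + eapply Rle_trans; [|apply Rabs_triang]; right; f_equal; field.
    + lra.
    + intros; apply HF; lra.
    + intros; apply Hg; lra.
    + intros; apply Hg1; lra.
    + lra.
Qed.

Definition ln_gf (s : R) (n : nat) : R := sum1 (fun m => - ln (1 - exp (- (INR m * s)))) n.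

Lemma neg_ln_1m_exp_bound (T : R) : 0 < T ->
  0 <= - ln (1 - exp (- T)) /\ T * - ln (1 - exp (- T)) <= bose T.
Proof.
  intros HT; assert (H := exp_neg_lt1 T HT); assert (H1 := exp_pos (- T)).
  set (q := exp (- T)) in *.
  assert (E : - ln (1 - q) = ln (1 + q / (1 - q))).
  { rewrite <- ln_Rinv by lra; f_equal; field; lra. }
  assert (Hq : 0 <= q / (1 - q)) by (apply Rmult_le_pos; [lra|left; apply Rinv_0_lt_compat; lra]).
  destruct (ln_1p_bounds _ Hq) as [L1 [_ [_ L2]]].
  split.
  - rewrite E; eapply Rle_trans; [|exact L1].
    apply Rmult_le_pos; [lra|left; apply Rinv_0_lt_compat; lra].
  - rewrite E; unfold bose; fold q.
    replace (T * q / (1 - q)) with (T * (q / (1 - q))) by (field; lra).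
    apply Rmult_le_compat_l; lra.
Qed.

(* Trapezoidal rule for the sum of -ln(1-e^{-t}) + ln t over t = s, ..., ns; the
   subtracted logarithms are summed by Stirling's formula. *)
Lemma ln_gf_asym_gen (s : R) (n : nat) : 0 < s <= 1 -> (1 <= n)%nat -> 1 <= INR n * s ->
  Rabs (ln_gf s n - (PI ^ 2 / (6 * s) + ln s / 2 - ln (2 * PI) / 2))
    <= 4 * s + 30 * exp (- (INR n * s / 2)) / s.
Proof.
  intros Hs Hn HT.
  assert (Hn' : 1 <= INR n) by (apply (le_INR 1); assumption).
  set (h := fun t => - ln (1 - exp (- t))).
  (* Adding ln t cancels the singularity of h at 0: the derivative g1 of g stays in [0, 1]. *)
  set (g := fun t => ln t + h t).
  set (g1 := fun t => / t - exp (- t) / (1 - exp (- t))).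
  (* Since t h'(t) = - bose t, a primitive of h is t h t + bose_int t. *)
  set (F := fun t => t * ln t - t + t * h t + bose_int t).
  assert (HF : forall t, 0 < t -> is_derive F t (g t)).
  { intros t Ht; assert (H := exp_neg_lt1 t Ht).
    assert (HD := bose_int_derive t Ht).
    assert (ED : ex_derive bose_int t) by (eexists; exact HD).
    unfold F, g, h; auto_derive; [repeat split; try assumption; lra|].
    rewrite (is_derive_unique _ _ _ HD : Derive (fun x => bose_int x) t = _).
    unfold bose, Rminus.
    generalize dependent (ln (1 + - exp (- t))); intros l.
    gen_exp; field; lra. }
  assert (Hg : forall t, 0 < t -> is_derive g t (g1 t)).
  { intros t Ht; assert (H := exp_neg_lt1 t Ht).
    unfold g, g1, h; auto_derive; [lra|]. gen_exp; field; lra. }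
  (* The derivative of g1 is (bose2 t - 1) / t^2 <= 0. *)
  assert (Hg1 : forall a b, 0 < a <= b -> g1 b <= g1 a).
  { intros a b Hab; enough (- g1 a <= - g1 b) by lra.
    apply (derive_ge0_le (fun t => - g1 t) (fun t => (1 - bose2 t) / t ^ 2)); [lra| |].
    - intros t Ht; assert (H := exp_neg_lt1 t).
      unfold g1, bose2; auto_derive; [lra|]. gen_exp; field; lra.
    - intros t Ht; assert (H := bose2_bounds t).
      apply Rmult_le_pos; [lra|left; apply Rinv_0_lt_compat; nra]. }
  assert (Bg1 : forall t, 0 < t -> 0 <= g1 t <= 1).
  { intros t Ht; assert (H := exp_neg_lt1 t Ht); assert (B := bose_bounds t Ht).
    replace (g1 t) with ((1 - bose t) * / t) by (unfold g1, bose; gen_exp; field; lra).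
    assert (0 < / t) by (apply Rinv_0_lt_compat; lra).
    split; [apply Rmult_le_pos; lra|].
    apply Rmult_le_reg_r with t; [lra|].
    rewrite Rmult_assoc, Rinv_l by lra; lra. }
  set (T := INR n * s) in *.
  assert (TR := sum1_trapezoid F g g1 s n (proj1 Hs) Hn HF Hg Hg1); fold T in TR.
  assert (TR' : Rabs (F T - F s - s * (sum1 (fun m => g (INR m * s)) n - (g s + g T) / 2)) <= s ^ 2 / 2).
  { eapply Rle_trans; [exact TR|].
    assert (B1 := Bg1 s); assert (B2 := Bg1 T). nra. }
  clear TR; apply Rabs_le_between in TR'.
  assert (SG : sum1 (fun m => g (INR m * s)) n = ln_fact n + INR n * ln s + ln_gf s n).
  { unfold ln_fact, ln_gf, g, h; rewrite <- sum1_const, <- !sum1_plus.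
    apply sum1_ext; intros m Hm.
    rewrite ln_mult; [ring|apply lt_0_INR; lia|lra]. }
  rewrite SG in TR'; clear SG.
  assert (BI := bose_int_main s T Hs HT); apply Rabs_le_between in BI.
  assert (ST := stirling n Hn); apply Rabs_le_between in ST.
  assert (LT : ln T = ln (INR n) + ln s) by (unfold T; apply ln_mult; lra).
  assert (HhT : 0 <= h T /\ T * h T <= bose T) by (apply neg_ln_1m_exp_bound; lra).
  assert (TB := T_bose_small T HT).
  assert (Hhs : - ln s <= h s <= s - ln s).
  { destruct (exp_neg_bounds s) as [[H1 H2] H3]; [lra|].
    assert (H4 := exp_neg_lt1 s (proj1 Hs)).
    unfold h; split.
    - enough (ln (1 - exp (- s)) <= ln s) by lra.
      destruct (Rle_lt_or_eq_dec (1 - exp (- s)) s) as [H| H]; [lra| |rewrite H; lra].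
      left; apply ln_increasing; lra.
    - enough (ln s <= ln (1 + s) + ln (1 - exp (- s))).
      { assert (ln (1 + s) <= s) by (apply ln_1p_bounds; lra). lra. }
      rewrite <- ln_mult by lra.
      destruct (Rle_lt_or_eq_dec s ((1 + s) * (1 - exp (- s)))) as [H| H]; [lra| |rewrite <- H; lra].
      left; apply ln_increasing; lra. }
  assert (Hin : 0 < / INR n <= s).
  { split; [apply Rinv_0_lt_compat; lra|].
    apply Rmult_le_reg_r with (INR n); [lra|]. rewrite Rinv_l by lra. unfold T in HT; lra. }
  set (e := exp (- (T / 2))) in *.
  assert (He : 0 < e) by apply exp_pos.
  (* s times the error splits into the errors of the trapezoidal rule, of Stirling's formula and of
     the integral, and boundary terms at T and at s. *)
  assert (EX : s * (ln_gf s n - (PI ^ 2 / (6 * s) + ln s / 2 - ln (2 * PI) / 2))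
    = - (F T - F s - s * (ln_fact n + INR n * ln s + ln_gf s n - (g s + g T) / 2))
      - s * (ln_fact n - ((INR n + 1 / 2) * ln (INR n) - INR n + ln (2 * PI) / 2))
      + (bose_int T - bose_int s - PI ^ 2 / 6 + s)
      + T * h T + s * h T / 2 - s * (h s + ln s) / 2).
  { unfold F, g; rewrite LT.
    generalize (h T) (h s) (bose_int T) (bose_int s) (ln (INR n)) (ln s) (ln_fact n)
      (ln_gf s n) (ln (2 * PI)); intros; unfold T; field; lra. }
  apply Rmult_le_reg_l with s; [lra|].
  rewrite <- (Rabs_right s) at 1 by lra; rewrite <- Rabs_mult, EX.
  replace (s * (4 * s + 30 * e / s)) with (4 * s ^ 2 + 30 * e) by (field; lra).
  assert (B1 : Rabs (s * (ln_fact n - ((INR n + 1 / 2) * ln (INR n) - INR n + ln (2 * PI) / 2))) <= s ^ 2).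
  { rewrite Rabs_mult, (Rabs_right s) by lra.
    replace (s ^ 2) with (s * s) by ring. apply Rmult_le_compat_l; [lra|].
    apply Rabs_le; lra. }
  apply Rabs_le_between in B1.
  assert (B2 : 0 <= T * h T <= 16 * e /\ 0 <= h T <= T * h T).
  { repeat split; nra. }
  assert (B3 : 0 <= s * h T / 2 <= 8 * e) by (split; nra).
  assert (B4 : 0 <= s * (h s + ln s) / 2 <= s ^ 2 / 2) by (split; nra).
  assert (0 < s ^ 2) by (apply pow_lt; lra).
  apply Rabs_le; split; lra.
Qed.

(** * Coefficients as Fourier integrals *)

(* (1 - r) / (1 - r e^{it}) has modulus exp (ln_mod r t) and argument arg r t. *)
Definition ln_mod (r t : R) : R := - (ln (1 + 4 * r * sin (t / 2) ^ 2 / (1 - r) ^ 2) / 2).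
Definition arg (r t : R) : R := atan (r * sin t / (1 - r * cos t)).

(** Keeps 1 - r e^{it} in the right half-plane, so that the atan in [arg] is on the right branch. *)
Lemma one_minus_rcos_pos (r t : R) : 0 < r < 1 -> 0 < 1 - r * cos t.
Proof. intros Hr; assert (H := COS_bound t); nra. Qed.

Lemma ln_mod_arg_nonneg (r t : R) : 0 < r < 1 -> 0 <= 4 * r * sin (t / 2) ^ 2 / (1 - r) ^ 2.
Proof.
  intros Hr; apply Rmult_le_pos.
  - apply Rmult_le_pos; [lra|apply pow2_ge_0].
  - left; apply Rinv_0_lt_compat; nra.
Qed.

Lemma cos_half (t : R) : cos t = 1 - 2 * sin (t / 2) ^ 2.
Proof. replace t with (2 * (t / 2)) at 1 by field; rewrite cos_2a_sin; ring. Qed.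

(** Real part of z (1 - r e^{it}) e^{i phi} = (1 - r) e^{i phi}, where z has modulus exp (ln_mod r
    t) and argument arg r t. In this form a factor can be removed under the integral sign. *)
Lemma polar_factor (r t phi : R) : 0 < r < 1 ->
  exp (ln_mod r t) * (cos (arg r t + phi) - r * cos (arg r t + phi + t)) = (1 - r) * cos phi.
Proof.
  intros Hr.
  assert (Hc := one_minus_rcos_pos r t Hr).
  assert (Hv := ln_mod_arg_nonneg r t Hr).
  set (c := 1 - r * cos t) in *; set (d := r * sin t).
  assert (Hcd : 0 < c ^ 2 + d ^ 2) by nra.
  set (rho := sqrt (c ^ 2 + d ^ 2)).
  assert (Hrho : 0 < rho) by (apply sqrt_lt_R0; assumption).
  assert (Erho : rho * rho = c ^ 2 + d ^ 2) by (apply sqrt_sqrt; lra).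
  assert (Ev : 1 + 4 * r * sin (t / 2) ^ 2 / (1 - r) ^ 2 = (rho / (1 - r)) ^ 2).
  { transitivity ((rho * rho) / (1 - r) ^ 2); [|field; lra].
    rewrite Erho; unfold c, d.
    assert (H := sin2_cos2 t); unfold Rsqr in H.
    replace ((1 - r * cos t) ^ 2 + (r * sin t) ^ 2)
      with (1 - 2 * r * cos t + r ^ 2 * (sin t * sin t + cos t * cos t)) by ring.
    rewrite H, cos_half; field; lra. }
  assert (Eexp : exp (ln_mod r t) = (1 - r) / rho).
  { unfold ln_mod; rewrite Ev.
    assert (0 < rho / (1 - r)) by (apply Rmult_lt_0_compat; [lra|apply Rinv_0_lt_compat; lra]).
    replace ((rho / (1 - r)) ^ 2) with ((rho / (1 - r)) * (rho / (1 - r))) by ring.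
    rewrite ln_mult by assumption.
    replace (- ((ln (rho / (1 - r)) + ln (rho / (1 - r))) / 2)) with (- ln (rho / (1 - r))) by field.
    rewrite exp_Ropp, exp_ln by assumption; field; lra. }
  assert (Es : sqrt (1 + (d / c)²) = rho / c).
  { replace (1 + (d / c)²) with ((rho / c) * (rho / c)).
    - apply sqrt_square; apply Rmult_le_pos; [lra|left; apply Rinv_0_lt_compat; lra].
    - transitivity ((rho * rho) / (c * c)); [field; lra|].
      rewrite Erho; unfold Rsqr; field; lra. }
  assert (Ecos : cos (arg r t) = c / rho).
  { unfold arg; fold c d; rewrite cos_atan, Es; field; lra. }
  assert (Esin : sin (arg r t) = d / rho).
  { unfold arg; fold c d; rewrite sin_atan, Es; field; lra. }
  rewrite (cos_plus (arg r t + phi) t), cos_plus, sin_plus, Ecos, Esin, Eexp.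
  replace (cos t) with ((1 - c) / r) by (unfold c; field; lra).
  replace (sin t) with (d / r) by (unfold d; field; lra).
  transitivity ((1 - r) * cos phi * ((c ^ 2 + d ^ 2) / (rho * rho))); [field; lra|].
  rewrite Erho; field; lra.
Qed.

Lemma ex_derive_ln_mod (r a x : R) : 0 < r < 1 -> ex_derive (fun x => ln_mod r (a * x)) x.
Proof.
  intros Hr; assert (H := ln_mod_arg_nonneg r (a * x) Hr); unfold ln_mod in *; auto_derive.
  unfold Rdiv in H; apply Rlt_le_trans with (1 + 0); [lra|now apply Rplus_le_compat_l].
Qed.

Lemma ex_derive_arg (r a x : R) : 0 < r < 1 -> ex_derive (fun x => arg r (a * x)) x.
Proof.
  intros Hr; assert (H := one_minus_rcos_pos r (a * x) Hr); unfold arg in *; auto_derive.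
  lra.
Qed.

Definition ln_gf_mod (s : R) (n : nat) (x : R) : R :=
  sum1 (fun m => ln_mod (exp (- (INR m * s))) (INR m * x)) n.
Definition gf_arg (s : R) (n : nat) (x : R) : R :=
  sum1 (fun m => arg (exp (- (INR m * s))) (INR m * x)) n.

Lemma exp_neg_mult_bounds (s : R) (m : nat) : 0 < s -> (1 <= m)%nat -> 0 < exp (- (INR m * s)) < 1.
Proof.
  intros Hs Hm; assert (1 <= INR m) by (apply (le_INR 1); assumption).
  split; [apply exp_pos|apply exp_neg_lt1; nra].
Qed.

Lemma ex_derive_sum1 (f : nat -> R -> R) (n : nat) (x : R) :
  (forall m, (1 <= m <= n)%nat -> ex_derive (f m) x) ->
  ex_derive (fun x => sum1 (fun m => f m x) n) x.
Proof.
  intros H; eexists; apply (is_derive_sum1 f (fun m => Derive (f m))).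
  intros m Hm; apply Derive_correct; auto.
Qed.

Lemma ex_derive_ln_gf_mod (s : R) (n : nat) (x : R) : 0 < s -> ex_derive (ln_gf_mod s n) x.
Proof.
  intros Hs; apply ex_derive_sum1; intros m Hm; apply ex_derive_ln_mod.
  apply exp_neg_mult_bounds; [assumption|lia].
Qed.

Lemma ex_derive_gf_arg (s : R) (n : nat) (x : R) : 0 < s -> ex_derive (gf_arg s n) x.
Proof.
  intros Hs; apply ex_derive_sum1; intros m Hm; apply ex_derive_arg.
  apply exp_neg_mult_bounds; [assumption|lia].
Qed.

Lemma ln_mod_le0 (r t : R) : 0 < r < 1 -> ln_mod r t <= 0.
Proof.
  intros Hr; assert (H := ln_mod_arg_nonneg r t Hr); unfold ln_mod.
  enough (0 <= ln (1 + 4 * r * sin (t / 2) ^ 2 / (1 - r) ^ 2)) by lra.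
  rewrite <- ln_1; destruct H as [H| <-]; [left; apply ln_increasing; lra|].
  rewrite Rplus_0_r; lra.
Qed.

Lemma ln_gf_mod_le0 (s : R) (n : nat) (x : R) : 0 < s -> ln_gf_mod s n x <= 0.
Proof.
  intros Hs; unfold ln_gf_mod.
  replace 0 with (sum1 (fun _ => 0) n) by (rewrite sum1_const; ring).
  apply sum1_le; intros m Hm; apply ln_mod_le0, exp_neg_mult_bounds; [assumption|lia].
Qed.

(** Real part of the coefficient integrand at exp (- s + i x), divided by the value of the product
    at exp (- s). The imaginary part is odd in x, so [0, PI] stands for the whole circle. A real nu
    admits negative indices. *)
Definition fourier_fun (s : R) (n : nat) (nu x : R) : R :=
  exp (ln_gf_mod s n x) * cos (gf_arg s n x - nu * x).
Definition fourier (s : R) (n : nat) (nu : R) : R := RInt (fourier_fun s n nu) 0 PI.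

Lemma continuous_fourier_fun (s : R) (n : nat) (nu x : R) :
  0 < s -> continuous (fourier_fun s n nu) x.
Proof.
  intros Hs; apply (ex_derive_continuous (fourier_fun s n nu)); unfold fourier_fun.
  assert (H1 := ex_derive_ln_gf_mod s n x Hs); assert (H2 := ex_derive_gf_arg s n x Hs).
  auto_derive; tauto.
Qed.

(** [polar_factor] under the integral, with phi the phase of the remaining n factors. *)
Lemma fourier_rec (s : R) (n : nat) (nu : R) : 0 < s ->
  fourier s (S n) nu - exp (- (INR (S n) * s)) * fourier s (S n) (nu - INR (S n))
  = (1 - exp (- (INR (S n) * s))) * fourier s n nu.
Proof.
  intros Hs.
  assert (Hc : forall n nu, ex_RInt (fourier_fun s n nu) 0 PI)
    by (intros; apply ex_RInt_cont; intros; now apply continuous_fourier_fun).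
  unfold fourier.
  transitivity (1 * RInt (fourier_fun s (S n) nu) 0 PI
    + - exp (- (INR (S n) * s)) * RInt (fourier_fun s (S n) (nu - INR (S n))) 0 PI); [ring|].
  transitivity ((1 - exp (- (INR (S n) * s))) * RInt (fourier_fun s n nu) 0 PI
    + 0 * RInt (fourier_fun s n nu) 0 PI); [|ring].
  rewrite <- !RInt_lin by auto.
  apply RInt_ext; intros x _; match goal with |- ?a = ?b => change (@eq R a b) end.
  unfold fourier_fun, ln_gf_mod, gf_arg; rewrite !sum1_S.
  rewrite exp_plus.
  set (L := sum1 _ n); set (P := sum1 _ n).
  set (r := exp (- (INR (S n) * s))).
  assert (Hr : 0 < r < 1) by (apply exp_neg_mult_bounds; [assumption|lia]).
  assert (H := polar_factor r (INR (S n) * x) (P - nu * x) Hr).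
  replace (P + arg r (INR (S n) * x) - nu * x) with (arg r (INR (S n) * x) + (P - nu * x)) by ring.
  replace (P + arg r (INR (S n) * x) - (nu - INR (S n)) * x)
    with (arg r (INR (S n) * x) + (P - nu * x) + INR (S n) * x) by ring.
  transitivity (exp L * (exp (ln_mod r (INR (S n) * x)) *
    (cos (arg r (INR (S n) * x) + (P - nu * x))
     - r * cos (arg r (INR (S n) * x) + (P - nu * x) + INR (S n) * x)))); [ring|].
  rewrite H; ring.
Qed.

Lemma fourier_0 (s : R) (z : Z) : fourier s 0 (IZR z) = if Z.eq_dec z 0 then PI else 0.
Proof.
  unfold fourier, fourier_fun, ln_gf_mod, gf_arg; simpl.
  destruct (Z.eq_dec z 0) as [->|Hz].
  - rewrite (RInt_ext _ (fun _ => 1)).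
    + rewrite (RInt_const (V := R_CompleteNormedModule)).
      change (scal (PI - 0) 1) with ((PI - 0) * 1); ring.
    + intros x _; rewrite exp_0, Rmult_0_l, Rminus_0_r, cos_0; apply Rmult_1_l.
  - assert (Hz' : IZR z <> 0) by now apply not_0_IZR.
    rewrite (RInt_deriv (fun x => sin (IZR z * x) / IZR z)).
    + rewrite Rmult_0_r, sin_0, (sin_eq_0_1 (IZR z * PI)) by (now exists z). field; assumption.
    + intros x; auto_derive; [exact I|].
      rewrite exp_0; replace (0 - IZR z * x) with (- (IZR z * x)) by ring.
      rewrite cos_neg; field; assumption.
    + intros x; apply (ex_derive_continuous (fun x => _ * _)); auto_derive; exact I.
Qed.

Lemma fourier_bound (s : R) (n : nat) (nu : R) : 0 < s -> Rabs (fourier s n nu) <= PI.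
Proof.
  intros Hs; assert (HP := PI_RGT_0).
  replace PI with ((PI - 0) * 1) at 1 by ring.
  apply abs_RInt_le_const; [lra| |].
  - apply ex_RInt_cont; intros; now apply continuous_fourier_fun.
  - intros t _; unfold fourier_fun; rewrite Rabs_mult.
    rewrite (Rabs_right (exp _)) by (left; apply exp_pos).
    assert (H1 := exp_le _ _ (ln_gf_mod_le0 s n t Hs)); rewrite exp_0 in H1.
    assert (H2 : Rabs (cos (gf_arg s n t - nu * t)) <= 1) by apply Rabs_le, COS_bound.
    assert (H3 := exp_pos (ln_gf_mod s n t)).
    assert (H4 := Rabs_pos (cos (gf_arg s n t - nu * t))). nra.
Qed.

(** Once the smaller product has no negative coefficients, the recurrence reduces index z to z - (n
    + 1) at the cost of a factor r < 1; iterating against the uniform bound PI forces 0. This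
    replaces an appeal to analyticity. *)
Lemma fourier_neg (s : R) (n : nat) (z : Z) : 0 < s -> (z < 0)%Z -> fourier s n (IZR z) = 0.
Proof.
  intros Hs; revert z; induction n as [|n IH]; intros z Hz.
  - rewrite fourier_0; destruct (Z.eq_dec z 0); [lia|reflexivity].
  - set (r := exp (- (INR (S n) * s))).
    assert (Hr : 0 < r < 1) by (apply exp_neg_mult_bounds; [assumption|lia]).
    assert (HB : forall j z, (z < 0)%Z -> Rabs (fourier s (S n) (IZR z)) <= r ^ j * PI).
    { induction j as [|j IHj]; intros y Hy.
      - simpl; rewrite Rmult_1_l; now apply fourier_bound.
      - assert (H := fourier_rec s n (IZR y) Hs); fold r in H.
        rewrite IH, Rmult_0_r in H by assumption.
        rewrite (INR_IZR_INZ (S n)), <- minus_IZR in H.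
        replace (fourier s (S n) (IZR y))
          with (r * fourier s (S n) (IZR (y - Z.of_nat (S n)))) by lra.
        rewrite Rabs_mult, Rabs_right by lra.
        assert (H1 := IHj (y - Z.of_nat (S n))%Z); simpl.
        rewrite Rmult_assoc; apply Rmult_le_compat_l; [lra|apply H1; lia]. }
    assert (HP := PI_RGT_0).
    destruct (Req_dec (fourier s (S n) (IZR z)) 0) as [E|E]; [exact E|exfalso].
    assert (E' := Rabs_pos_lt _ E).
    destruct (pow_lt_1_zero r) with (y := Rabs (fourier s (S n) (IZR z)) / PI) as [N HN].
    + rewrite Rabs_right; lra.
    + apply Rmult_lt_0_compat; [lra|now apply Rinv_0_lt_compat].
    + specialize (HN N (le_n N)); specialize (HB N z Hz).
      rewrite Rabs_right in HN by (apply Rle_ge, pow_le; lra).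
      apply Rmult_lt_compat_r with (r := PI) in HN; [|lra].
      unfold Rdiv in HN; rewrite Rmult_assoc, Rinv_l in HN by lra. lra.
Qed.

(* Cauchy's integral formula for the coefficients of prod_{m <= N} 1/(1-q^m), obtained
   from the recurrence of the coefficients instead of from their generating series. *)
Lemma fourier_coef (c : nat -> nat -> nat) (s : R) (N n : nat) : 0 < s ->
  (forall n, c 0%nat n = if Nat.eq_dec n 0 then 1%nat else 0%nat) ->
  (forall N n, c (S N) n
     = (c N n + if le_dec (S N) n then c (S N) (n - S N) else 0)%nat) ->
  PI * INR (c N n) = exp (INR n * s + ln_gf s N) * fourier s N (INR n).
Proof.
  intros Hs c0 cS; revert n; induction N as [|N IHN].
  - intros n; rewrite c0, (INR_IZR_INZ n), fourier_0; unfold ln_gf; simpl.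
    destruct (Nat.eq_dec n 0) as [->|]; destruct (Z.eq_dec _ 0); try lia.
    + replace (IZR (Z.of_nat 0) * s + 0) with 0 by (simpl; ring); rewrite exp_0; simpl; ring.
    + simpl; ring.
  (* [cS] lowers n by S N without changing the number of factors, hence the inner well-founded
     induction. *)
  - intros n; induction n as [n IHn] using lt_wf_ind.
    set (r := exp (- (INR (S N) * s))).
    assert (Hr : 0 < r < 1) by (apply exp_neg_mult_bounds; [assumption|lia]).
    assert (E1 : exp (INR n * s + ln_gf s (S N)) * (1 - r) = exp (INR n * s + ln_gf s N)).
    { unfold ln_gf; rewrite sum1_S; fold r.
      rewrite <- Rplus_assoc, (exp_plus _ (- ln (1 - r))), exp_Ropp, exp_ln by lra.
      rewrite Rmult_assoc, Rinv_l by lra; ring. }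
    assert (H := fourier_rec s N (INR n) Hs); fold r in H.
    replace (fourier s (S N) (INR n)) with
      (r * fourier s (S N) (INR n - INR (S N)) + (1 - r) * fourier s N (INR n)) by lra.
    rewrite Rmult_plus_distr_l, <- Rmult_assoc, <- Rmult_assoc, E1, <- IHN, cS, plus_INR.
    destruct (le_dec (S N) n) as [Hle|Hle].
    + rewrite <- minus_INR by assumption.
      replace (exp (INR n * s + ln_gf s (S N)) * r)
        with (exp (INR (n - S N) * s + ln_gf s (S N)))
        by (unfold r; rewrite <- exp_plus, minus_INR by assumption; f_equal; ring).
      rewrite <- IHn by lia; ring.
    (* Here n < S N: the shifted index is negative, so its integral vanishes like the absent term of
       the recurrence. *)
    + rewrite !INR_IZR_INZ, <- minus_IZR, fourier_neg by (try assumption; lia).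
      simpl; ring.
Qed.

(** * Expansion of modulus and argument *)

Lemma exp_neg_cube (y : R) : 0 < y -> exp (- y) <= (3 / y) ^ 3.
Proof.
  intros Hy.
  assert (E : exp (- y) = exp (- (y / 3)) ^ 3).
  { replace (exp (- (y / 3)) ^ 3) with (exp (- (y / 3)) * (exp (- (y / 3)) * exp (- (y / 3)))) by ring.
    rewrite <- !exp_plus; f_equal; field. }
  rewrite E; apply pow_incr; split; [left; apply exp_pos|].
  assert (H1 := exp_ineq1_le (y / 3)); assert (H2 := exp_neg (y / 3)).
  assert (H3 := exp_pos (- (y / 3))).
  apply Rmult_le_reg_r with (y / 3); [lra|].
  replace (3 / y * (y / 3)) with 1 by (field; lra). nra.
Qed.

Lemma PI_sqr_bounds : 9 <= PI ^ 2 <= 16.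
Proof. assert (H1 := PI2_3_2); assert (H2 := PI_4); nra. Qed.

(** The saddle equation puts the cut-off T = n s beyond 1 / s, so exp (- T / 2) <= (6 s)^3. *)
Lemma exp_tail_small (s : R) (n : nat) : 0 < s -> INR n * s ^ 2 = PI ^ 2 / 6 ->
  1 <= s * (INR n * s) /\ exp (- (INR n * s / 2)) <= 216 * s ^ 3.
Proof.
  intros Hs En; assert (HP := PI_sqr_bounds).
  assert (H : 1 <= s * (INR n * s)).
  { replace (s * (INR n * s)) with (INR n * s ^ 2) by ring; lra. }
  split; [exact H|].
  assert (HT : 0 < INR n * s / 2) by nra.
  eapply Rle_trans; [apply exp_neg_cube, HT|].
  replace (216 * s ^ 3) with ((6 * s) ^ 3) by ring.
  apply pow_incr; split; [apply Rmult_le_pos; [lra|left; apply Rinv_0_lt_compat; lra]|].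
  apply Rmult_le_reg_r with (INR n * s / 2); [lra|].
  replace (3 / (INR n * s / 2) * (INR n * s / 2)) with 3 by (field; nra). nra.
Qed.

(** The constants round up 3 + 4 * 216, 6 + 24 * 216 and 4 + 30 * 216. *)
Lemma sum_asym (s : R) (n : nat) : 0 < s <= 1 -> INR n * s ^ 2 = PI ^ 2 / 6 ->
  Rabs (s * sum1 (fun m => bose (INR m * s)) n - PI ^ 2 / 6) <= 900 * s /\
  Rabs (s * sum1 (fun m => bose2 (INR m * s)) n - PI ^ 2 / 3) <= 6000 * s /\
  Rabs (ln_gf s n - (PI ^ 2 / (6 * s) + ln s / 2 - ln (2 * PI) / 2)) <= 7000 * s.
Proof.
  intros Hs En.
  destruct (exp_tail_small s n (proj1 Hs) En) as [H1 H2].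
  assert (HT : 1 <= INR n * s) by nra.
  assert (Hn : (1 <= n)%nat).
  { destruct n; [simpl in HT; lra|lia]. }
  assert (S1 := sum_bose_asym s n Hs Hn HT).
  assert (S2 := sum_bose2_asym s n Hs Hn HT).
  assert (S3 := ln_gf_asym_gen s n Hs Hn HT).
  assert (s ^ 3 <= s) by nra.
  repeat split; [lra|lra|].
  eapply Rle_trans; [exact S3|].
  apply Rle_trans with (4 * s + 30 * (216 * s ^ 3) / s).
  - apply Rplus_le_compat_l, Rmult_le_compat_r; [left; apply Rinv_0_lt_compat; lra|lra].
  - replace (30 * (216 * s ^ 3) / s) with (6480 * s ^ 2) by (field; lra). nra.
Qed.

Lemma Rabs_sin_le (x : R) : Rabs (sin x) <= Rabs x.
Proof.
  assert (H : forall u, 0 <= u -> Rabs (sin u) <= u).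
  { intros u Hu.
    destruct (mvt sin cos 0 u Hu) as [c [Hc E]].
    - intros y _; auto_derive; [exact I|ring].
    - rewrite sin_0 in E; assert (H := COS_bound c); apply Rabs_le; nra. }
  destruct (Rle_dec 0 x) as [Hx|Hx].
  - rewrite (Rabs_right x) by lra; now apply H.
  - rewrite <- (Rabs_Ropp (sin x)), <- sin_neg, (Rabs_left x) by lra; apply H; lra.
Qed.

Lemma cos_ge_quadratic (t : R) : 1 - cos t <= t ^ 2 / 2.
Proof.
  rewrite cos_half.
  assert (H : Rabs (sin (t / 2)) <= Rabs (t / 2)) by apply Rabs_sin_le.
  apply Rsqr_le_abs_1 in H; unfold Rsqr in H; nra.
Qed.

(** Mean value theorem: the derivative of [arg] in t equals r / (1 - r) at 0 and departs from it
    only by a multiple of 1 - cos c. *)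
Lemma arg_approx (r t : R) : 0 < r < 1 -> 0 <= t ->
  Rabs (arg r t - t * (r / (1 - r))) <= t ^ 3 * (r / (1 - r) ^ 3).
Proof.
  intros Hr Ht.
  destruct (mvt (arg r) (fun c => (r * cos c - r ^ 2) / ((1 - r) ^ 2 + 2 * r * (1 - cos c))) 0 t Ht)
    as [c [Hc E]].
  - intros x _; assert (H := one_minus_rcos_pos r x Hr); assert (H1 := COS_bound x).
    assert (H2 : 0 < (1 - r) ^ 2 + 2 * r * (1 - cos x)) by nra.
    unfold arg; auto_derive; [lra|].
    assert (H3 := sin2_cos2 x); unfold Rsqr in H3.
    assert (H4 : (1 + - (r * cos x)) ^ 2 + (r * sin x) ^ 2 = (1 - r) ^ 2 + 2 * r * (1 - cos x)).
    { replace ((1 + - (r * cos x)) ^ 2 + (r * sin x) ^ 2)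
      with (1 - 2 * r * cos x + r ^ 2 * (sin x * sin x + cos x * cos x)) by ring.
      rewrite H3; ring. }
    rewrite <- H4; rewrite <- H4 in H2.
    unfold Rsqr.
    replace (r * cos x - r ^ 2) with (r * cos x - r ^ 2 * (sin x * sin x + cos x * cos x))
      by (rewrite H3; ring).
    field; repeat split; try lra; nra.
  - assert (A0 : arg r 0 = 0).
    { unfold arg; rewrite sin_0, Rmult_0_r, Rdiv_0_l; apply atan_0. }
    rewrite A0, !Rminus_0_r in E; rewrite E.
    assert (H1 := COS_bound c); assert (H5 := cos_ge_quadratic c).
    assert (H2 : 0 < (1 - r) ^ 2 + 2 * r * (1 - cos c)) by nra.
    set (Q := (1 - r) ^ 2 + 2 * r * (1 - cos c)) in *.
    assert (HQ : (1 - r) ^ 2 <= Q) by (unfold Q; nra).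
    replace ((r * cos c - r ^ 2) / Q * t - t * (r / (1 - r)))
      with (- (t * (r * (1 + r) * (1 - cos c) / ((1 - r) * Q)))) by (unfold Q in *; field; lra).
    assert (Hp : 0 < / ((1 - r) * Q)) by (apply Rinv_0_lt_compat; nra).
    rewrite Rabs_Ropp, Rabs_right.
    2: { apply Rle_ge, Rmult_le_pos; [lra|apply Rmult_le_pos; [|lra]].
         apply Rmult_le_pos; [nra|lra]. }
    replace (t ^ 3 * (r / (1 - r) ^ 3)) with (t * (r * t ^ 2 / ((1 - r) ^ 3))) by (field; lra).
    apply Rmult_le_compat_l; [lra|].
    unfold Rdiv; apply Rmult_le_compat.
    + apply Rmult_le_pos; [nra|lra].
    + lra.
    + assert (c ^ 2 <= t ^ 2) by nra.
      apply Rle_trans with (r * 2 * (t ^ 2 / 2)); [|lra].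
      apply Rmult_le_compat; nra.
    + apply Rinv_le_contravar; [apply pow_lt; lra|].
      replace ((1 - r) ^ 3) with ((1 - r) * (1 - r) ^ 2) by ring.
      apply Rmult_le_compat_l; lra.
Qed.

Lemma sin_sqr_bounds (u : R) : 0 <= u -> u ^ 2 - u ^ 4 <= sin u ^ 2 <= u ^ 2.
Proof.
  intros Hu.
  assert (H1 : Rabs (sin u) <= Rabs u) by apply Rabs_sin_le.
  rewrite (Rabs_right u) in H1 by lra; apply Rabs_le_between in H1.
  destruct (mvt (fun t => t - sin t) (fun t => 1 - cos t) 0 u Hu) as [c [Hc E]].
  - intros x _; auto_derive; [exact I|ring].
  - rewrite sin_0 in E; assert (H2 := cos_ge_quadratic c).
    assert (H3 : u - sin u <= u ^ 3 / 2).
    { assert (c ^ 2 <= u ^ 2) by nra.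
      replace (u ^ 3 / 2) with (u ^ 2 / 2 * u) by field.
      replace (u - sin u) with ((1 - cos c) * (u - 0)) by lra. nra. }
    split; [|nra].
    assert (0 <= u ^ 3) by (apply pow_le; lra).
    assert ((u - sin u) * (u + sin u) <= u ^ 3 / 2 * (2 * u)) by (apply Rmult_le_compat; lra).
    nra.
Qed.

(** The two error terms come from the quadratic term of the logarithm and from replacing sin^2 (t /
    2) by t^2 / 4. *)
Lemma ln_mod_approx (r t : R) : 0 < r < 1 -> 0 <= t ->
  Rabs (ln_mod r t + t ^ 2 * (r / (1 - r) ^ 2) / 2)
    <= t ^ 4 * (r ^ 2 / (1 - r) ^ 4 + r / (1 - r) ^ 2).
Proof.
  intros Hr Ht; unfold ln_mod.
  assert (Hv := ln_mod_arg_nonneg r t Hr).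
  destruct (ln_1p_bounds _ Hv) as [_ [_ [L1 L2]]].
  destruct (sin_sqr_bounds (t / 2)) as [S1 S2]; [lra|].
  set (k := r / (1 - r) ^ 2).
  assert (Hk : 0 < k) by (apply Rmult_lt_0_compat; [lra|apply Rinv_0_lt_compat; nra]).
  replace (4 * r * sin (t / 2) ^ 2 / (1 - r) ^ 2) with (4 * k * sin (t / 2) ^ 2) in *
    by (unfold k; field; lra).
  replace (r ^ 2 / (1 - r) ^ 4) with (k ^ 2) by (unfold k; field; lra).
  set (l := ln (1 + 4 * k * sin (t / 2) ^ 2)) in *.
  set (S := sin (t / 2) ^ 2) in *.
  assert (HS : 0 <= S) by apply pow2_ge_0.
  assert (B1 : 4 * k * S <= k * t ^ 2) by nra.
  assert (B2 : k * t ^ 2 - k * t ^ 4 <= 4 * k * S).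
  { assert (0 <= t ^ 4) by (apply pow_le; lra). nra. }
  assert (B3 : (4 * k * S) ^ 2 <= k ^ 2 * t ^ 4).
  { replace (k ^ 2 * t ^ 4) with ((k * t ^ 2) ^ 2) by ring. apply pow_incr; nra. }
  assert (0 <= k * t ^ 4) by (apply Rmult_le_pos; [lra|apply pow_le; lra]).
  assert (0 <= (4 * k * S) ^ 2) by apply pow2_ge_0.
  apply Rabs_le; split; lra.
Qed.

(** 4096 is 8^4, from (1 + y) exp (- y / 8) <= 8. *)
Lemma poly_exp_bound (y : R) : 0 <= y ->
  (1 + y) ^ 3 * exp (- y) <= 4096 * exp (- (y / 2)) /\
  (1 + y) ^ 4 * exp (- y) <= 4096 * exp (- (y / 2)).
Proof.
  intros Hy.
  assert (H4 : (1 + y) ^ 4 * exp (- y) <= 4096 * exp (- (y / 2))).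
  { assert (E : exp (- y) = exp (- (y / 8)) ^ 4 * exp (- (y / 2))).
    { replace (exp (- (y / 8)) ^ 4) with (exp (- (y / 8)) * exp (- (y / 8)) * exp (- (y / 8)) * exp (- (y / 8)))
        by ring.
      rewrite <- !exp_plus; f_equal; field. }
    rewrite E, <- Rmult_assoc, <- Rpow_mult_distr.
    apply Rmult_le_compat_r; [left; apply exp_pos|].
    replace 4096 with (8 ^ 4) by ring.
    assert (H1 := exp_ineq1_le (y / 8)); assert (H2 := exp_neg (y / 8)).
    assert (H3 := exp_pos (- (y / 8))).
    apply pow_incr; split; nra. }
  split; [|exact H4].
  eapply Rle_trans; [|exact H4].
  apply Rmult_le_compat_r; [left; apply exp_pos|].
  apply Rle_pow; [lra|lia].
Qed.

(** With y = m s and z = x / s, the bound y / (1 - r) <= 1 + y turns the error of factor m into z^3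
    (1 + y)^3 exp (- y), which is summable over m. The linear term is the one that cancels n x at
    the saddle point. *)
Lemma gf_arg_approx (s : R) (n : nat) (x : R) : 0 < s -> 0 <= x ->
  Rabs (gf_arg s n x - x / s * sum1 (fun m => bose (INR m * s)) n) <= 8192 * x ^ 3 / s ^ 4.
Proof.
  intros Hs Hx; unfold gf_arg; rewrite <- sum1_scal, <- sum1_minus.
  apply Rle_trans with (sum1 (fun m => 4096 * (x / s) ^ 3 * exp (- (INR m * (s / 2)))) n).
  - apply sum1_Rabs_le; intros m Hm.
    assert (Hm' : 1 <= INR m) by (apply (le_INR 1); lia).
    set (y := INR m * s).
    assert (Hy : 0 < y) by (unfold y; nra).
    replace (INR m * (s / 2)) with (y / 2) by (unfold y; field).
    replace (INR m * x) with (y * (x / s)) by (unfold y; field; lra).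
    assert (Hxs : 0 <= x / s) by (apply Rmult_le_pos; [lra|left; apply Rinv_0_lt_compat; lra]).
    set (z := x / s) in *.
    assert (Hr : 0 < exp (- y) < 1) by (split; [apply exp_pos|now apply exp_neg_lt1]).
    destruct (exp_neg_bounds y) as [_ B]; [lra|].
    destruct (poly_exp_bound y) as [P _]; [lra|].
    assert (H := arg_approx (exp (- y)) (y * z) Hr); specialize (H ltac:(nra)).
    replace (z * bose y) with (y * z * (exp (- y) / (1 - exp (- y))))
      by (unfold bose; gen_exp; field; lra).
    eapply Rle_trans; [exact H|].
    set (r := exp (- y)) in *.
    assert (B' : y / (1 - r) <= 1 + y).
    { apply Rmult_le_reg_r with (1 - r); [lra|].
      replace (y / (1 - r) * (1 - r)) with y by (field; lra). exact B. }
    replace ((y * z) ^ 3 * (r / (1 - r) ^ 3)) with (z ^ 3 * ((y / (1 - r)) ^ 3 * r)) by (field; lra).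
    replace (4096 * z ^ 3 * exp (- (y / 2))) with (z ^ 3 * (4096 * exp (- (y / 2)))) by ring.
    apply Rmult_le_compat_l; [now apply pow_le|].
    eapply Rle_trans; [|exact P].
    apply Rmult_le_compat_r; [lra|].
    apply pow_incr; split; [apply Rmult_le_pos; [lra|left; apply Rinv_0_lt_compat; lra]|exact B'].
  - rewrite sum1_scal.
    replace (8192 * x ^ 3 / s ^ 4) with (4096 * (x / s) ^ 3 * / (s / 2)) by (field; lra).
    apply Rmult_le_compat_l; [|apply sum1_geom; lra].
    apply Rmult_le_pos; [lra|apply pow_le].
    apply Rmult_le_pos; [lra|left; apply Rinv_0_lt_compat; lra].
Qed.

Lemma ln_gf_mod_approx (s : R) (n : nat) (x : R) : 0 < s -> 0 <= x ->
  Rabs (ln_gf_mod s n x + x ^ 2 / (2 * s ^ 2) * sum1 (fun m => bose2 (INR m * s)) n)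
    <= 16384 * x ^ 4 / s ^ 5.
Proof.
  intros Hs Hx; unfold ln_gf_mod; rewrite <- sum1_scal, <- sum1_plus.
  apply Rle_trans with (sum1 (fun m => 8192 * (x / s) ^ 4 * exp (- (INR m * (s / 2)))) n).
  - apply sum1_Rabs_le; intros m Hm.
    assert (Hm' : 1 <= INR m) by (apply (le_INR 1); lia).
    set (y := INR m * s).
    assert (Hy : 0 < y) by (unfold y; nra).
    replace (INR m * (s / 2)) with (y / 2) by (unfold y; field).
    replace (INR m * x) with (y * (x / s)) by (unfold y; field; lra).
    replace (x ^ 2 / (2 * s ^ 2)) with ((x / s) ^ 2 / 2) by (field; lra).
    assert (Hxs : 0 <= x / s) by (apply Rmult_le_pos; [lra|left; apply Rinv_0_lt_compat; lra]).
    set (z := x / s) in *.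
    assert (Hr : 0 < exp (- y) < 1) by (split; [apply exp_pos|now apply exp_neg_lt1]).
    destruct (exp_neg_bounds y) as [_ B]; [lra|].
    destruct (poly_exp_bound y) as [_ P]; [lra|].
    assert (H := ln_mod_approx (exp (- y)) (y * z) Hr); specialize (H ltac:(nra)).
    replace (z ^ 2 / 2 * bose2 y) with ((y * z) ^ 2 * (exp (- y) / (1 - exp (- y)) ^ 2) / 2)
      by (unfold bose2; gen_exp; field; lra).
    eapply Rle_trans; [exact H|].
    set (r := exp (- y)) in *.
    assert (B' : 0 <= y / (1 - r) <= 1 + y).
    { split; [apply Rmult_le_pos; [lra|left; apply Rinv_0_lt_compat; lra]|].
      apply Rmult_le_reg_r with (1 - r); [lra|].
      replace (y / (1 - r) * (1 - r)) with y by (field; lra). exact B. }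
    replace ((y * z) ^ 4 * (r ^ 2 / (1 - r) ^ 4 + r / (1 - r) ^ 2))
      with (z ^ 4 * ((y / (1 - r)) ^ 4 * r * r + y ^ 2 * (y / (1 - r)) ^ 2 * r)) by (field; lra).
    replace (8192 * z ^ 4 * exp (- (y / 2)))
      with (z ^ 4 * (4096 * exp (- (y / 2)) + 4096 * exp (- (y / 2)))) by ring.
    apply Rmult_le_compat_l; [now apply pow_le|].
    assert (P4 : (y / (1 - r)) ^ 4 <= (1 + y) ^ 4) by (apply pow_incr; lra).
    assert (P0 : 0 <= (y / (1 - r)) ^ 4) by (apply pow_le; lra).
    assert (P2 : y ^ 2 * (y / (1 - r)) ^ 2 <= (1 + y) ^ 4).
    { replace ((1 + y) ^ 4) with ((1 + y) ^ 2 * (1 + y) ^ 2) by ring.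
      apply Rmult_le_compat; try apply pow2_ge_0; apply pow_incr; lra. }
    assert (H0 : 0 <= (1 + y) ^ 4) by (apply pow_le; lra).
    apply Rplus_le_compat; [|nra].
    apply Rle_trans with ((1 + y) ^ 4 * r); [|exact P].
    apply Rmult_le_compat_r; [lra|]. nra.
  - rewrite sum1_scal.
    replace (16384 * x ^ 4 / s ^ 5) with (8192 * (x / s) ^ 4 * / (s / 2)) by (field; lra).
    apply Rmult_le_compat_l; [|apply sum1_geom; lra].
    apply Rmult_le_pos; [lra|apply pow_le].
    apply Rmult_le_pos; [lra|left; apply Rinv_0_lt_compat; lra].
Qed.

(** * Decay of the modulus away from 0 *)

Lemma ln_mod_upper (y t v : R) : 0 < y <= 1 -> 0 <= v -> v * y ^ 2 <= sin (t / 2) ^ 2 ->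
  ln_mod (exp (- y)) t <= - (v / (2 + v)).
Proof.
  intros Hy Hv Hvs.
  assert (Hr : 0 < exp (- y) < 1) by (split; [apply exp_pos|apply exp_neg_lt1; lra]).
  destruct (exp_neg_bounds y) as [[B1 B2] _]; [lra|].
  (* For y <= 1, 4 exp (- y) >= 1 and 1 - exp (- y) <= y, so the argument of the logarithm is at
     least 1 + v. *)
  assert (B3 : / 4 <= exp (- y)).
  { assert (H := exp_neg y); assert (exp y <= 3) by (apply Rle_trans with (exp 1); [apply exp_le; lra|apply exp_le_3]).
    assert (exp (- y) * 4 >= 1) by nra. lra. }
  assert (Hw : v <= 4 * exp (- y) * sin (t / 2) ^ 2 / (1 - exp (- y)) ^ 2).
  { set (r := exp (- y)) in *; set (S := sin (t / 2) ^ 2) in *.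
    assert (0 < (1 - r) ^ 2) by (apply pow_lt; lra).
    apply Rmult_le_reg_r with ((1 - r) ^ 2); [assumption|].
    replace (4 * r * S / (1 - r) ^ 2 * (1 - r) ^ 2) with (4 * r * S) by (field; lra).
    assert ((1 - r) ^ 2 <= y ^ 2) by (apply pow_incr; lra).
    assert (0 <= S) by apply pow2_ge_0.
    apply Rle_trans with (v * y ^ 2); [apply Rmult_le_compat_l; assumption|nra]. }
  unfold ln_mod.
  set (V := 4 * exp (- y) * sin (t / 2) ^ 2 / (1 - exp (- y)) ^ 2) in *.
  destruct (ln_1p_bounds v Hv) as [L _].
  assert (L2 : ln (1 + v) <= ln (1 + V)).
  { destruct Hw as [Hw| ->]; [left; apply ln_increasing; lra|lra]. }
  replace (v / (2 + v)) with (2 * v / (2 + v) / 2) by (field; lra). lra.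
Qed.

Lemma ln_gf_mod_le_sum (s x c : R) (k n : nat) : 0 < s -> (k <= n)%nat ->
  sum1 (fun m => ln_mod (exp (- (INR m * s))) (INR m * x)) k <= c -> ln_gf_mod s n x <= c.
Proof.
  intros Hs Hk H; eapply Rle_trans; [|exact H].
  enough (sum1 (fun m => -1 * ln_mod (exp (- (INR m * s))) (INR m * x)) k
          <= sum1 (fun m => -1 * ln_mod (exp (- (INR m * s))) (INR m * x)) n)
    by (rewrite !sum1_scal in *; unfold ln_gf_mod; lra).
  apply sum1_le_n; [assumption|].
  intros m Hm; assert (H1 := ln_mod_le0 (exp (- (INR m * s))) (INR m * x)).
  assert (H2 := exp_neg_mult_bounds s m Hs); specialize (H2 ltac:(lia)). specialize (H1 H2); lra.
Qed.

(** Only m <= L / 2 is used: then m x / 2 <= PI / 2, so Jordan's inequality applies and each factor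
    contributes at most - v / 7, where v = (x / (PI s))^2 <= 5. There are at least 4 / (10 s) such
    m. *)
Lemma ln_gf_mod_near (s x : R) (n L : nat) : 0 < s <= 1 / 10 -> 1 <= s * (INR n * s) ->
  INR L * s <= 1 < (INR L + 1) * s -> 0 <= x -> x * INR L <= 2 * PI ->
  ln_gf_mod s n x <= - (x ^ 2 / s ^ 3 / 300).
Proof.
  intros Hs Hn HL Hx HxL.
  assert (HP := PI_RGT_0); assert (HP2 := PI_sqr_bounds).
  assert (HLn : (L <= n)%nat).
  { apply INR_le. assert (INR L * s <= INR n * s) by nra. nra. }
  set (k := Nat.div2 L).
  assert (Hk : (2 * k <= L <= 2 * k + 1)%nat).
  { unfold k; assert (H := Nat.div2_odd L); destruct (Nat.odd L); simpl Nat.b2n in H; lia. }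
  assert (HkL : 2 * INR k <= INR L <= 2 * INR k + 1).
  { destruct Hk as [H1 H2]; apply le_INR in H1; apply le_INR in H2.
    rewrite plus_INR, mult_INR in H2; rewrite mult_INR in H1; simpl in H1, H2; lra. }
  assert (Hs3 : 0 < s ^ 3) by (apply pow_lt; lra).
  set (u := x / s).
  assert (Eu : x = u * s) by (unfold u; field; lra).
  assert (Hu : 0 <= u) by (apply Rmult_le_pos; [lra|left; apply Rinv_0_lt_compat; lra]).
  set (v := u ^ 2 / PI ^ 2).
  assert (Hv0 : 0 <= v) by (apply Rmult_le_pos; [apply pow2_ge_0|left; apply Rinv_0_lt_compat; lra]).
  assert (Ev : v * PI ^ 2 = u ^ 2) by (unfold v; field; lra).
  assert (Hu2 : u * (9 / 10) <= 2 * PI) by (rewrite Eu in HxL; nra).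
  assert (Hv5 : v <= 5).
  { assert ((u * (9 / 10)) ^ 2 <= (2 * PI) ^ 2) by (apply pow_incr; nra). nra. }
  apply ln_gf_mod_le_sum with k; [lra|lia|].
  apply Rle_trans with (sum1 (fun _ => - (v / 7)) k).
  - apply sum1_le; intros m Hm.
    assert (Hm1 : 1 <= INR m) by (apply (le_INR 1); lia).
    assert (Hmk : INR m <= INR k) by (apply le_INR; lia).
    eapply Rle_trans; [apply (ln_mod_upper (INR m * s) (INR m * x) v); [nra|assumption|]|].
    + assert (Hsin : 2 / PI * (INR m * x / 2) <= sin (INR m * x / 2)) by (apply sin_ge_linear; nra).
      replace (v * (INR m * s) ^ 2) with ((2 / PI * (INR m * x / 2)) ^ 2)
        by (rewrite Eu; unfold v; field; lra).
      apply pow_incr; split; [|exact Hsin].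
      apply Rmult_le_pos; [apply Rmult_le_pos; [lra|left; now apply Rinv_0_lt_compat]|nra].
    + apply Ropp_le_contravar; unfold Rdiv; apply Rmult_le_compat_l; [lra|].
      apply Rinv_le_contravar; lra.
  - rewrite sum1_const.
    replace (x ^ 2 / s ^ 3 / 300) with (u ^ 2 / 300 * / s) by (unfold u; field; lra).
    assert (Hks : 4 / 10 * / s <= INR k).
    { apply Rmult_le_reg_r with s; [lra|]. rewrite Rmult_assoc, Rinv_l by lra. nra. }
    assert (0 < / s) by (apply Rinv_0_lt_compat; lra).
    assert (u ^ 2 / 16 <= v) by nra.
    enough (u ^ 2 / 300 * / s <= INR k * (v / 7)) by lra.
    apply Rle_trans with (4 / 10 * / s * (v / 7)).
    + replace (4 / 10 * / s * (v / 7)) with (4 / 70 * v * / s) by (field; lra).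
      apply Rmult_le_compat_r; [lra|]. assert (0 <= u ^ 2) by apply pow2_ge_0. lra.
    + apply Rmult_le_compat_r; lra.
Qed.

Lemma sum_cos (x : R) (n : nat) :
  2 * sin (x / 2) * sum1 (fun m => cos (INR m * x)) n = sin (INR n * x + x / 2) - sin (x / 2).
Proof.
  induction n as [|n IH].
  - simpl; rewrite Rmult_0_l, Rplus_0_l; ring.
  - rewrite sum1_S, Rmult_plus_distr_l, IH, S_INR.
    replace (INR n * x + x / 2) with ((INR n + 1) * x - x / 2) by field.
    rewrite sin_plus, sin_minus; ring.
Qed.

(** For m <= L one has m s <= 1, and the factor contributes at most - (1 - cos (m x)) / 8. Once x L
    >= 2 PI the cosines average out: by Dirichlet's kernel their sum is at most L / 4. *)
Lemma ln_gf_mod_far (s x : R) (n L : nat) : 0 < s <= 1 / 10 -> 1 <= s * (INR n * s) ->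
  INR L * s <= 1 < (INR L + 1) * s -> x <= PI -> 2 * PI <= x * INR L ->
  ln_gf_mod s n x <= - (/ s / 20).
Proof.
  intros Hs Hn HL Hx HxL.
  assert (HP := PI_RGT_0).
  assert (HLn : (L <= n)%nat).
  { apply INR_le. assert (INR L * s <= INR n * s) by nra. nra. }
  assert (HL9 : 9 / 10 * / s <= INR L).
  { apply Rmult_le_reg_r with s; [lra|]. rewrite Rmult_assoc, Rinv_l by lra. nra. }
  assert (Hsi : 0 < / s) by (apply Rinv_0_lt_compat; lra).
  assert (Hx0 : 0 < x) by nra.
  apply ln_gf_mod_le_sum with L; [lra|assumption|].
  apply Rle_trans with (sum1 (fun m => - (1 / 8) + 1 / 8 * cos (INR m * x)) L).
  - apply sum1_le; intros m Hm.
    assert (Hm1 : 1 <= INR m) by (apply (le_INR 1); lia).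
    assert (HmL : INR m <= INR L) by (apply le_INR; lia).
    set (S := sin (INR m * x / 2) ^ 2).
    assert (HS : 0 <= S <= 1).
    { unfold S; assert (H := SIN_bound (INR m * x / 2)); nra. }
    eapply Rle_trans; [apply (ln_mod_upper (INR m * s) (INR m * x) S); [nra|lra|]|].
    + fold S; assert (0 <= INR m * s <= 1) by nra.
      generalize dependent (INR m * s); intros y Hy; assert (y ^ 2 <= 1) by nra. nra.
    + rewrite cos_half; fold S.
      enough (S / 4 <= S / (2 + S)) by lra.
      unfold Rdiv; apply Rmult_le_compat_l; [lra|apply Rinv_le_contravar; lra].
  - rewrite sum1_plus, sum1_const, sum1_scal.
    assert (H := sum_cos x L).
    assert (Hsin : 2 / PI * (x / 2) <= sin (x / 2)) by (apply sin_ge_linear; lra).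
    assert (Hb := SIN_bound (INR L * x + x / 2)).
    assert (Hlow : x <= PI * sin (x / 2)).
    { apply Rmult_le_compat_l with (r := PI) in Hsin; [|lra].
      replace (PI * (2 / PI * (x / 2))) with x in Hsin by (field; lra); exact Hsin. }
    assert (Hs0 : 0 < sin (x / 2)) by nra.
    set (C := sum1 (fun m => cos (INR m * x)) L) in *.
    assert (HC : C <= INR L / 4).
    { destruct (Rle_dec C 0) as [HC|HC]; [nra|].
      assert (2 * sin (x / 2) * C <= 1) by lra.
      assert (2 * x * C <= PI).
      { apply Rle_trans with (2 * (PI * sin (x / 2)) * C); [nra|].
        replace (2 * (PI * sin (x / 2)) * C) with (PI * (2 * sin (x / 2) * C)) by ring. nra. }
      assert (4 * PI * C <= PI * INR L) by nra.
      nra. }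
    lra.
Qed.

(** * Powers of the cosine and elementary estimates *)

Lemma cos_pow_upper (x : R) (M : nat) : 0 <= x <= PI ->
  0 <= cos (x / 2) ^ (2 * M) <= exp (- (INR M * x ^ 2 / 16)).
Proof.
  intros Hx; assert (HP := PI_RGT_0); assert (HP4 := PI_4).
  rewrite pow_mult.
  assert (H := sin2_cos2 (x / 2)); unfold Rsqr in H.
  split; [apply pow_le, pow2_ge_0|].
  assert (Hsin : 2 / PI * (x / 2) <= sin (x / 2)) by (apply sin_ge_linear; lra).
  assert (Hlow : x / 4 <= sin (x / 2)).
  { apply Rle_trans with (2 / PI * (x / 2)); [|exact Hsin].
    replace (2 / PI * (x / 2)) with (x * / PI) by (field; lra).
    unfold Rdiv; apply Rmult_le_compat_l; [lra|]. apply Rinv_le_contravar; lra. }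
  replace (- (INR M * x ^ 2 / 16)) with (INR M * - (x ^ 2 / 16)) by field.
  assert (E : exp (INR M * - (x ^ 2 / 16)) = exp (- (x ^ 2 / 16)) ^ M).
  { clear; induction M as [|M IH]; [simpl; rewrite Rmult_0_l; apply exp_0|].
    rewrite S_INR, Rmult_plus_distr_r, exp_plus, IH, Rmult_1_l; simpl; ring. }
  rewrite E; apply pow_incr; split; [apply pow2_ge_0|].
  eapply Rle_trans; [|apply exp_ineq1_le]. nra.
Qed.

Lemma cos_pow_near (x : R) (M : nat) : 0 <= x <= 1 ->
  exists y, cos (x / 2) ^ (2 * M) = exp y /\ Rabs (y + INR M * x ^ 2 / 4) <= INR M * x ^ 4.
Proof.
  intros Hx.
  assert (H := sin2_cos2 (x / 2)); unfold Rsqr in H.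
  destruct (sin_sqr_bounds (x / 2)) as [S1 S2]; [lra|].
  set (S := sin (x / 2) ^ 2) in *.
  assert (HS0 : 0 <= S) by apply pow2_ge_0.
  assert (HS1 : S <= 1 / 4) by nra.
  assert (Ec : cos (x / 2) ^ 2 = 1 - S) by (unfold S; nra).
  exists (INR M * ln (1 - S)); split.
  - rewrite pow_mult, Ec, <- (exp_ln (1 - S)) at 1 by lra.
    clear; induction M as [|M IH]; [simpl; rewrite Rmult_0_l; now rewrite exp_0|].
    rewrite S_INR, Rmult_plus_distr_r, exp_plus, <- IH, Rmult_1_l; simpl; ring.
  - replace (INR M * ln (1 - S) + INR M * x ^ 2 / 4) with (INR M * (ln (1 - S) + x ^ 2 / 4)) by field.
    rewrite Rabs_mult, (Rabs_right (INR M)) by (apply Rle_ge, pos_INR).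
    apply Rmult_le_compat_l; [apply pos_INR|].
    assert (Hq : 0 <= S / (1 - S)) by (apply Rmult_le_pos; [lra|left; apply Rinv_0_lt_compat; lra]).
    destruct (ln_1p_bounds _ Hq) as [L1 [_ [_ L2]]].
    replace (1 + S / (1 - S)) with (/ (1 - S)) in * by (field; lra).
    rewrite ln_Rinv in * by lra.
    assert (U1 : S / (1 - S) <= S + 2 * S ^ 2).
    { apply Rmult_le_reg_r with (1 - S); [lra|].
      replace (S / (1 - S) * (1 - S)) with S by (field; lra). nra. }
    assert (U2 : S <= 2 * (S / (1 - S)) / (2 + S / (1 - S))).
    { replace (2 * (S / (1 - S)) / (2 + S / (1 - S))) with (2 * S / (2 - S)) by (field; lra).
      apply Rmult_le_reg_r with (2 - S); [lra|].
      replace (2 * S / (2 - S) * (2 - S)) with (2 * S) by (field; lra). nra. }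
    assert (HS2 : S ^ 2 <= ((x / 2) ^ 2) ^ 2) by (apply pow_incr; lra).
    apply Rabs_le; split; nra.
Qed.

Lemma exp_diff (a b c : R) : a <= c -> b <= c -> Rabs (exp a - exp b) <= exp c * Rabs (a - b).
Proof.
  assert (main : forall a b, a <= b -> b <= c -> Rabs (exp a - exp b) <= exp c * Rabs (a - b)).
  { clear; intros a b Hab Hb.
    destruct (mvt exp exp a b Hab) as [d [Hd E]].
    - intros x _; apply is_derive_exp.
    - rewrite <- Rabs_Ropp, Ropp_minus_distr, E, Rabs_mult, (Rabs_right (exp d))
        by (left; apply exp_pos).
      rewrite (Rabs_minus_sym b a); apply Rmult_le_compat_r; [apply Rabs_pos|apply exp_le; lra]. }
  intros Ha Hb; destruct (Rle_dec a b); [now apply main|].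
  rewrite Rabs_minus_sym, (Rabs_minus_sym a b); apply main; lra.
Qed.

(** Linear rather than quadratic: the phases it is applied to are already as small as the permitted
    error. *)
Lemma one_minus_cos_le (t : R) : 0 <= 1 - cos t <= Rabs t.
Proof.
  assert (H := COS_bound t); assert (H1 := cos_ge_quadratic t).
  split; [lra|].
  destruct (Rle_dec (Rabs t) 2) as [H2|H2]; [|lra].
  assert (t ^ 2 = Rabs t ^ 2) by (symmetry; apply pow2_abs).
  assert (H3 := Rabs_pos t). nra.
Qed.

(** Trades the Gaussian for 1 / (1 + w^2), whose integral is an arctangent; 900 is 3 * 300, from (1
    + u) exp (- u / 900) <= 900. *)
Lemma gauss_poly_bound (w : R) :
  (1 + w ^ 2) ^ 2 * exp (- (w ^ 2 / 300)) <= 900 ^ 3 / (1 + w ^ 2).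
Proof.
  set (u := w ^ 2); assert (Hu : 0 <= u) by apply pow2_ge_0.
  apply Rmult_le_reg_r with (1 + u); [lra|].
  replace (900 ^ 3 / (1 + u) * (1 + u)) with (900 ^ 3) by (field; lra).
  replace (exp (- (u / 300))) with (exp (- (u / 900)) ^ 3).
  - replace ((1 + u) ^ 2 * exp (- (u / 900)) ^ 3 * (1 + u)) with (((1 + u) * exp (- (u / 900))) ^ 3) by ring.
    assert (H1 := exp_ineq1_le (u / 900)); assert (H2 := exp_neg (u / 900)).
    assert (H3 := exp_pos (- (u / 900))).
    apply pow_incr; split; nra.
  - replace (exp (- (u / 900)) ^ 3)
      with (exp (- (u / 900)) * (exp (- (u / 900)) * exp (- (u / 900)))) by ring.
    rewrite <- !exp_plus; f_equal; field.
Qed.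

(** * The saddle point *)

(** Here s = q^2 and x = w q^3: w measures x in units of the peak width s^{3/2}, and all powers of q
    are integral. *)
Lemma gf_arg_near (q w : R) (n : nat) : 0 < q <= 1 -> 0 <= w ->
  INR n * (q ^ 2) ^ 2 = PI ^ 2 / 6 ->
  Rabs (gf_arg (q ^ 2) n (w * q ^ 3) - INR n * (w * q ^ 3)) <= q * (8192 * w ^ 3 + 900 * w).
Proof.
  intros Hq Hw En.
  assert (Hq2 : 0 < q ^ 2 <= 1) by nra.
  assert (Hx : 0 <= w * q ^ 3) by (apply Rmult_le_pos; [lra|apply pow_le; lra]).
  assert (H1 := gf_arg_approx (q ^ 2) n (w * q ^ 3) (proj1 Hq2) Hx).
  destruct (sum_asym (q ^ 2) n Hq2 En) as [H2 _].
  set (Sg := sum1 (fun m => bose (INR m * q ^ 2)) n) in *.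
  replace (gf_arg (q ^ 2) n (w * q ^ 3) - INR n * (w * q ^ 3))
    with ((gf_arg (q ^ 2) n (w * q ^ 3) - w * q ^ 3 / q ^ 2 * Sg)
          + w / q * (q ^ 2 * Sg - INR n * (q ^ 2) ^ 2)) by (field; lra).
  rewrite En.
  eapply Rle_trans; [apply Rabs_triang|].
  rewrite Rmult_plus_distr_l; apply Rplus_le_compat.
  - eapply Rle_trans; [exact H1|]. right; field; lra.
  - assert (0 <= w / q) by (apply Rmult_le_pos; [lra|left; apply Rinv_0_lt_compat; lra]).
    rewrite Rabs_mult, (Rabs_right (w / q)) by lra.
    replace (q * (900 * w)) with (w / q * (900 * q ^ 2)) by (field; lra).
    now apply Rmult_le_compat_l.
Qed.

Lemma ln_gf_mod_gauss (q w : R) (n : nat) : 0 < q <= 1 -> 0 <= w ->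
  INR n * (q ^ 2) ^ 2 = PI ^ 2 / 6 ->
  Rabs (ln_gf_mod (q ^ 2) n (w * q ^ 3) + PI ^ 2 / 6 * w ^ 2) <= q * (16384 * w ^ 4 + 3000 * w ^ 2).
Proof.
  intros Hq Hw En.
  assert (Hq2 : 0 < q ^ 2 <= 1) by nra.
  assert (Hx : 0 <= w * q ^ 3) by (apply Rmult_le_pos; [lra|apply pow_le; lra]).
  assert (H1 := ln_gf_mod_approx (q ^ 2) n (w * q ^ 3) (proj1 Hq2) Hx).
  destruct (sum_asym (q ^ 2) n Hq2 En) as [_ [H2 _]].
  set (Sg := sum1 (fun m => bose2 (INR m * q ^ 2)) n) in *.
  replace (ln_gf_mod (q ^ 2) n (w * q ^ 3) + PI ^ 2 / 6 * w ^ 2)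
    with ((ln_gf_mod (q ^ 2) n (w * q ^ 3) + (w * q ^ 3) ^ 2 / (2 * (q ^ 2) ^ 2) * Sg)
          - w ^ 2 / 2 * (q ^ 2 * Sg - PI ^ 2 / 3)) by (field; lra).
  assert (Hw2 : 0 <= w ^ 2) by apply pow2_ge_0.
  assert (Hw4 : 0 <= w ^ 4) by (apply pow_le; lra).
  eapply Rle_trans; [apply Rabs_triang|].
  rewrite Rmult_plus_distr_l; apply Rplus_le_compat.
  - eapply Rle_trans; [exact H1|].
    replace (16384 * (w * q ^ 3) ^ 4 / (q ^ 2) ^ 5) with (q * (q * (16384 * w ^ 4))) by (field; lra).
    apply Rmult_le_compat_l; [lra|]. nra.
  - rewrite Rabs_Ropp, Rabs_mult, (Rabs_right (w ^ 2 / 2)) by lra.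
    apply Rle_trans with (w ^ 2 / 2 * (6000 * q ^ 2)); [apply Rmult_le_compat_l; lra|].
    replace (w ^ 2 / 2 * (6000 * q ^ 2)) with (q * (q * (3000 * w ^ 2))) by field.
    apply Rmult_le_compat_l; [lra|]. nra.
Qed.

(** exp (- M x^2 / 4) with x^2 = w^2 s^3 has to match exp (- PI^2 w^2 / 6); the tolerance 1 leaves
    room for an integer M. *)
Definition gauss_order (s : R) (M : nat) : Prop := Rabs (INR M - 2 * PI ^ 2 / (3 * s ^ 3)) <= 1.

Lemma gauss_order_bounds (s : R) (M : nat) : 0 < s <= 1 -> gauss_order s M ->
  5 / s ^ 3 <= INR M <= 12 / s ^ 3.
Proof.
  intros Hs HM; apply Rabs_le_between in HM; assert (HP := PI_sqr_bounds).
  assert (Hs3 : 0 < s ^ 3 <= 1) by (split; [apply pow_lt; lra|rewrite <- (pow1 3); apply pow_incr; lra]).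
  assert (Hi : 1 <= / s ^ 3) by (rewrite <- Rinv_1; apply Rinv_le_contravar; lra).
  replace (2 * PI ^ 2 / (3 * s ^ 3)) with (2 / 3 * PI ^ 2 * / s ^ 3) in HM by (field; lra).
  unfold Rdiv; split; nra.
Qed.

(* Coefficient integrand of (1 - q) prod_{m <= n} 1/(1 - q^m), normalised by its value
   exp (n s + ln_gf s n) on the positive real axis. *)
Definition diff_fun (s : R) (n : nat) (x : R) : R :=
  fourier_fun s n (INR n) x - exp (- s) * fourier_fun s n (INR n - 1) x.

(** Every error term carries the decay exp (- w^2 / 300) and a factor q^3, one power beyond the size
    q^2 of the approximation. *)
Lemma diff_fun_near (q w : R) (n L M : nat) : 0 < q <= 1 / 4 -> 0 <= w ->
  INR n * (q ^ 2) ^ 2 = PI ^ 2 / 6 -> gauss_order (q ^ 2) M ->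
  INR L * q ^ 2 <= 1 < (INR L + 1) * q ^ 2 ->
  w * q ^ 3 <= 1 -> w * q ^ 3 * INR L <= 2 * PI ->
  Rabs (diff_fun (q ^ 2) n (w * q ^ 3) - q ^ 2 * cos (w * q ^ 3 / 2) ^ (2 * M))
    <= 50000 * 900 ^ 3 * q ^ 3 / (1 + w ^ 2).
Proof.
  intros Hq Hw En HM HL Hx1 HxL.
  assert (Hs : 0 < q ^ 2 <= 1 / 10) by nra.
  assert (Hx : 0 <= w * q ^ 3) by (apply Rmult_le_pos; [lra|apply pow_le; lra]).
  assert (Hw2 : 0 <= w ^ 2) by apply pow2_ge_0.
  assert (Hw3 : 0 <= w ^ 3) by (apply pow_le; lra).
  assert (Hw4 : 0 <= w ^ 4) by (apply pow_le; lra).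
  destruct (exp_tail_small (q ^ 2) n (proj1 Hs) En) as [Hn _].
  assert (HE := ln_gf_mod_near (q ^ 2) (w * q ^ 3) n L Hs Hn HL Hx HxL).
  replace ((w * q ^ 3) ^ 2 / (q ^ 2) ^ 3 / 300) with (w ^ 2 / 300) in HE by (field; lra).
  assert (HA := gf_arg_near q w n ltac:(lra) Hw En).
  assert (HG := ln_gf_mod_gauss q w n ltac:(lra) Hw En).
  destruct (cos_pow_near (w * q ^ 3) M) as [y [Ey Hy]]; [lra|].
  assert (HMb := gauss_order_bounds (q ^ 2) M ltac:(lra) HM).
  assert (Hq3 : 0 < q ^ 3) by (apply pow_lt; lra).
  assert (Hq6 : 0 < q ^ 6 <= q).
  { split; [apply pow_lt; lra|].
    replace q with (q * 1) at 2 by ring; replace (q ^ 6) with (q * q ^ 5) by ring.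
    apply Rmult_le_compat_l; [lra|]. rewrite <- (pow1 5); apply pow_incr; lra. }
  (* Both exponents lie below - w^2 / 300, so [exp_diff] preserves this decay. *)
  assert (Hy' : y <= - (w ^ 2 / 300)).
  { assert (C := cos_pow_upper (w * q ^ 3) M).
    assert (HP2 := PI2_3_2). specialize (C ltac:(lra)). rewrite Ey in C; destruct C as [_ C].
    assert (y <= - (INR M * (w * q ^ 3) ^ 2 / 16)).
    { destruct (Rle_dec y (- (INR M * (w * q ^ 3) ^ 2 / 16))) as [|N]; [assumption|].
      apply Rnot_le_lt, exp_increasing in N; lra. }
    assert (5 * w ^ 2 <= INR M * (w * q ^ 3) ^ 2); [|lra].
    replace (5 * w ^ 2) with (5 / (q ^ 2) ^ 3 * (w * q ^ 3) ^ 2) by (field; lra).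
    apply Rmult_le_compat_r; [apply pow2_ge_0|lra]. }
  assert (Hyg : Rabs (y + PI ^ 2 / 6 * w ^ 2) <= q * (12 * w ^ 4 + w ^ 2)).
  { apply Rabs_le_between in Hy; unfold gauss_order in HM; apply Rabs_le_between in HM.
    assert (B1 : INR M * (w * q ^ 3) ^ 4 <= q * (12 * w ^ 4)).
    { apply Rle_trans with (12 / (q ^ 2) ^ 3 * (w * q ^ 3) ^ 4).
      - apply Rmult_le_compat_r; [now apply pow_le|lra].
      - replace (12 / (q ^ 2) ^ 3 * (w * q ^ 3) ^ 4) with (q ^ 6 * (12 * w ^ 4)) by (field; lra).
        apply Rmult_le_compat_r; lra. }
    assert (B2 : Rabs (INR M * (w * q ^ 3) ^ 2 / 4 - PI ^ 2 / 6 * w ^ 2) <= q * w ^ 2).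
    { replace (INR M * (w * q ^ 3) ^ 2 / 4 - PI ^ 2 / 6 * w ^ 2)
        with ((INR M - 2 * PI ^ 2 / (3 * (q ^ 2) ^ 3)) * (q ^ 6 * w ^ 2 / 4)) by (field; lra).
      assert (B0 : 0 <= q ^ 6 * w ^ 2 / 4) by nra.
      rewrite Rabs_mult, (Rabs_right (q ^ 6 * w ^ 2 / 4)) by lra.
      apply Rle_trans with (1 * (q ^ 6 * w ^ 2 / 4)).
      - apply Rmult_le_compat_r; [assumption|now apply Rabs_le].
      - nra. }
    apply Rabs_le_between in B2; apply Rabs_le; split; nra. }
  set (E := ln_gf_mod (q ^ 2) n (w * q ^ 3)) in *.
  set (th := gf_arg (q ^ 2) n (w * q ^ 3) - INR n * (w * q ^ 3)) in *.
  set (x := w * q ^ 3) in *.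
  set (g := exp (- (w ^ 2 / 300))).
  assert (Hg : 0 < g) by apply exp_pos.
  assert (HEg : 0 < exp E <= g) by (split; [apply exp_pos|now apply exp_le]).
  assert (HD : Rabs (exp E - exp y) <= g * (q * (17000 * w ^ 4 + 4000 * w ^ 2))).
  { eapply Rle_trans; [apply (exp_diff E y _ HE Hy')|].
    apply Rmult_le_compat_l; [lra|].
    apply Rabs_le_between in HG; apply Rabs_le_between in Hyg; apply Rabs_le; split; nra. }
  assert (Eth : gf_arg (q ^ 2) n x - (INR n - 1) * x = th + x) by (unfold th; ring).
  unfold diff_fun, fourier_fun; fold E; fold th; rewrite Eth, Ey.
  set (e := exp (- q ^ 2)).
  assert (He : 1 - q ^ 2 <= e <= 1 /\ e * (1 + q ^ 2) <= 1).
  { destruct (exp_neg_bounds (q ^ 2)) as [B1 B2]; [lra|]. unfold e; lra. }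
  rewrite cos_plus.
  (* The first two terms replace the factor 1 - exp (- s + i x) by q^2, the third replaces the
     modulus by the power of the cosine, the fourth cos th by 1. *)
  replace (exp E * cos th - e * (exp E * (cos th * cos x - sin th * sin x)) - q ^ 2 * exp y)
    with (exp E * ((1 - q ^ 2 - e) + e * (1 - cos x)) * cos th + exp E * e * (sin th * sin x)
          + q ^ 2 * (exp E - exp y) + q ^ 2 * - (exp E * (1 - cos th))) by ring.
  assert (Cx := one_minus_cos_le x); rewrite (Rabs_right x) in Cx by lra.
  assert (Ct := one_minus_cos_le th).
  assert (Sx : Rabs (sin x) <= x) by (rewrite <- (Rabs_right x) at 2 by lra; apply Rabs_sin_le).
  assert (T1 : Rabs (exp E * ((1 - q ^ 2 - e) + e * (1 - cos x)) * cos th) <= g * (q ^ 4 + x)).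
  { rewrite !Rabs_mult, (Rabs_right (exp E)) by lra.
    assert (Rabs (cos th) <= 1) by apply Rabs_le, COS_bound.
    assert (Rabs (1 - q ^ 2 - e + e * (1 - cos x)) <= q ^ 4 + x).
    { replace (q ^ 4) with (q ^ 2 * q ^ 2) by ring. apply Rabs_le; split; nra. }
    rewrite Rmult_assoc; apply Rmult_le_compat; try lra.
    - apply Rmult_le_pos; apply Rabs_pos.
    - replace (q ^ 4 + x) with ((q ^ 4 + x) * 1) by ring.
      apply Rmult_le_compat; try assumption; apply Rabs_pos. }
  assert (T2 : Rabs (exp E * e * (sin th * sin x)) <= g * x).
  { rewrite !Rabs_mult, (Rabs_right (exp E)), (Rabs_right e) by lra.
    assert (Rabs (sin th) <= 1) by apply Rabs_le, SIN_bound.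
    assert (H1 := Rabs_pos (sin th)); assert (H2 := Rabs_pos (sin x)).
    rewrite Rmult_assoc; apply Rmult_le_compat; try lra.
    - apply Rmult_le_pos; [lra|now apply Rmult_le_pos].
    - assert (Rabs (sin th) * Rabs (sin x) <= 1 * x) by (apply Rmult_le_compat; lra).
      assert (0 <= Rabs (sin th) * Rabs (sin x)) by now apply Rmult_le_pos.
      nra. }
  assert (T3 : Rabs (q ^ 2 * (exp E - exp y)) <= g * (q ^ 3 * (17000 * w ^ 4 + 4000 * w ^ 2))).
  { rewrite Rabs_mult, (Rabs_right (q ^ 2)) by lra.
    replace (g * (q ^ 3 * (17000 * w ^ 4 + 4000 * w ^ 2)))
      with (q ^ 2 * (g * (q * (17000 * w ^ 4 + 4000 * w ^ 2)))) by ring.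
    apply Rmult_le_compat_l; lra. }
  assert (T4 : Rabs (q ^ 2 * - (exp E * (1 - cos th))) <= g * (q ^ 3 * (8192 * w ^ 3 + 900 * w))).
  { rewrite Rabs_mult, (Rabs_right (q ^ 2)), Rabs_Ropp, Rabs_mult, (Rabs_right (exp E)),
      (Rabs_right (1 - cos th)) by lra.
    replace (g * (q ^ 3 * (8192 * w ^ 3 + 900 * w)))
      with (q ^ 2 * (g * (q * (8192 * w ^ 3 + 900 * w)))) by ring.
    apply Rmult_le_compat_l; [lra|]. apply Rmult_le_compat; lra. }
  assert (T : Rabs (exp E * ((1 - q ^ 2 - e) + e * (1 - cos x)) * cos th + exp E * e * (sin th * sin x)
          + q ^ 2 * (exp E - exp y) + q ^ 2 * - (exp E * (1 - cos th)))
     <= g * (q ^ 4 + x) + g * x + g * (q ^ 3 * (17000 * w ^ 4 + 4000 * w ^ 2))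
        + g * (q ^ 3 * (8192 * w ^ 3 + 900 * w))).
  { eapply Rle_trans; [apply Rabs_triang|]; apply Rplus_le_compat; [|assumption].
    eapply Rle_trans; [apply Rabs_triang|]; apply Rplus_le_compat; [|assumption].
    eapply Rle_trans; [apply Rabs_triang|]; now apply Rplus_le_compat. }
  eapply Rle_trans; [exact T|].
  apply Rle_trans with (50000 * q ^ 3 * ((1 + w ^ 2) ^ 2 * g)).
  - unfold x.
    replace (g * (q ^ 4 + w * q ^ 3) + g * (w * q ^ 3)
       + g * (q ^ 3 * (17000 * w ^ 4 + 4000 * w ^ 2)) + g * (q ^ 3 * (8192 * w ^ 3 + 900 * w)))
      with ((g * q ^ 3) * (q + 902 * w + 17000 * w ^ 4 + 4000 * w ^ 2 + 8192 * w ^ 3)) by ring.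
    replace (50000 * q ^ 3 * ((1 + w ^ 2) ^ 2 * g)) with ((g * q ^ 3) * (50000 * (1 + w ^ 2) ^ 2)) by ring.
    apply Rmult_le_compat_l; [nra|].
    assert (w <= 1 + w ^ 2) by nra.
    assert (w ^ 3 <= w ^ 2 + w ^ 4) by nra.
    replace ((1 + w ^ 2) ^ 2) with (1 + 2 * w ^ 2 + w ^ 4) by ring. lra.
  - replace (50000 * 900 ^ 3 * q ^ 3 / (1 + w ^ 2))
      with (50000 * q ^ 3 * (900 ^ 3 / (1 + w ^ 2))) by (field; lra).
    apply Rmult_le_compat_l; [lra|]. apply gauss_poly_bound.
Qed.

(** Both sides of the comparison are small by themselves: the modulus by [ln_gf_mod_far], the cosine
    power because x >= s and M >= 5 / s^3. The bound is exp (- 1 / (20 s)) <= (60 s)^3, counted for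
    two values of the integrand and one cosine power. *)
Lemma diff_fun_far (s x : R) (n L M : nat) : 0 < s <= 1 / 16 ->
  INR n * s ^ 2 = PI ^ 2 / 6 -> gauss_order s M ->
  INR L * s <= 1 < (INR L + 1) * s -> x <= PI -> 2 * PI <= x * INR L ->
  Rabs (diff_fun s n x - s * cos (x / 2) ^ (2 * M)) <= 3 * 60 ^ 3 * s ^ 3.
Proof.
  intros Hs En HM HL Hx HxL.
  destruct (exp_tail_small s n (proj1 Hs) En) as [Hn _].
  assert (HE := ln_gf_mod_far s x n L ltac:(lra) Hn HL Hx HxL).
  assert (HP := PI_RGT_0); assert (HP2 := PI2_3_2).
  assert (HMb := gauss_order_bounds s M ltac:(lra) HM).
  assert (Hsi : 0 < / s) by (apply Rinv_0_lt_compat; lra).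
  assert (HLs : INR L <= / s).
  { apply Rmult_le_reg_r with s; [lra|]. rewrite Rinv_l by lra; lra. }
  assert (Hx0 : 0 < x) by (assert (H := pos_INR L); nra).
  assert (Hxs : s <= x).
  { assert (2 * PI <= x * / s) by nra.
    assert (s * 1 <= s * (x * / s)) by (apply Rmult_le_compat_l; lra).
    replace (s * (x * / s)) with x in H0 by (field; lra). lra. }
  assert (HC := cos_pow_upper x M ltac:(lra)).
  assert (Hq : exp (- (/ s / 20)) <= 60 ^ 3 * s ^ 3).
  { eapply Rle_trans; [apply exp_neg_cube; lra|]. right; field; lra. }
  assert (HC' : exp (- (INR M * x ^ 2 / 16)) <= exp (- (/ s / 20))).
  { apply exp_le.
    assert (5 / s ^ 3 * s ^ 2 <= INR M * x ^ 2).
    { apply Rmult_le_compat; [|apply pow2_ge_0|lra|apply pow_incr; lra].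
      apply Rmult_le_pos; [lra|left; apply Rinv_0_lt_compat, pow_lt; lra]. }
    replace (5 / s ^ 3 * s ^ 2) with (5 * / s) in H by (field; lra). lra. }
  assert (HE' := exp_le _ _ HE).
  assert (P := exp_pos (ln_gf_mod s n x)).
  assert (He : 0 < exp (- s) < 1) by (split; [apply exp_pos|apply exp_neg_lt1; lra]).
  unfold diff_fun, fourier_fun.
  assert (C1 := COS_bound (gf_arg s n x - INR n * x)).
  assert (C2 := COS_bound (gf_arg s n x - (INR n - 1) * x)).
  set (c1 := cos (gf_arg s n x - INR n * x)) in *.
  set (c2 := cos (gf_arg s n x - (INR n - 1) * x)) in *.
  set (G := exp (ln_gf_mod s n x)) in *.
  assert (B1 : - G <= G * c1 <= G) by nra.
  assert (B2 : - G <= G * c2 <= G) by nra.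
  assert (B3 : - G <= exp (- s) * (G * c2) <= G) by nra.
  apply Rabs_le; split; nra.
Qed.

Lemma nat_floor_ex (y : R) : 0 <= y -> exists m : nat, INR m <= y < INR m + 1.
Proof.
  intros Hy; destruct (archimed y) as [H1 H2].
  assert (H0 : (0 <= up y - 1)%Z).
  { apply le_IZR; rewrite minus_IZR.
    assert (H3 : (0 < up y)%Z) by (apply lt_IZR; lra).
    assert (H4 : (1 <= up y)%Z) by lia. apply IZR_le in H4. lra. }
  exists (Z.to_nat (up y - 1)).
  rewrite INR_IZR_INZ, Z2Nat.id, minus_IZR by assumption; lra.
Qed.

Lemma diff_fun_bound (q x : R) (n M : nat) : 0 < q <= 1 / 4 ->
  INR n * (q ^ 2) ^ 2 = PI ^ 2 / 6 -> gauss_order (q ^ 2) M -> 0 <= x <= PI ->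
  Rabs (diff_fun (q ^ 2) n x - q ^ 2 * cos (x / 2) ^ (2 * M))
    <= 50000 * 900 ^ 3 * (q ^ 3 / (1 + (x / q ^ 3) ^ 2)) + 3 * 60 ^ 3 * q ^ 6.
Proof.
  intros Hq En HM Hx.
  assert (Hs : 0 < q ^ 2 <= 1 / 16) by nra.
  assert (Hq3 : 0 < q ^ 3) by (apply pow_lt; lra).
  assert (Hq6 : 0 < q ^ 6) by (apply pow_lt; lra).
  assert (HP4 := PI_4).
  destruct (nat_floor_ex (/ q ^ 2)) as [L HL]; [left; apply Rinv_0_lt_compat; lra|].
  assert (HLs : INR L * q ^ 2 <= 1 < (INR L + 1) * q ^ 2).
  { assert (E : / q ^ 2 * q ^ 2 = 1) by (apply Rinv_l; lra). nra. }
  set (w := x / q ^ 3).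
  assert (Ex : x = w * q ^ 3) by (unfold w; field; lra).
  assert (Hw : 0 <= w) by (apply Rmult_le_pos; [lra|left; now apply Rinv_0_lt_compat]).
  assert (H0 : 0 < / (1 + w ^ 2)) by (apply Rinv_0_lt_compat; nra).
  destruct (Rle_dec (x * INR L) (2 * PI)) as [N|N].
  (* s <= 1 / 16 gives L >= 15, which exceeds 2 PI. *)
  - assert (Hx1 : x <= 1).
    { assert (15 <= INR L) by nra. nra. }
    assert (H := diff_fun_near q w n L M Hq Hw En HM HLs).
    rewrite <- Ex in H; specialize (H Hx1 N).
    eapply Rle_trans; [exact H|]. unfold Rdiv; nra.
  - assert (H := diff_fun_far (q ^ 2) x n L M Hs En HM HLs).
    specialize (H ltac:(lra) ltac:(lra)).
    eapply Rle_trans; [exact H|].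
    assert (0 <= q ^ 3 / (1 + w ^ 2)) by (apply Rmult_le_pos; lra).
    replace ((q ^ 2) ^ 3) with (q ^ 6) by ring. lra.
Qed.

Lemma continuous_diff_fun (s : R) (n : nat) (x : R) : 0 < s -> continuous (diff_fun s n) x.
Proof.
  intros Hs; unfold diff_fun.
  apply (continuous_minus (V := R_NormedModule) (fourier_fun s n (INR n))
           (fun x => exp (- s) * fourier_fun s n (INR n - 1) x)).
  - now apply continuous_fourier_fun.
  - apply (continuous_scal_r (V := R_NormedModule) (exp (- s)) (fourier_fun s n (INR n - 1))).
    now apply continuous_fourier_fun.
Qed.

Lemma RInt_cos_pow_half (M : nat) : RInt (fun x => cos (x / 2) ^ M) 0 PI = 2 * wallis M.
Proof.
  unfold wallis.
  assert (H := RInt_comp_lin (V := R_CompleteNormedModule) (fun x => cos x ^ M) (/ 2) 0 0 PI).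
  replace (/ 2 * 0 + 0) with 0 in H by ring.
  replace (/ 2 * PI + 0) with (PI / 2) in H by field.
  rewrite <- H by (apply ex_RInt_cont, continuous_cos_pow).
  rewrite (RInt_scal (V := R_CompleteNormedModule) (fun y => cos (/ 2 * y + 0) ^ M)).
  - change (RInt (fun x => cos (x / 2) ^ M) 0 PI = 2 * (/ 2 * RInt (fun y => cos (/ 2 * y + 0) ^ M) 0 PI)).
    rewrite <- Rmult_assoc, Rinv_r, Rmult_1_l by lra.
    apply RInt_ext; intros x _; do 2 f_equal; field.
  - apply ex_RInt_cont; intros x.
    apply (ex_derive_continuous (fun y => cos (/ 2 * y + 0) ^ M)); auto_derive; exact I.
Qed.

(** The peak error is q^6 times the kernel b, whose integral is an arctangent and so bounded
    uniformly in q. The constants use PI / 2 <= 2 and PI <= 4. *)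
Lemma RInt_diff_fun (q : R) (n M : nat) : 0 < q <= 1 / 4 ->
  INR n * (q ^ 2) ^ 2 = PI ^ 2 / 6 -> gauss_order (q ^ 2) M ->
  Rabs (RInt (diff_fun (q ^ 2) n) 0 PI - q ^ 2 * (2 * wallis (2 * M)))
    <= (100000 * 900 ^ 3 + 12 * 60 ^ 3) * q ^ 6.
Proof.
  intros Hq En HM.
  assert (Hs : 0 < q ^ 2) by (apply pow_lt; lra).
  assert (Hq3 : 0 < q ^ 3) by (apply pow_lt; lra).
  assert (Hq6 : 0 < q ^ 6) by (apply pow_lt; lra).
  assert (HP := PI_RGT_0); assert (HP4 := PI_4).
  set (k := fun x => cos (x / 2) ^ (2 * M)).
  assert (Ck : forall x, continuous k x).
  { intros x; apply (ex_derive_continuous k); unfold k; auto_derive; exact I. }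
  set (b := fun x => / q ^ 3 * / (1 + (x / q ^ 3) ^ 2)).
  assert (Cb : forall x, continuous b x).
  { intros x; apply (ex_derive_continuous b); unfold b; auto_derive.
    apply Rgt_not_eq.
    apply Rlt_le_trans with (1 + 0); [lra|apply Rplus_le_compat_l].
    exact (pow2_ge_0 (x * / q ^ 3)). }
  assert (E1 : RInt (diff_fun (q ^ 2) n) 0 PI - q ^ 2 * (2 * wallis (2 * M))
          = RInt (fun x => 1 * diff_fun (q ^ 2) n x + - q ^ 2 * k x) 0 PI).
  { rewrite RInt_lin.
    - unfold k; rewrite (RInt_cos_pow_half (2 * M)); ring.
    - apply ex_RInt_cont; intros; now apply continuous_diff_fun.
    - now apply ex_RInt_cont. }
  assert (E2 : RInt b 0 PI = atan (PI / q ^ 3)).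
  { rewrite (RInt_deriv (fun x => atan (x / q ^ 3))).
    - rewrite Rdiv_0_l, atan_0; apply Rminus_0_r.
    - intros x; unfold b; auto_derive; [exact I|].
      match goal with |- ?a = ?b => change (@eq R a b) end.
      rewrite Rmult_1_l; reflexivity.
    - exact Cb. }
  set (K1 := 50000 * 900 ^ 3); set (K2 := 3 * 60 ^ 3).
  assert (E3 : RInt (fun x => K1 * q ^ 6 * b x + K2 * q ^ 6 * 1) 0 PI
               = K1 * q ^ 6 * atan (PI / q ^ 3) + K2 * q ^ 6 * PI).
  { rewrite RInt_lin, E2.
    - rewrite (RInt_const (V := R_CompleteNormedModule)).
      change (scal (PI - 0) 1) with ((PI - 0) * 1); rewrite Rminus_0_r, Rmult_1_r; reflexivity.
    - now apply ex_RInt_cont.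
    - apply (ex_RInt_const (V := R_CompleteNormedModule)). }
  rewrite E1.
  apply Rle_trans with (RInt (fun x => Rabs (1 * diff_fun (q ^ 2) n x + - q ^ 2 * k x)) 0 PI).
  { apply abs_RInt_le; [lra|].
    apply ex_RInt_cont; intros x.
    apply (continuous_plus (V := R_NormedModule) (fun x => 1 * diff_fun (q ^ 2) n x) (fun x => - q ^ 2 * k x)).
    - apply (continuous_scal_r (V := R_NormedModule) 1 (diff_fun (q ^ 2) n)); now apply continuous_diff_fun.
    - apply (continuous_scal_r (V := R_NormedModule) (- q ^ 2) k), Ck. }
  apply Rle_trans with (RInt (fun x => K1 * q ^ 6 * b x + K2 * q ^ 6 * 1) 0 PI).
  - apply RInt_le; [lra| | |].
    + apply ex_RInt_cont; intros x.
      apply (continuous_comp (fun x => 1 * diff_fun (q ^ 2) n x + - q ^ 2 * k x) Rabs); [|apply continuous_Rabs].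
      apply (continuous_plus (V := R_NormedModule) (fun x => 1 * diff_fun (q ^ 2) n x) (fun x => - q ^ 2 * k x)).
      * apply (continuous_scal_r (V := R_NormedModule) 1 (diff_fun (q ^ 2) n)); now apply continuous_diff_fun.
      * apply (continuous_scal_r (V := R_NormedModule) (- q ^ 2) k), Ck.
    + apply ex_RInt_cont; intros x.
      apply (continuous_plus (V := R_NormedModule) (fun x => K1 * q ^ 6 * b x) (fun _ => K2 * q ^ 6 * 1)).
      * apply (continuous_scal_r (V := R_NormedModule) (K1 * q ^ 6) b), Cb.
      * apply continuous_const.
    + intros x Hx.
      assert (H := diff_fun_bound q x n M Hq En HM ltac:(lra)); fold K1 K2 in H; fold (k x) in H.
      replace (1 * diff_fun (q ^ 2) n x + - q ^ 2 * k x) with (diff_fun (q ^ 2) n x - q ^ 2 * k x) by ring.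
      eapply Rle_trans; [exact H|]. unfold b; right.
      assert (0 <= (x / q ^ 3) ^ 2) by apply pow2_ge_0.
      assert (0 < x ^ 2) by (apply pow_lt; lra).
      field; split; [|lra]. apply Rgt_not_eq; nra.
  - rewrite E3.
    assert (HA := atan_bound (PI / q ^ 3)).
    assert (0 < K1) by (unfold K1; lra). assert (0 < K2) by (unfold K2; lra).
    replace (100000 * 900 ^ 3 + 12 * 60 ^ 3) with (2 * K1 + 4 * K2) by (unfold K1, K2; ring).
    replace (K1 * q ^ 6 * atan (PI / q ^ 3) + K2 * q ^ 6 * PI)
      with ((K1 * atan (PI / q ^ 3) + K2 * PI) * q ^ 6) by ring.
    apply Rmult_le_compat_r; [lra|]. nra.
Qed.

(** y0 is sqrt (PI / M) at the ideal value M = 2 PI^2 / (3 s^3). Rounding M and Wallis' bounds cost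
    a relative error O(s^3), within the claimed s. *)
Lemma wallis_asym (s y0 : R) (M : nat) : 0 < s <= 1 -> gauss_order s M ->
  0 < y0 -> y0 ^ 2 = 3 * s ^ 3 / (2 * PI) ->
  Rabs (2 * wallis (2 * M) - y0) <= y0 * s.
Proof.
  intros Hs HM Hy0 Ey0.
  assert (HP := PI_RGT_0); assert (HP2 := PI_sqr_bounds).
  assert (Hs3 : 0 < s ^ 3 <= s).
  { split; [apply pow_lt; lra|]. replace (s ^ 3) with (s * (s * s)) by ring. nra. }
  assert (HMb := gauss_order_bounds s M Hs HM).
  assert (H5 : 5 <= 5 / s ^ 3).
  { apply Rmult_le_reg_r with (s ^ 3); [lra|].
    replace (5 / s ^ 3 * s ^ 3) with 5 by (field; lra). nra. }
  assert (HM1 : (1 <= M)%nat) by (apply INR_le; simpl; lra).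
  destruct (wallis_sqr_bounds M HM1) as [W1 W2].
  assert (P := proj1 (wallis_pos_decr (2 * M))).
  set (y := wallis (2 * M)) in *.
  unfold gauss_order in HM; apply Rabs_le_between in HM.
  set (m := INR M) in *.
  assert (HM' : - s ^ 3 <= m * s ^ 3 - 2 * PI ^ 2 / 3 <= s ^ 3).
  { replace (m * s ^ 3 - 2 * PI ^ 2 / 3) with ((m - 2 * PI ^ 2 / (3 * s ^ 3)) * s ^ 3) by (field; lra).
    split; nra. }
  assert (U1 : 4 * y ^ 2 * m <= PI).
  { apply Rmult_le_compat_r with (r := 4 * m) in W2; [|lra].
    replace (PI / (4 * m) * (4 * m)) with PI in W2 by (field; lra). lra. }
  assert (U2 : PI <= 4 * y ^ 2 * (m + 1 / 2)).
  { apply Rmult_le_compat_r with (r := 4 * m + 2) in W1; [|lra].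
    replace (PI / (4 * m + 2) * (4 * m + 2)) with PI in W1 by (field; lra). lra. }
  assert (E0 : y0 ^ 2 * (2 * PI ^ 2 / 3) = PI * s ^ 3) by (rewrite Ey0; field; lra).
  assert (Hy2 : 0 < y ^ 2) by (apply pow_lt; lra).
  assert (Hy02 : 0 < y0 ^ 2) by (apply pow_lt; lra).
  set (a := 2 * PI ^ 2 / 3) in *.
  assert (Ha : 6 <= a) by (unfold a; lra).
  assert (V1 : 4 * y ^ 2 * (a - s ^ 3) <= y0 ^ 2 * a).
  { rewrite E0. apply Rle_trans with (4 * y ^ 2 * (m * s ^ 3)); [nra|].
    replace (4 * y ^ 2 * (m * s ^ 3)) with (4 * y ^ 2 * m * s ^ 3) by ring. nra. }
  assert (V2 : y0 ^ 2 * a <= 4 * y ^ 2 * (a + 3 / 2 * s ^ 3)).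
  { rewrite E0. apply Rle_trans with (4 * y ^ 2 * (m + 1 / 2) * s ^ 3); [nra|].
    replace (4 * y ^ 2 * (m + 1 / 2) * s ^ 3) with (4 * y ^ 2 * (m * s ^ 3 + s ^ 3 / 2)) by field.
    apply Rmult_le_compat_l; lra. }
  assert (F1 : (2 * y) ^ 2 <= (y0 * (1 + s)) ^ 2).
  { replace ((2 * y) ^ 2) with (4 * y ^ 2) by ring.
    replace ((y0 * (1 + s)) ^ 2) with (y0 ^ 2 * (1 + s) ^ 2) by ring.
    apply Rmult_le_reg_r with (a - s ^ 3); [lra|].
    eapply Rle_trans; [exact V1|].
    rewrite Rmult_assoc; apply Rmult_le_compat_l; [lra|]. nra. }
  assert (F2 : (y0 * (1 - s)) ^ 2 <= (2 * y) ^ 2).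
  { replace ((2 * y) ^ 2) with (4 * y ^ 2) by ring.
    replace ((y0 * (1 - s)) ^ 2) with (y0 ^ 2 * (1 - s) ^ 2) by ring.
    apply Rmult_le_reg_r with (a + 3 / 2 * s ^ 3); [lra|].
    eapply Rle_trans; [|exact V2].
    rewrite Rmult_assoc; apply Rmult_le_compat_l; [lra|].
    assert ((1 - s) ^ 2 <= 1 - s) by nra.
    apply Rle_trans with ((1 - s) * (a + 3 / 2 * s ^ 3)); [apply Rmult_le_compat_r; lra|]. nra. }
  apply Rabs_le; split.
  - enough (y0 * (1 - s) <= 2 * y) by lra.
    apply Rsqr_incr_0; unfold Rsqr; nra.
  - enough (2 * y <= y0 * (1 + s)) by lra.
    apply Rsqr_incr_0; unfold Rsqr; nra.
Qed.

Lemma gauss_order_ex (s : R) : 0 < s -> exists M, gauss_order s M.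
Proof.
  intros Hs.
  destruct (nat_floor_ex (2 * PI ^ 2 / (3 * s ^ 3))) as [M HM].
  - assert (0 < s ^ 3) by (apply pow_lt; lra). assert (HP := PI_sqr_bounds).
    apply Rmult_le_pos; [lra|left; apply Rinv_0_lt_compat; lra].
  - exists M; unfold gauss_order; apply Rabs_le; lra.
Qed.

(** 3 bounds exp dl; the bracket is the error of [RInt_diff_fun] plus 1 for [wallis_asym]; 22000
    exceeds 3 * 7000 from [sum_asym]. *)
Definition saddle_const : R := 22000 + 3 * (100000 * 900 ^ 3 + 12 * 60 ^ 3 + 1).

(** n s = PI^2 / (6 s) doubles the leading exponent of [ln_gf]; its term ln s / 2 gives a factor q,
    which with s y0 makes q^6. The bound 1 / 7000 on q^2 keeps the error dl of [ln_gf] within 1. *)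
Lemma coef_diff_saddle (c : nat -> nat -> nat) (q : R) (n : nat) :
  0 < q -> q ^ 2 <= 1 / 7000 ->
  INR n * (q ^ 2) ^ 2 = PI ^ 2 / 6 ->
  (forall n, c 0%nat n = if Nat.eq_dec n 0 then 1%nat else 0%nat) ->
  (forall N n, c (S N) n
     = (c N n + if le_dec (S N) n then c (S N) (n - S N) else 0)%nat) ->
  Rabs (INR (c n n) - INR (c n (n - 1)%nat)
        - sqrt 3 / (2 * PI ^ 2) * q ^ 6 * exp (PI ^ 2 / (3 * q ^ 2)))
    <= saddle_const * q ^ 7 * exp (PI ^ 2 / (3 * q ^ 2)).
Proof.
  intros Hq Hq2 En c0 cS.
  assert (Hq14 : q <= 1 / 4) by nra.
  assert (Hs : 0 < q ^ 2) by (apply pow_lt; lra).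
  assert (HP := PI_RGT_0); assert (HP2 := PI_sqr_bounds); assert (HP3 := PI2_3_2).
  destruct (exp_tail_small (q ^ 2) n Hs En) as [Hn _].
  assert (Hn1 : (1 <= n)%nat) by (destruct n; [simpl in Hn; lra|lia]).
  destruct (gauss_order_ex (q ^ 2) Hs) as [M HM].
  assert (F1 := fourier_coef c (q ^ 2) n n Hs c0 cS).
  assert (F2 := fourier_coef c (q ^ 2) n (n - 1) Hs c0 cS).
  rewrite minus_INR in F2 by assumption; simpl (INR 1) in F2.
  set (Lg := ln_gf (q ^ 2) n) in *.
  assert (ED : PI * (INR (c n n) - INR (c n (n - 1)%nat))
    = exp (INR n * q ^ 2 + Lg) * RInt (diff_fun (q ^ 2) n) 0 PI).
  { rewrite Rmult_minus_distr_l, F1, F2.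
    replace ((INR n - 1) * q ^ 2 + Lg) with (INR n * q ^ 2 + Lg + - q ^ 2) by ring.
    rewrite (exp_plus _ (- q ^ 2)).
    assert (El : RInt (diff_fun (q ^ 2) n) 0 PI
      = 1 * fourier (q ^ 2) n (INR n) + - exp (- q ^ 2) * fourier (q ^ 2) n (INR n - 1)).
    { unfold fourier; rewrite <- RInt_lin by (apply ex_RInt_cont; intros; now apply continuous_fourier_fun).
      apply RInt_ext; intros x _; match goal with |- ?a = ?b => change (@eq R a b) end.
      unfold diff_fun; ring. }
    rewrite El; ring. }
  destruct (sum_asym (q ^ 2) n ltac:(lra) En) as [_ [_ HL]]; fold Lg in HL.
  set (dl := Lg - (PI ^ 2 / (6 * q ^ 2) + ln (q ^ 2) / 2 - ln (2 * PI) / 2)) in *.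
  set (Z := exp (PI ^ 2 / (3 * q ^ 2))).
  assert (HZ : 0 < Z) by apply exp_pos.
  set (t := sqrt (2 * PI)).
  assert (Ht : 0 < t) by (apply sqrt_lt_R0; lra).
  assert (Et : t * t = 2 * PI) by (apply sqrt_sqrt; lra).
  assert (EP : exp (INR n * q ^ 2 + Lg) = Z * (q / t) * exp dl).
  { replace (INR n * q ^ 2 + Lg)
      with (PI ^ 2 / (3 * q ^ 2) + (ln q + - ln t) + dl).
    - rewrite !exp_plus, exp_Ropp, !exp_ln by assumption; reflexivity.
    - unfold dl.
      replace (ln (q ^ 2)) with (2 * ln q)
        by (replace (q ^ 2) with (q * q) by ring; rewrite ln_mult by assumption; ring).
      rewrite <- Et, ln_mult by assumption.
      replace (INR n) with (PI ^ 2 / 6 / (q ^ 2) ^ 2) by (rewrite <- En; field; lra).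
      field; lra. }
  set (r3 := sqrt 3).
  assert (Hr3 : 0 < r3) by (apply sqrt_lt_R0; lra).
  assert (Er3 : r3 * r3 = 3) by (apply sqrt_sqrt; lra).
  set (y0 := r3 / t * q ^ 3).
  assert (Hq3 : 0 < q ^ 3) by (apply pow_lt; lra).
  assert (Hrt : 0 < r3 / t <= 1).
  { split; [apply Rmult_lt_0_compat; [assumption|now apply Rinv_0_lt_compat]|].
    apply Rmult_le_reg_r with t; [assumption|].
    replace (r3 / t * t) with r3 by (field; lra).
    apply Rsqr_incr_0; unfold Rsqr; lra. }
  assert (Hy0 : 0 < y0 <= q ^ 3) by (unfold y0; split; nra).
  assert (W := wallis_asym (q ^ 2) y0 M ltac:(lra) HM (proj1 Hy0)).
  assert (Ey0 : y0 ^ 2 = 3 * (q ^ 2) ^ 3 / (2 * PI)).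
  { unfold y0; rewrite <- Er3, <- Et; field; lra. }
  specialize (W Ey0).
  assert (HI := RInt_diff_fun q n M ltac:(lra) En HM).
  set (I := RInt (diff_fun (q ^ 2) n) 0 PI) in *.
  set (K1 := 100000 * 900 ^ 3 + 12 * 60 ^ 3) in *.
  assert (HK1 : 0 < K1) by (unfold K1; lra).
  assert (Hq6 : 0 < q ^ 6) by (apply pow_lt; lra).
  assert (HI' : Rabs (I - q ^ 2 * y0) <= (K1 + 1) * q ^ 6).
  { replace (I - q ^ 2 * y0) with ((I - q ^ 2 * (2 * wallis (2 * M))) + q ^ 2 * (2 * wallis (2 * M) - y0))
      by ring.
    eapply Rle_trans; [apply Rabs_triang|].
    rewrite Rmult_plus_distr_r, Rmult_1_l; apply Rplus_le_compat; [exact HI|].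
    rewrite Rabs_mult, (Rabs_right (q ^ 2)) by lra.
    apply Rle_trans with (q ^ 2 * (y0 * q ^ 2)); [apply Rmult_le_compat_l; lra|].
    apply Rle_trans with (q ^ 2 * (q ^ 3 * q ^ 2)).
    - apply Rmult_le_compat_l; [lra|apply Rmult_le_compat_r; lra].
    - replace (q ^ 2 * (q ^ 3 * q ^ 2)) with (q * q ^ 6) by ring. nra. }
  assert (Hdl : Rabs dl <= 1) by lra.
  assert (Hdl2 := proj1 (Rabs_le_between _ _) Hdl).
  assert (Hed : exp dl <= 3) by (apply Rle_trans with (exp 1); [apply exp_le; lra|apply exp_le_3]).
  assert (Hed1 : Rabs (exp dl - 1) <= 21000 * q ^ 2).
  { rewrite <- exp_0 at 1.
    eapply Rle_trans; [apply (exp_diff dl 0 1); lra|].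
    rewrite Rminus_0_r; assert (E1 := exp_le_3); assert (0 <= Rabs dl) by apply Rabs_pos. nra. }
  assert (EM : PI * (r3 / (2 * PI ^ 2) * q ^ 6 * Z) = Z * (q / t) * (q ^ 2 * y0)).
  { unfold y0; replace PI with (t * t / 2) by lra; field; lra. }
  apply Rmult_le_reg_l with PI; [lra|].
  rewrite <- (Rabs_right PI) at 1 by lra; rewrite <- Rabs_mult, Rmult_minus_distr_l, ED, EP, EM.
  replace (Z * (q / t) * exp dl * I - Z * (q / t) * (q ^ 2 * y0))
    with (Z * (q / t) * (exp dl * (I - q ^ 2 * y0) + (exp dl - 1) * (q ^ 2 * y0))) by ring.
  assert (Hqt : 0 < q / t <= q).
  { split; [apply Rmult_lt_0_compat; [lra|now apply Rinv_0_lt_compat]|].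
    assert (1 <= t) by nra.
    apply Rmult_le_reg_r with t; [assumption|]. replace (q / t * t) with q by (field; lra). nra. }
  assert (Hed0 := exp_pos dl).
  assert (B : Rabs (exp dl * (I - q ^ 2 * y0) + (exp dl - 1) * (q ^ 2 * y0)) <= saddle_const * q ^ 6).
  { eapply Rle_trans; [apply Rabs_triang|].
    rewrite !Rabs_mult, (Rabs_right (exp dl)), (Rabs_right (q ^ 2)), (Rabs_right y0) by lra.
    assert (exp dl * Rabs (I - q ^ 2 * y0) <= 3 * ((K1 + 1) * q ^ 6))
      by (apply Rmult_le_compat; try lra; apply Rabs_pos).
    assert (Rabs (exp dl - 1) * (q ^ 2 * y0) <= 21000 * q ^ 2 * (q ^ 2 * q ^ 3)).
    { apply Rmult_le_compat; try apply Rabs_pos; [nra|assumption|apply Rmult_le_compat_l; lra]. }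
    replace (21000 * q ^ 2 * (q ^ 2 * q ^ 3)) with (q * (21000 * q ^ 6)) in H0 by ring.
    unfold saddle_const; fold K1. nra. }
  rewrite Rabs_mult, (Rabs_right (Z * (q / t))) by nra.
  assert (HSC : 0 < saddle_const) by (unfold saddle_const; fold K1; lra).
  apply Rle_trans with (Z * q * (saddle_const * q ^ 6)).
  - apply Rmult_le_compat; try assumption; try apply Rabs_pos; nra.
  - replace (Z * q * (saddle_const * q ^ 6)) with (saddle_const * q ^ 7 * Z) by ring.
    assert (0 < saddle_const * q ^ 7 * Z).
    { apply Rmult_lt_0_compat; [apply Rmult_lt_0_compat; [lra|apply pow_lt; lra]|lra]. }
    nra.
Qed.

Lemma coef_diff_asym (c : nat -> nat -> nat) :
  (forall n, c 0%nat n = if Nat.eq_dec n 0 then 1%nat else 0%nat) ->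
  (forall N n, c (S N) n
     = (c N n + if le_dec (S N) n then c (S N) (n - S N) else 0)%nat) ->
  exists K X, 0 < K /\ 1 <= X /\ forall n b, X <= INR n -> b = sqrt (INR n) ->
  Rabs (INR (c n n) - INR (c n (n - 1)%nat)
        - PI / (12 * sqrt 2) / b ^ 3 * exp (2 * PI * b / sqrt 6))
    <= K / (b ^ 3 * sqrt b) * exp (2 * PI * b / sqrt 6).
Proof.
  intros c0 cS.
  assert (HP := PI_RGT_0); assert (HP2 := PI_sqr_bounds); assert (HP4 := PI_4).
  assert (HSC : 0 < saddle_const) by (unfold saddle_const; lra).
  (* s b = PI / sqrt 6 <= 4, so b >= 28000 ensures q^2 = s <= 1 / 7000; and q sqrt b <= 2 gives the
     2^7. *)
  exists (saddle_const * 2 ^ 7), (28000 ^ 2); split; [lra|split; [lra|]].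
  intros n b HX Eb.
  assert (Hn : 0 < INR n) by lra.
  assert (Ebb : b * b = INR n) by (rewrite Eb; apply sqrt_sqrt; lra).
  assert (Hb0 : 0 <= b) by (rewrite Eb; apply sqrt_pos).
  assert (Hb : 28000 <= b) by (apply Rsqr_incr_0; unfold Rsqr; lra).
  set (r6 := sqrt 6).
  assert (Er6 : r6 * r6 = 6) by (apply sqrt_sqrt; lra).
  assert (Hr6 : 1 <= r6) by (assert (0 <= r6) by apply sqrt_pos; nra).
  set (s := PI / (r6 * b)).
  assert (Hrb : 0 < r6 * b) by nra.
  assert (Hs : 0 < s) by (apply Rmult_lt_0_compat; [lra|now apply Rinv_0_lt_compat]).
  assert (Hsb : s * b <= 4).
  { replace (s * b) with (PI / r6) by (unfold s; field; lra).
    apply Rmult_le_reg_r with r6; [lra|]. replace (PI / r6 * r6) with PI by (field; lra). nra. }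
  set (q := sqrt s).
  assert (Hq : 0 < q) by (now apply sqrt_lt_R0).
  assert (Eq : q ^ 2 = s) by (simpl; rewrite Rmult_1_r; apply sqrt_sqrt; lra).
  assert (Hs7 : q ^ 2 <= 1 / 7000) by (rewrite Eq; nra).
  assert (En : INR n * (q ^ 2) ^ 2 = PI ^ 2 / 6).
  { rewrite Eq, <- Ebb, <- Er6; unfold s; field; lra. }
  assert (H := coef_diff_saddle c q n Hq Hs7 En c0 cS).
  replace (PI ^ 2 / (3 * q ^ 2)) with (2 * PI * b / r6) in H.
  2: { rewrite Eq; unfold s; replace 3 with (r6 * r6 / 2) by lra; field; lra. }
  set (r2 := sqrt 2).
  assert (Er2 : r2 * r2 = 2) by (apply sqrt_sqrt; lra).
  assert (Hr2 : 0 < r2) by (apply sqrt_lt_R0; lra).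
  assert (E6 : r6 = r2 * sqrt 3) by (unfold r6, r2; rewrite <- sqrt_mult by lra; f_equal; lra).
  replace (sqrt 3 / (2 * PI ^ 2) * q ^ 6) with (PI / (12 * r2) / b ^ 3) in H.
  2: { replace (q ^ 6) with (s ^ 3) by (rewrite <- Eq; ring).
       transitivity (PI * sqrt 3 / (2 * (r6 * r6) * r6 * b ^ 3)); [|unfold s; field; lra].
       rewrite Er6, E6. assert (0 < sqrt 3) by (apply sqrt_lt_R0; lra). field; repeat split; lra. }
  eapply Rle_trans; [exact H|].
  apply Rmult_le_compat_r; [left; apply exp_pos|].
  set (d := sqrt b).
  assert (Hd : 0 < d) by (apply sqrt_lt_R0; lra).
  assert (Ed : d * d = b) by (apply sqrt_sqrt; lra).
  assert (Hqd : q * d <= 2) by (apply Rsqr_incr_0; unfold Rsqr; nra).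
  assert (Hqd' : q <= 2 * / d).
  { apply Rmult_le_reg_r with d; [assumption|]. rewrite Rmult_assoc, Rinv_l by lra; lra. }
  replace (saddle_const * 2 ^ 7 / (b ^ 3 * d)) with (saddle_const * (2 * / d) ^ 7)
    by (rewrite <- Ed; field; lra).
  apply Rmult_le_compat_l; [lra|]. apply pow_incr; lra.
Qed.

(** * Alternating sums of differences *)

(** a and b are square roots of arguments that differ by i, and i <= b^2 / 2 gives a >= 7 b / 10.
    The main term changes by a relative O(i / b). *)
Lemma exp_over_cube_shift (be a b i : R) : 0 <= be -> 1 <= b -> 0 <= a <= b ->
  b ^ 2 - a ^ 2 = i -> i <= b ^ 2 / 2 ->
  / (a ^ 3 * sqrt a) <= 8 * / (b ^ 3 * sqrt b) /\
  Rabs (/ a ^ 3 * exp (be * a) - / b ^ 3 * exp (be * b)) <= (12 + be) * i * / b ^ 4 * exp (be * b).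
Proof.
  intros Hbe Hb Hab Ei Hi.
  assert (Ha : 7 / 10 * b <= a) by (apply Rsqr_incr_0; unfold Rsqr; nra).
  assert (Ha3 : b ^ 3 <= 4 * a ^ 3).
  { assert ((7 / 10 * b) ^ 3 <= a ^ 3) by (apply pow_incr; lra).
    assert (0 < b ^ 3) by (apply pow_lt; lra). nra. }
  assert (Hb3 : 0 < b ^ 3) by (apply pow_lt; lra).
  assert (Hd : 0 < sqrt b) by (apply sqrt_lt_R0; lra).
  split.
  - replace (8 * / (b ^ 3 * sqrt b)) with (/ (b ^ 3 / 4 * (sqrt b / 2))) by (field; lra).
    apply Rinv_le_contravar; [nra|].
    apply Rmult_le_compat; try lra.
    assert (E1 : sqrt b * sqrt b = b) by (apply sqrt_sqrt; lra).
    assert (E2 : sqrt a * sqrt a = a) by (apply sqrt_sqrt; lra).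
    apply Rsqr_incr_0; unfold Rsqr; [nra|lra|apply sqrt_pos].
  - assert (Hi0 : 0 <= i) by nra.
    assert (Hba : (b - a) * b <= i) by nra.
    assert (Hb1 : b - a <= i * / b).
    { apply Rmult_le_reg_r with b; [lra|]. rewrite Rmult_assoc, Rinv_l by lra; lra. }
    set (x := exp (be * a)); set (y := exp (be * b)).
    assert (Hxy : 0 < x <= y) by (split; [apply exp_pos|apply exp_le; nra]).
    assert (Hyx : y - x <= y * (be * (i * / b))).
    { assert (H := exp_ineq1_le (- (be * (b - a)))).
      assert (E : x = y * exp (- (be * (b - a)))) by (unfold x, y; rewrite <- exp_plus; f_equal; ring).
      rewrite E at 1. assert (be * (b - a) <= be * (i * / b)) by now apply Rmult_le_compat_l. nra. }
    assert (Hib : 0 < / b <= 1).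
    { split; [apply Rinv_0_lt_compat; lra|rewrite <- Rinv_1; apply Rinv_le_contravar; lra]. }
    assert (Hc : 0 <= / a ^ 3 - / b ^ 3 <= 12 * i * / b ^ 4).
    { split.
      - enough (/ b ^ 3 <= / a ^ 3) by lra.
        apply Rinv_le_contravar; [lra|apply pow_incr; lra].
      - replace (/ a ^ 3 - / b ^ 3) with ((b - a) * (a ^ 2 + a * b + b ^ 2) * (/ a ^ 3 * / b ^ 3))
          by (field; lra).
        apply Rle_trans with (i * / b * (3 * b ^ 2) * (4 * / b ^ 3 * / b ^ 3)).
        + apply Rmult_le_compat.
          * apply Rmult_le_pos; nra.
          * apply Rmult_le_pos; left; apply Rinv_0_lt_compat; lra.
          * apply Rmult_le_compat; nra.
          * apply Rmult_le_compat_r; [left; apply Rinv_0_lt_compat; lra|].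
            replace (4 * / b ^ 3) with (/ (b ^ 3 / 4)) by (field; lra).
            apply Rinv_le_contravar; lra.
        + replace (i * / b * (3 * b ^ 2) * (4 * / b ^ 3 * / b ^ 3)) with (12 * i * / b ^ 4 * / b)
            by (field; lra).
          assert (0 <= 12 * i * / b ^ 4).
          { apply Rmult_le_pos; [lra|left; apply Rinv_0_lt_compat, pow_lt; lra]. }
          nra. }
    replace (/ a ^ 3 * x - / b ^ 3 * y) with ((/ a ^ 3 - / b ^ 3) * x - / b ^ 3 * (y - x)) by ring.
    eapply Rle_trans; [apply Rabs_triang|].
    rewrite Rabs_Ropp, !Rabs_mult, (Rabs_right x), (Rabs_right (/ a ^ 3 - / b ^ 3)),
      (Rabs_right (y - x)), (Rabs_right (/ b ^ 3)) by (try lra; left; now apply Rinv_0_lt_compat).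
    replace ((12 + be) * i * / b ^ 4 * y) with (12 * i * / b ^ 4 * y + / b ^ 3 * (y * (be * (i * / b))))
      by (field; lra).
    apply Rplus_le_compat.
    + apply Rmult_le_compat; lra.
    + apply Rmult_le_compat_l; [left; now apply Rinv_0_lt_compat|assumption].
Qed.

Lemma telescope_approx (P : Z -> R) (z : Z) (t : nat) (G eta : R) :
  (forall y, (z - Z.of_nat t < y <= z)%Z -> Rabs (P y - P (y - 1)%Z - G) <= eta) ->
  Rabs (P z - P (z - Z.of_nat t)%Z - INR t * G) <= INR t * eta.
Proof.
  induction t as [|t IH]; intros H.
  - simpl; rewrite Z.sub_0_r, !Rmult_0_l, Rminus_0_r, Rminus_diag, Rabs_R0; lra.
  - rewrite S_INR, !Rmult_plus_distr_r, !Rmult_1_l.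
    replace (z - Z.of_nat (S t))%Z with (z - Z.of_nat t - 1)%Z by lia.
    assert (H1 := IH ltac:(intros y Hy; apply H; lia)).
    assert (H2 := H (z - Z.of_nat t)%Z ltac:(lia)).
    eapply Rle_trans; [|apply (Rplus_le_compat _ _ _ _ H1 H2)].
    eapply Rle_trans; [|apply Rabs_triang]. right; f_equal; ring.
Qed.

(* The j-th term is a sum of 2j+1 consecutive differences, and
   the sum of (-1)^j (2j+1) over j <= m is (-1)^m (m+1). *)
Lemma alternating_sum_approx (P : Z -> R) (n : Z) (m : nat) (G eta : R) :
  (forall y, (n - 4 * Z.of_nat (S m) ^ 2 <= y <= n)%Z -> Rabs (P y - P (y - 1)%Z - G) <= eta) ->
  Rabs ((-1) ^ m * sum_f_R0 (fun j =>
      (-1) ^ j * (P (n - Z.of_nat j * (3 * Z.of_nat j + 1) / 2)%Z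
                  - P (n - Z.of_nat j * (3 * Z.of_nat j + 5) / 2 - 1)%Z)) m
    - INR (S m) * G) <= INR (S m) ^ 2 * eta.
Proof.
  intros H.
  set (F := fun j => (-1) ^ j * (P (n - Z.of_nat j * (3 * Z.of_nat j + 1) / 2)%Z
                  - P (n - Z.of_nat j * (3 * Z.of_nat j + 5) / 2 - 1)%Z)).
  assert (T : forall j, (j <= m)%nat ->
    Rabs (F j - (-1) ^ j * (INR (2 * j + 1) * G)) <= INR (2 * j + 1) * eta).
  { intros j Hj; unfold F.
    set (u := (Z.of_nat j * (3 * Z.of_nat j + 1))%Z).
    (* The quadratic parts differ by 4j before halving, so the two arguments differ by 2j + 1. *)
    replace (Z.of_nat j * (3 * Z.of_nat j + 5))%Z with (u + (2 * Z.of_nat j) * 2)%Z by (unfold u; ring).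
    rewrite Z.div_add by lia.
    assert (Hu : (0 <= u / 2 <= u)%Z).
    { assert (0 <= u)%Z by (unfold u; nia).
      split; [apply Z.div_pos; lia|]. apply Z.div_le_upper_bound; lia. }
    replace (n - (u / 2 + 2 * Z.of_nat j) - 1)%Z with (n - u / 2 - Z.of_nat (2 * j + 1))%Z by lia.
    rewrite <- Rmult_minus_distr_l, Rabs_mult, pow_1_abs, Rmult_1_l.
    apply telescope_approx; intros y Hy; apply H; split; [|lia].
    (* This keeps all differences of the j-th term in the window of the hypothesis. *)
    assert (u + 2 * Z.of_nat j <= 4 * Z.of_nat (S m) ^ 2)%Z by (unfold u; nia). lia. }
  assert (S : forall l, (l <= m)%nat ->
    Rabs (sum_f_R0 F l - (-1) ^ l * (INR (S l) * G)) <= INR (S l) ^ 2 * eta).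
  { induction l as [|l IHl]; intros Hl.
    - assert (T0 := T 0%nat Hl); simpl in *.
      rewrite !Rmult_1_l in *; exact T0.
    - assert (T1 := T (S l) Hl); assert (I1 := IHl ltac:(lia)).
      rewrite tech5.
      assert (E1 : INR (2 * S l + 1) = 2 * INR (S l) + 1) by (rewrite plus_INR, mult_INR; simpl; ring).
      rewrite E1 in T1; rewrite (S_INR (S l)).
      set (x := INR (S l)) in *.
      replace ((x + 1) ^ 2 * eta) with (x ^ 2 * eta + (2 * x + 1) * eta) by ring.
      eapply Rle_trans; [|apply (Rplus_le_compat _ _ _ _ I1 T1)].
      eapply Rle_trans; [|apply Rabs_triang]. right; f_equal.
      rewrite <- tech_pow_Rmult; ring. }
  specialize (S m (le_n m)).
  replace ((-1) ^ m * sum_f_R0 F m - INR (Datatypes.S m) * G)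
    with ((-1) ^ m * (sum_f_R0 F m - (-1) ^ m * (INR (Datatypes.S m) * G))).
  - rewrite Rabs_mult, pow_1_abs, Rmult_1_l; exact S.
  - assert (E : (-1) ^ m * (-1) ^ m = 1).
    { rewrite <- Rpow_mult_distr; replace (-1 * -1) with 1 by ring; apply pow1. }
    rewrite Rmult_minus_distr_l, <- Rmult_assoc, E; ring.
Qed.

(** * From single differences to the truncated sum *)

Lemma Rpower_quarters (x : R) : 0 < x ->
  Rpower x (- (3 / 2)) = / sqrt x ^ 3 /\
  Rpower x (- (7 / 4)) = / (sqrt x ^ 3 * sqrt (sqrt x)) /\
  Rpower x (1 / 4) = sqrt (sqrt x).
Proof.
  intros Hx.
  assert (Hb : 0 < sqrt x) by now apply sqrt_lt_R0.
  assert (E4 : Rpower x (1 / 4) = sqrt (sqrt x)).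
  { rewrite <- (Rpower_sqrt (sqrt x)), <- (Rpower_sqrt x), Rpower_mult by assumption.
    f_equal; field. }
  assert (E3 : Rpower x (3 / 2) = sqrt x ^ 3).
  { rewrite <- Rpower_pow, <- (Rpower_sqrt x), Rpower_mult by assumption.
    f_equal; simpl; field. }
  repeat split.
  - now rewrite Rpower_Ropp, E3.
  - rewrite Rpower_Ropp; replace (7 / 4) with (3 / 2 + 1 / 4) by field.
    now rewrite Rpower_plus, E3, E4.
  - exact E4.
Qed.

(** The first bound keeps the shifted arguments above n / 2, the second turns k^4 n^{-2} into k^3
    n^{-7/4}. With d = n^{1/4} the threshold says d >= 8 C^2 + 1, whence 4 C^2 d <= d^2 / 2. *)
Lemma k_bounds (C eps x k : R) : 0 < C -> 0 < eps -> (8 * C ^ 2 + 1) ^ 4 <= x ->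
  0 <= k -> k <= C * Rpower x (1 / 8 - eps) ->
  4 * k ^ 2 <= x / 2 /\ k <= C * sqrt (sqrt x).
Proof.
  intros HC He Hx Hk0 Hk.
  assert (HC2 : 0 < C ^ 2) by (apply pow_lt; lra).
  assert (Hx1 : 1 <= x).
  { eapply Rle_trans; [|exact Hx]. rewrite <- (pow1 4); apply pow_incr; lra. }
  destruct (Rpower_quarters x) as [_ [_ E4]]; [lra|].
  set (d := sqrt (sqrt x)) in *.
  assert (Ed : d ^ 4 = x).
  { replace (d ^ 4) with ((d * d) * (d * d)) by ring.
    unfold d; rewrite sqrt_sqrt by apply sqrt_pos; apply sqrt_sqrt; lra. }
  assert (Hd0 : 0 <= d) by apply sqrt_pos.
  assert (Hd : 8 * C ^ 2 + 1 <= d).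
  { apply Rnot_lt_le; intros N.
    assert (d ^ 4 < (8 * C ^ 2 + 1) ^ 4); [|lra].
    assert (d ^ 2 < (8 * C ^ 2 + 1) ^ 2) by nra.
    replace (d ^ 4) with (d ^ 2 * d ^ 2) by ring.
    replace ((8 * C ^ 2 + 1) ^ 4) with ((8 * C ^ 2 + 1) ^ 2 * (8 * C ^ 2 + 1) ^ 2) by ring.
    apply Rmult_le_0_lt_compat; try assumption; apply pow2_ge_0. }
  set (h := Rpower x (1 / 8)).
  assert (Hh0 : 0 < h) by apply exp_pos.
  assert (Eh : h * h = d).
  { unfold h; rewrite <- Rpower_plus, <- E4; f_equal; field. }
  assert (Hkh : k <= C * h).
  { eapply Rle_trans; [exact Hk|]. apply Rmult_le_compat_l; [lra|].
    apply Rle_Rpower; lra. }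
  assert (Hh1 : 1 <= h) by nra.
  split.
  - assert (k ^ 2 <= C ^ 2 * d).
    { rewrite <- Eh; replace (C ^ 2 * (h * h)) with ((C * h) ^ 2) by ring. apply pow_incr; lra. }
    rewrite <- Ed. assert (d * d <= d ^ 4) by (replace (d ^ 4) with (d * d * (d * d)) by ring; nra). nra.
  - eapply Rle_trans; [exact Hkh|]. apply Rmult_le_compat_l; [lra|]. nra.
Qed.

Lemma truncated_sum_asym (c : nat -> nat -> nat) (P : Z -> R) (eps C : R) :
  (forall n, c 0%nat n = if Nat.eq_dec n 0 then 1%nat else 0%nat) ->
  (forall N n, c (S N) n
     = (c N n + if le_dec (S N) n then c (S N) (n - S N) else 0)%nat) ->
  (forall N n, (n <= N)%nat -> P (Z.of_nat n) = INR (c N n)) ->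
  0 < eps -> 0 < C ->
  exists (K : R) (N : nat), 0 < K /\
    forall n m : nat, (N <= n)%nat ->
      INR (S m) <= C * Rpower (INR n) (1 / 8 - eps) ->
      Rabs ((-1) ^ m * sum_f_R0 (fun j =>
          (-1) ^ j * (P (Z.of_nat n - Z.of_nat j * (3 * Z.of_nat j + 1) / 2)%Z
                      - P (Z.of_nat n - Z.of_nat j * (3 * Z.of_nat j + 5) / 2 - 1)%Z)) m
        - PI / (12 * sqrt 2) * INR (S m) * Rpower (INR n) (- (3 / 2))
          * exp (2 * PI * sqrt (INR n) / sqrt 6))
      <= K * INR (S m) ^ 3 * Rpower (INR n) (- (7 / 4))
         * exp (2 * PI * sqrt (INR n) / sqrt 6).
Proof.
  intros c0 cS HPc Heps HC.
  destruct (coef_diff_asym c c0 cS) as [K [X [HK [HX main]]]].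
  assert (HP := PI_RGT_0).
  set (A := PI / (12 * sqrt 2)) in *.
  assert (HA : 0 < A).
  { assert (0 < sqrt 2) by (apply sqrt_lt_R0; lra).
    apply Rmult_lt_0_compat; [lra|apply Rinv_0_lt_compat; lra]. }
  set (be := 2 * PI / sqrt 6).
  assert (Hr6 : 0 < sqrt 6) by (apply sqrt_lt_R0; lra).
  assert (Hbe : 0 < be) by (apply Rmult_lt_0_compat; [lra|now apply Rinv_0_lt_compat]).
  assert (Ebe : forall b, 2 * PI * b / sqrt 6 = be * b) by (intros b; unfold be; field; lra).
  (* All arguments are at least n / 2, so n >= 2 X keeps them in the range of [coef_diff_asym]; the
     other summand is the threshold of [k_bounds]. *)
  destruct (nat_floor_ex (2 * X + (8 * C ^ 2 + 1) ^ 4)) as [N0 HN0].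
  { assert (0 <= (8 * C ^ 2 + 1) ^ 4) by (apply pow_le; nra). lra. }
  (* 8 K covers the errors of the single differences, the second summand the variation of the main
     term over a window of length 4 k^2. *)
  exists (8 * K + 4 * A * (12 + be) * C), (S N0).
  split; [assert (0 < A * (12 + be) * C) by (apply Rmult_lt_0_compat; nra); lra|].
  intros n m Hn Hk.
  assert (Hx : 2 * X + (8 * C ^ 2 + 1) ^ 4 <= INR n).
  { apply le_INR in Hn; rewrite S_INR in Hn; lra. }
  assert (HY : 0 <= (8 * C ^ 2 + 1) ^ 4) by (apply pow_le; nra).
  set (k := INR (S m)) in *.
  assert (Hk1 : 1 <= k) by (apply (le_INR 1); lia).
  destruct (k_bounds C eps (INR n) k HC Heps) as [Hkx Hkd]; [lra|lra|exact Hk|].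
  set (x := INR n) in *.
  destruct (Rpower_quarters x) as [R1 [R2 _]]; [lra|].
  rewrite R1, R2; clear R1 R2.
  set (b := sqrt x) in *.
  assert (Ebb : b * b = x) by (apply sqrt_sqrt; lra).
  assert (Hb0 : 0 <= b) by apply sqrt_pos.
  assert (Hb : 1 <= b) by nra.
  set (d := sqrt b) in *.
  assert (Edd : d * d = b) by (apply sqrt_sqrt; lra).
  assert (Hd : 0 < d) by (apply sqrt_lt_R0; lra).
  rewrite Ebe.
  set (y := exp (be * b)).
  assert (Hy : 0 < y) by apply exp_pos.
  set (eta := (8 * K * / (b ^ 3 * d) + A * (12 + be) * (4 * k ^ 2) * / b ^ 4) * y).
  assert (step : forall z, (Z.of_nat n - 4 * Z.of_nat (S m) ^ 2 <= z <= Z.of_nat n)%Z ->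
    Rabs (P z - P (z - 1)%Z - A * / b ^ 3 * y) <= eta).
  { intros z [Hz1 Hz2].
    assert (Hzr : x - 4 * k ^ 2 <= IZR z <= x).
    { unfold x, k; rewrite !INR_IZR_INZ; split; [|now apply IZR_le].
      apply IZR_le in Hz1.
      rewrite minus_IZR, Z.pow_2_r, !mult_IZR in Hz1; lra. }
    assert (Hz0 : (1 <= z)%Z) by (apply le_IZR; lra).
    set (l := Z.to_nat z).
    assert (El : Z.of_nat l = z) by (unfold l; lia).
    assert (ElR : INR l = IZR z) by (rewrite INR_IZR_INZ; now rewrite El).
    assert (M1 := main l (sqrt (INR l))); specialize (M1 ltac:(lra) eq_refl).
    rewrite <- (HPc l l), <- (HPc l (l - 1)%nat), El in M1 by lia.
    replace (Z.of_nat (l - 1)) with (z - 1)%Z in M1 by lia.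
    rewrite Ebe in M1.
    set (a := sqrt (INR l)) in *.
    assert (Ea : a * a = INR l) by (apply sqrt_sqrt; lra).
    assert (Ha0 : 0 <= a) by apply sqrt_pos.
    assert (Hab : a <= b) by (apply Rsqr_incr_0; unfold Rsqr; lra).
    destruct (exp_over_cube_shift be a b (x - INR l)) as [S1 S2]; [lra|lra|lra|nra|nra|].
    fold d in S1; fold y in S2.
    assert (Hya : 0 < exp (be * a) <= y) by (split; [apply exp_pos|apply exp_le; nra]).
    assert (Hb4 : 0 < / b ^ 4) by (apply Rinv_0_lt_compat, pow_lt; lra).
    replace (P z - P (z - 1)%Z - A * / b ^ 3 * y)
      with ((P z - P (z - 1)%Z - A / a ^ 3 * exp (be * a))
            + A * (/ a ^ 3 * exp (be * a) - / b ^ 3 * y)) by (unfold Rdiv; ring).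
    eapply Rle_trans; [apply Rabs_triang|].
    unfold eta; rewrite (Rmult_plus_distr_r _ _ y); apply Rplus_le_compat.
    - eapply Rle_trans; [exact M1|].
      apply Rmult_le_compat; [|lra| |lra].
      + apply Rmult_le_pos; [lra|]. left; apply Rinv_0_lt_compat.
        assert (0 < a) by nra.
        apply Rmult_lt_0_compat; [now apply pow_lt|now apply sqrt_lt_R0].
      + replace (8 * K * / (b ^ 3 * d)) with (K * (8 * / (b ^ 3 * d))) by ring.
        apply Rmult_le_compat_l; [lra|exact S1].
    - rewrite Rabs_mult, (Rabs_right A) by lra.
      replace (A * (12 + be) * (4 * k ^ 2) * / b ^ 4 * y)
        with (A * ((12 + be) * (4 * k ^ 2) * / b ^ 4 * y)) by ring.
      apply Rmult_le_compat_l; [lra|].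
      eapply Rle_trans; [exact S2|].
      apply Rmult_le_compat_r; [lra|]. apply Rmult_le_compat_r; [lra|].
      apply Rmult_le_compat_l; lra. }
  assert (AS := alternating_sum_approx P (Z.of_nat n) m _ _ step); fold k in AS.
  replace (A * k * / b ^ 3 * y) with (k * (A * / b ^ 3 * y)) by ring.
  eapply Rle_trans; [exact AS|].
  unfold eta.
  replace (k ^ 2 * ((8 * K * / (b ^ 3 * d) + A * (12 + be) * (4 * k ^ 2) * / b ^ 4) * y))
    with ((8 * K * k ^ 2 * / (b ^ 3 * d) + 4 * A * (12 + be) * (k ^ 3 * (k * / b ^ 4))) * y) by ring.
  (* C / (b^3 d) = C d / b^4 because d^2 = b, so it remains to compare k^2 with k^3 and k with C
     d. *)
  replace ((8 * K + 4 * A * (12 + be) * C) * k ^ 3 * / (b ^ 3 * d) * y)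
    with ((8 * K * k ^ 3 * / (b ^ 3 * d) + 4 * A * (12 + be) * (k ^ 3 * (C * d * / b ^ 4))) * y)
    by (rewrite <- Edd; field; lra).
  apply Rmult_le_compat_r; [lra|apply Rplus_le_compat].
  - apply Rmult_le_compat_r.
    + left; apply Rinv_0_lt_compat, Rmult_lt_0_compat; [apply pow_lt; lra|lra].
    + apply Rmult_le_compat_l; [lra|]. apply Rle_pow; [lra|lia].
  - apply Rmult_le_compat_l.
    + apply Rmult_le_pos; [lra|lra].
    + apply Rmult_le_compat_l; [apply pow_le; lra|].
      apply Rmult_le_compat_r; [left; apply Rinv_0_lt_compat, pow_lt; lra|exact Hkd].
Qed.

Require Import Defs.
From mathcomp Require Import all_boot.

(** * Recurrence for partitions with bounded parts *)

Local Open Scope nat_scope.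

(* Partitions of n into parts at most N; the first argument only bounds the
   recursion depth, and is large enough as soon as it is at least N + n. *)
Fixpoint parts (f N n : nat) : seq (seq nat) :=
  match f, N with
  | f'.+1, N'.+1 =>
      parts f' N' n ++
      (if N'.+1 <= n then [seq N'.+1 :: s | s <- parts f' N'.+1 (n - N'.+1)] else [::])
  | _, _ => if n == 0 then [:: [::]] else [::]
  end.

(** Parts decrease weakly, so the head is the largest part: head N + 1 belongs to the second list of
    [parts], a smaller head to the first. *)
Lemma mem_parts (f N n : nat) (s : seq nat) : N + n <= f ->
  (s \in parts f N n) = is_partition n s && all (fun i => i <= N) s.
Proof.
have base m t : (t \in if m == 0 then [:: [::]] else [::])
    = is_partition m t && all (fun i => i <= 0) t.
  rewrite /is_partition; case: t => [|x t] /=.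
    by rewrite andbT [0 == m]eq_sym; case: (m == 0).
  have -> : (x :: t \in if m == 0 then [:: [::]] else [::]) = false by case: (m == 0).
  by rewrite inE negb_or leqn0; case: x => [|x] /=; rewrite ?andbF.
elim: f N n s => [|f IHf] [|N] n s /=; try by move=> _; exact: base.
  by rewrite addSn.
rewrite addSn ltnS => le_f; rewrite mem_cat IHf //.
have le_fN : N.+1 <= n -> N.+1 + (n - N.+1) <= f.
  by move=> le_n; rewrite subnKC // (leq_trans _ le_f) // leq_addl.
have geq_trans : transitive geq by move=> a b c /= ba ac; apply: leq_trans ac ba.
case: s => [|x s] /=.
  rewrite /is_partition /= orb_idr //.
  by case: ifP => // _ /mapP[].
rewrite /is_partition /= !inE !negb_or (path_sortedE geq_trans).
case: (ltngtP x N.+1) => [xN|xN|->].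
- have -> : (x :: s \in if N < n then [seq N.+1 :: s0 | s0 <- parts f N.+1 (n - N.+1)] else [::]) = false.
    by case: ifP => // _; apply/mapP => -[t _ [ex _]]; rewrite ex ltnn in xN.
  rewrite orbF -ltnS xN /=; case all_x: (all (geq x) s) => //=.
  have -> : all (fun i => i <= N) s.
    by apply: sub_all all_x => i /= ix; rewrite (leq_trans ix).
  have -> // : all (fun i => i <= N.+1) s.
  by apply: sub_all all_x => i /= ix; rewrite (leq_trans ix) // ltnW.
- have -> : (x <= N) = false by apply/negbTE; rewrite -ltnNge // ltnW.
  rewrite /= !andbF; case: ifP => // _.
  by apply/mapP => -[t _ [ex _]]; rewrite ex ltnn in xN.
- rewrite ltnn andbF /=; case: ifP => le_n.
    rewrite mem_map; last by move=> ? ? [].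
    rewrite IHf ?le_fN // /is_partition /=.
    have -> : (N.+1 + sumn s == n) = (sumn s == n - N.+1).
      by rewrite -{1}(subnKC le_n) eqn_add2l.
    have -> : all (geq N.+1) s = all (fun i => i <= N.+1) s by [].
    by case: (all _ s); rewrite ?andbF ?andbT //= andbF.
  apply/esym/negP => /andP[/and3P[_ _ /eqP e] _].
  by rewrite -e leq_addr in le_n.
Qed.

(** The two lists are disjoint because only members of the second contain the part N + 1. *)
Lemma uniq_parts (f N n : nat) : N + n <= f -> uniq (parts f N n).
Proof.
have base m : uniq (if m == 0 then [:: [::]] else [::] : seq (seq nat)) by case: eqP.
elim: f N n => [|f IHf] [|N] n //=; rewrite addSn ltnS => le_f.
have le_fN : N.+1 <= n -> N.+1 + (n - N.+1) <= f.
  by move=> le_n; rewrite subnKC // (leq_trans _ le_f) // leq_addl.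
rewrite cat_uniq IHf //=; case: ifP => //= le_n.
rewrite map_inj_uniq ?IHf ?le_fN //; last by move=> ? ? [].
rewrite andbT; apply/hasPn => _ /mapP[t _ ->].
by rewrite mem_parts // /= ltnn /= !andbF.
Qed.

Definition npart (N n : nat) : nat := size (parts (N + n) N n).

(** Duplicate-free lists with the same members have the same length, so the recursion depth does not
    matter. *)
Lemma size_parts (f N n : nat) : N + n <= f -> size (parts f N n) = npart N n.
Proof.
move=> le_f; apply/perm_size/uniq_perm; rewrite ?uniq_parts // => s.
by rewrite !mem_parts.
Qed.

Lemma npart0 (n : nat) : npart 0 n = (n == 0).
Proof. by rewrite /npart; case: n. Qed.

Lemma npartS (N n : nat) :
  npart N.+1 n = npart N n + (if N.+1 <= n then npart N.+1 (n - N.+1) else 0).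
Proof.
rewrite {1}/npart addSn /= size_cat size_parts //; congr (_ + _).
case: ifP => //= le_n; rewrite size_map size_parts // subnKC //.
exact: leq_addl.
Qed.

(** No part of a partition of n exceeds n <= N, so the bound on the parts excludes nothing;
    [map val] matches bounded sequences with lists. *)
Lemma p_npart (N n : nat) : n <= N -> p (Z.of_nat n) = npart N n.
Proof.
move=> le_nN; rewrite /p.
have -> : (Z.of_nat n <? 0)%Z = false by apply/Z.ltb_ge; exact: Nat2Z.is_nonneg.
rewrite Nat2Z.id cardE -(size_map (fun s : n.-bseq 'I_n.+1 => map val s)).
apply/perm_size/uniq_perm.
- rewrite map_inj_uniq ?enum_uniq // => s t /= /(inj_map val_inj) e.
  exact: val_inj.
- exact: uniq_parts.
move=> s; rewrite mem_parts //; apply/mapP/andP => [[t] | [Ps _]].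
  rewrite mem_enum inE => Pt ->; split=> //.
  by apply/allP => _ /mapP[i _ ->]; apply: leq_trans le_nN; rewrite -ltnS; exact: ltn_ord.
by have [t tP <-] := is_partition_bseq Ps; exists t; rewrite // mem_enum.
Qed.

Local Open Scope R_scope.

Theorem theorem1p1 (eps C : R) (heps : 0 < eps) (hC : 0 < C) :
  exists (K : R) (N : nat), 0 < K /\
    forall n k : nat, (N <= n)%N -> (1 <= k)%N ->
      INR k <= C * Rpower (INR n) (1 / 8 - eps) ->
      Rabs (M k n - PI / (12 * sqrt 2) * INR k * Rpower (INR n) (- (3 / 2))
                    * exp (2 * PI * sqrt (INR n) / sqrt 6))
      <= K * INR k ^ 3 * Rpower (INR n) (- (7 / 4))
         * exp (2 * PI * sqrt (INR n) / sqrt 6).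
Proof.
(* The counting part uses Boolean tests, the analytic part [Nat.eq_dec] and [le_dec]; the next three
   facts translate. *)
have c0 n : npart 0 n = match Nat.eq_dec n 0 with left _ => 1%N | right _ => 0%N end.
  by rewrite npart0; case: n.
have cS N n : npart (S N) n
    = Nat.add (npart N n) (match le_dec (S N) n with
       | left _ => npart (S N) (Nat.sub n (S N)) | right _ => 0%N end).
  rewrite npartS; case: le_dec => le_Nn.
    by rewrite (introT leP le_Nn).
  by rewrite (introF leP le_Nn).
have Pc N n : (n <= N)%coq_nat -> INR (p (Z.of_nat n)) = INR (npart N n).
  by move=> /leP le_nN; rewrite (p_npart _ _ le_nN).
have [K [N [K0 main]]] := truncated_sum_asym _ (fun z => INR (p z)) eps C c0 cS Pc heps hC.
(* k = m + 1, so the exponent and the last index k - 1 in [M] become m. *)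
exists K, N; split=> // n [|m] // /leP le_Nn _ le_k.
have -> : M (S m) n = (-1) ^ m * sum_f_R0 (fun j =>
    (-1) ^ j * (INR (p (Z.of_nat n - Z.of_nat j * (3 * Z.of_nat j + 1) / 2)%Z)
    - INR (p (Z.of_nat n - Z.of_nat j * (3 * Z.of_nat j + 5) / 2 - 1)%Z))) m.
  by rewrite /M subSS subn0.
exact: main.
Qed.
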